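(* For any positive integer $m$, the set $\mathcal P$ of all rational primes can be written as a union of pairwise disjoint sets $\mathcal S_1,\ldots,\mathcal S_m$, each of upper density $1$, such that for all $i$ we have $\operatorname{HTP}(\mathbb{Z}[\mathcal S_i^{-1}])\le_T\operatorname{HTP}(\mathbb{Q})$ and $\mathcal S_i\le_T\operatorname{HTP}(\mathbb{Q})$.
   Context: For a set $\mathcal S$ of rational primes, $\mathbb{Z}[\mathcal S^{-1}]$ is the subring of $\mathbb{Q}$ obtained by inverting the primes in $\mathcal S$. The upper density of a set $\mathcal S$ of primes is $\limsup_{x\to\infty} \#\{p\in\mathcal S: p\le x\}/\#\{p \text{ prime}: p\le x\}$. For a subring $R\subseteq\mathbb{Q}$, $\operatorname{HTP}(R)$ is the set of (indices, under a fixed computable enumeration, of) polynomials with integer coefficients in finitely many variables that have a zero with all coordinates in $R$. $\le_T$ denotes Turing reducibility; sets of primes are regarded as subsets of $\mathbb{Z}_{>0}$. *)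

(* Defs.v *)
From mathcomp Require Import all_boot all_order all_algebra.
From mathcomp Require Import all_classical all_reals all_analysis.
(* The notations of mpoly are incompatible with those of mathcomp-analysis. *)
From mathcomp Require Import -(notations) mpoly.

Set Implicit Arguments.
Unset Strict Implicit.
Unset Printing Implicit Defensive.

Import Order.TTheory GRing.Theory Num.Theory.

Local Open Scope classical_set_scope.
Local Open Scope ring_scope.

(* Codes of n-ary partial recursive functions with one oracle. *)
Inductive orec : nat -> Type :=
| OZero (n : nat) : orec n
| OSucc : orec 1
| OProj (n : nat) (i : 'I_n) : orec n
| OOracle : orec 1
| OComp (n k : nat) (f : orec k) (g : 'I_k -> orec n) : orec n
| ORec (n : nat) (f : orec n) (g : orec n.+2) : orec n.+1
| OMin (n : nat) (f : orec n.+1) : orec n.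

(* [ocomputes B f v y]: with oracle the characteristic function of [B], the
   function coded by [f] converges on input [v], with value [y].
   - [ORec f g] is h with h(0, w) = f(w) and h(i+1, w) = g(i, h(i, w), w);
     [s] lists the successive values h(0, w), h(1, w), ...
   - [OMin f] maps v to the least y with f(y, v) = 0, where f must converge on
     all smaller arguments. *)
Fixpoint ocomputes (B : set nat) (n : nat) (f : orec n) :
    n.-tuple nat -> nat -> Prop :=
  match f in orec n return n.-tuple nat -> nat -> Prop with
  | OZero _ => fun v y => y = 0%N
  | OSucc => fun v y => y = (thead v).+1
  | OProj _ i => fun v y => y = tnth v i
  | OOracle => fun v y => (B (thead v) /\ y = 1%N) \/ (~ B (thead v) /\ y = 0%N)
  | OComp _ k f g => fun v y =>
      exists2 w : k.-tuple nat,
        forall i, ocomputes B (g i) v (tnth w i) & ocomputes B f w y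
  | ORec _ f g => fun v y =>
      let w := [tuple of behead v] in
      exists s : nat -> nat,
        [/\ ocomputes B f w (s 0%N),
            forall i, (i < thead v)%N ->
              ocomputes B g [tuple of i :: s i :: w] (s i.+1)
          & y = s (thead v)]
  | OMin _ f => fun v y =>
      ocomputes B f [tuple of y :: v] 0%N /\
      forall i, (i < y)%N -> exists z, ocomputes B f [tuple of i :: v] z.+1
  end.

Definition turing_le (A B : set nat) : Prop :=
  exists f : orec 1, forall x,
    (A x -> ocomputes B f [tuple x] 1%N) /\
    (~ A x -> ocomputes B f [tuple x] 0%N).

(* Enumeration of the polynomials with integer coefficients in finitely many
   variables, through the bijection [CodeSeq.decode : nat -> seq nat]. A
   polynomial is coded by [:: n; m_1; ...; m_k], with n the number of variables
   and each m_j coding a monomial [:: c; e_0; ...; e_(n-1)], with c a coded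
   coefficient and e_i the exponent of the variable i. Missing entries are read
   as 0 and exponents e_i with i >= n are ignored, so that every natural number
   is a code. *)
Definition int_of_code (c : nat) : int :=
  if odd c then Negz c./2 else Posz c./2.

Definition monomial_of_code (n m : nat) : mpoly n int :=
  let s := CodeSeq.decode m in
  int_of_code (head 0%N s) *:
    mpolyX int (Multinom [tuple nth 0%N (behead s) i | i < n]).

Definition poly_nvars (k : nat) : nat := head 0%N (CodeSeq.decode k).

Definition poly_of_code (k : nat) : mpoly (poly_nvars k) int :=
  \sum_(m <- behead (CodeSeq.decode k)) monomial_of_code (poly_nvars k) m.

Lemma poly_of_code_surj (n : nat) (p : mpoly n int) :
  exists k, existT (fun n => mpoly n int) (poly_nvars k) (poly_of_code k)
            = existT (fun n => mpoly n int) n p.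
Proof.
pose cint (c : int) := match c with Posz a => a.*2 | Negz a => a.*2.+1 end.
have cintK : cancel cint int_of_code.
  by case=> a; rewrite /int_of_code /= ?odd_double ?doubleK //= uphalf_double.
pose cmon (m : multinom n) :=
  CodeSeq.code (cint (mcoeff m p) :: multinom_val m : seq nat).
exists (CodeSeq.code (n :: map cmon (msupp p))).
rewrite /poly_of_code /poly_nvars CodeSeq.codeK /= big_map; congr existT.
rewrite [RHS]mpolyE; apply: eq_bigr => m _.
rewrite /monomial_of_code CodeSeq.codeK /= cintK; congr (_ *: mpolyX _ _).
by apply/mnmP => i; rewrite mnmE /= -tnth_nth.
Qed.

Definition HTP (A : set rat) : set nat :=
  [set k | exists2 v : 'I_(poly_nvars k) -> rat,
      forall i, A (v i) & meval v (map_mpoly intr (poly_of_code k)) = 0].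

(* The localization Z[S^-1], as a subset of Q. *)
Definition Zinv (S : set nat) : set rat :=
  [set q | exists (a : int) (s : seq nat),
      (forall p, p \in s -> S p) /\ q = a%:~R / (\prod_(p <- s) p)%N%:R].

Definition primes_upto (S : set nat) (x : nat) : nat :=
  #|[set p : 'I_x.+1 | prime p && `[< S p >]]%SET|.

(* Both counts are constant between consecutive integers, so the limsup over
   real x is the limsup over natural x. *)
Definition upper_density (R : realType) (S : set nat) : \bar R :=
  limn_esup (fun x : nat =>
    ((primes_upto S x)%:R / (primes_upto [set: nat] x)%:R)%:E).

(* Main.v *)
Require Import Defs.
From mathcomp Require Import all_boot all_order all_algebra.
From mathcomp Require Import all_classical all_reals all_analysis.
From mathcomp Require Import all_fingroup all_solvable all_field.
From mathcomp Require Import -(notations) mpoly.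
From mathcomp Require Import zify ring lra.

(* The primes are coloured in stages, the class of the colour i being S_i. Stage n = k * m + i treats the
   k-th polynomial f and the colour i. Only finitely many numbers have a colour by then; let F be the finite
   set of primes whose colour is not i, and Z_F the ring of the rationals whose denominators are prime to F.
   Since Z[S_i^-1] will lie in Z_F, f has no zero over Z[S_i^-1] if it has none over Z_F. If f has a zero over
   Z_F, one is found by search, and giving the colour i to all new primes up to its largest denominator puts
   the zero in Z[S_i^-1]. Going on with the colour i until the primes coloured earlier have proportion at most
   1 / (n + 2) makes the upper density of S_i equal to 1. All this is recursive in HTP(Q) provided that
   zeros over Z_F can be decided from HTP(Q), uniformly in F, that is, provided that Z_F is Diophantine over Q
   uniformly in F.

   To see this, let c be such that kap = 4c - 1 is prime and x^2 + xy + cy^2 is anisotropic modulo 2 and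
   modulo every p in F, and let N be squarefree and divisible exactly by these primes. Comparing valuations,
   1 + N (X^2 + Xw + cw^2) = Y^2 + YZ + cZ^2 forces X and w to be p-integral for p | N. Conversely, for every
   integer k this equation is solvable with 2X + w = 4 kap k, by Legendre's theorem on ternary forms; the prime
   that makes Legendre's local conditions hold has prescribed quadratic characters. So every integer tau has a
   rational certificate (write tau = 4k + e1 + 2 e2 with e1, e2 in {0, 1}), and certified numbers are p-integral
   for p | N. For N0 the product of F, a rational q lies in Z_F iff q (1 + N0 s) = y for certified s and y: if
   b is the denominator of q, take 1 + N0 s = b^phi(N0).

   Primes with prescribed quadratic characters are obtained from Mertens-type sums, which only need L(1, chi)
   to be nonzero for real characters chi. *)

Set Implicit Arguments.
Unset Strict Implicit.
Unset Printing Implicit Defensive.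

Import Order.TTheory GRing.Theory Num.Theory.
Local Open Scope ring_scope.

(** * Quadratic reciprocity *)

(** The form x^2 + xy + cy^2 has discriminant -kap, and four times it is (2x + y)^2 + kap y^2. It
    has a middle term because every diagonal binary form is isotropic modulo 2, while 2 may lie in
    F. Multiplied by 4, the equation asks that 4 B0 + N kap w^2, with B0 = 1 + 4 N kap^2 k^2, be a
    value of U^2 + kap V^2. An auxiliary prime t splits this into two conics: t has to be
    represented, up to squares, both by A x^2 + N kap y^2, where A is the squarefree part of B0, and
    by y^2 + kap z^2. The conditions on t are Legendre symbols and a residue modulo 8, which is why
    real characters suffice. N always contains the factor 2, even when 2 is not in F: then A N kap
    and N kap t are twice odd numbers, hence not squares, and the degenerate outcomes of the
    pigeonhole argument disappear. The certified numbers are only known to lie between the integers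
    and the p-integral numbers, so they do not define Z_F themselves; in q (1 + N0 s) = y the factor
    of q is a unit at every p dividing N0. As F changes with the stage, c cannot be fixed in advance
    and is itself found by search. *)

Definition leg (p n : nat) : int :=
  if (p %| n)%N then 0
  else if [exists x : 'I_p, (x ^ 2 == n %[mod p])%N] then 1 else -1.

Lemma leg_mod (p n : nat) : leg p (n %% p)%N = leg p n.
Proof.
by rewrite /leg /dvdn !modn_mod.
Qed.

Lemma Fp_eq (p m n : nat) : prime p ->
  ((m%:R == n%:R :> 'F_p) = (m == n %[mod p])%N).
Proof.
move=> pp; rewrite -[m%:R]Fp_nat_mod // -[n%:R]Fp_nat_mod //.
apply/eqP/eqP => [|-> //] /(congr1 val) /=.
by rewrite !val_Fp_nat // !modn_mod.
Qed.

Lemma Fp_eq0 (p n : nat) : prime p -> ((n%:R == 0 :> 'F_p) = (p %| n)%N).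
Proof. by move=> pp; rewrite -[0]/(0%:R) Fp_eq // mod0n. Qed.

Lemma finField_prim_root (F : finFieldType) :
  exists z : F, #|F|.-1.-primitive_root z.
Proof.
have F1 : (1 < #|F|)%N by apply: finNzRing_gt1.
have := @has_prim_root F #|F|.-1 (enum [pred x : F | x != 0]).
case/(_ _ _ _ _)/hasP => //; first by case: #|F| F1 => [|[]].
- apply/allP => x; rewrite mem_enum inE => x0; apply/unity_rootP.
  apply: (mulfI x0); rewrite -exprS mulr1 prednK ?expf_card //.
  by case: #|F| F1.
- exact: enum_uniq.
- by rewrite -cardE -(cardC1 (0 : F)).
by move=> z _ hz; exists z.
Qed.

Lemma euler_criterion (p n : nat) : prime p -> odd p ->
  (n%:R ^+ p./2 = (leg p n)%:~R :> 'F_p).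
Proof.
move=> pp op; have p2 : p = (p./2.*2.+1)%N by rewrite -[LHS]odd_double_half op.
have h0 : (0 < p./2)%N by rewrite half_gt0 prime_gt1.
rewrite /leg; case: ifPn => [/[dup] pn|npn].
  by rewrite -Fp_eq0 // => /eqP ->; rewrite expr0n; case: p./2 h0.
have n0 : n%:R != 0 :> 'F_p by rewrite Fp_eq0.
have [z] := finField_prim_root 'F_p; rewrite card_Fp // [p.-1](_ : _ = p./2.*2)%N => [hz|]; last by rewrite {1}p2.
have fermat (y : 'F_p) : y != 0 -> y ^+ p./2.*2 = 1.
  move=> y0; apply: (mulfI y0); rewrite -exprS -p2 mulr1.
  by rewrite -[RHS]expf_card card_Fp.
case: ifPn => [/existsP[x] /eqP xn|nx].
  have xn' : (x%:R ^+ 2 = n%:R :> 'F_p).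
    by apply/eqP; rewrite -natrX Fp_eq //; apply/eqP.
  rewrite -xn' -exprM mul2n fermat //.
  by apply: contraNneq n0 => x0; rewrite -xn' x0 expr0n.
have [i ni] := prim_rootP hz (fermat _ n0).
have zh : z ^+ p./2 = -1.
  have /eqP: (z ^+ p./2) ^+ 2 = 1 by rewrite -exprM muln2 (prim_expr_order hz).
  rewrite sqrf_eq1 => /orP[|/eqP //].
  by rewrite -(prim_order_dvd hz) => /dvdn_leq; rewrite -addnn => /(_ h0); lia.
rewrite ni -exprM mulnC exprM zh -signr_odd.
suff -> : odd i by rewrite expr1.
apply: contraNT nx => ei; apply/existsP.
have hx : (((z ^+ (i./2)) : nat) < p)%N by rewrite -[X in (_ < X)%N](card_Fp pp) card_ord; apply: ltn_ord.
exists (Ordinal hx) => /=; rewrite -Fp_eq // natrX natr_Zp -exprM ni muln2 even_halfK //.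
Qed.

Lemma leg_cases (p n : nat) : [\/ leg p n = 0, leg p n = 1 | leg p n = -1].
Proof.
rewrite /leg; case: ifP => _; first by constructor 1.
by case: ifP => _; [constructor 2 | constructor 3].
Qed.

Lemma leg_eq0 (p n : nat) : (leg p n == 0) = (p %| n)%N.
Proof. by rewrite /leg; case: ifP => // _; case: ifP. Qed.

(** The values 0, 1 and -1 stay distinct in odd characteristic, so identities between Legendre
    symbols may be verified in any field of characteristic [q]. *)
Lemma legF_inj (F : fieldType) (q : nat) (a b : int) :
  q \in [pchar F] -> odd q ->
  [\/ a = 0, a = 1 | a = -1] -> [\/ b = 0, b = 1 | b = -1] ->
  a%:~R = b%:~R :> F -> a = b.
Proof.
move=> hq oq ha hb; move/eqP; rewrite -subr_eq0 -rmorphB /=.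
have h1 : 1 != 0 :> F by apply: oner_neq0.
have h2 : 2%:R != 0 :> F.
  rewrite -(dvdn_pcharf hq); apply/negP => /dvdn_leq => /(_ isT).
  by case: q hq oq => [|[|[|]]] //; case/andP.
have hm1 : (-1)%:~R != 0 :> F by rewrite rmorphN1 oppr_eq0.
have hm2 : (-2)%:~R != 0 :> F by rewrite rmorphN oppr_eq0.
by case: ha => ->; case: hb => -> //; rewrite ?subr0 ?sub0r ?opprK ?rmorph1 ?(negPf h1) ?(negPf hm1) //= => h; move: h2 hm2; rewrite -?[-1 - 1]/(-2) -?[1+1]/2 in h *; rewrite ?h // ?(eqP h) eqxx.
Qed.

Lemma leg1 (p : nat) : prime p -> leg p 1 = 1.
Proof.
move=> pp; have p1 := prime_gt1 pp.
rewrite /leg dvdn1 gtn_eqF //; case: existsP => // -[].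
by exists (Ordinal p1).
Qed.

Lemma legM (p m n : nat) : prime p -> odd p -> leg p (m * n)%N = leg p m * leg p n.
Proof.
move=> pp op; apply: (@legF_inj 'F_p p) => //.
- exact: pchar_Fp.
- exact: leg_cases.
- by case: (leg_cases p m) => ->; case: (leg_cases p n) => ->; rewrite ?mulr0 ?mul0r ?mulr1 ?mul1r;
    [constructor 1| constructor 1| constructor 1| constructor 1| constructor 2 | constructor 3|constructor 1|constructor 3|constructor 2].
by rewrite rmorphM /= -!euler_criterion // natrM exprMn.
Qed.

Lemma leg_sqr (p n : nat) : prime p -> odd p -> ~~ (p %| n)%N -> leg p (n * n)%N = 1.
Proof.
move=> pp op; rewrite -leg_eq0 legM //.
by case: (leg_cases p n) => ->.
Qed.

Lemma leg_eq1_sqrt (p n : nat) : leg p n = 1 -> exists x : nat, (x ^ 2 = n %[mod p])%N.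
Proof.
rewrite /leg; case: ifP => // _; case: ifP => // /existsP[x /eqP hx] _.
by exists x.
Qed.

Lemma leg_sum0 (p : nat) : prime p -> odd p -> exists n : nat, leg p n = -1.
Proof.
move=> pp op; have [z] := finField_prim_root 'F_p; rewrite card_Fp // => hz.
exists (z : nat); have p2 : p = (p./2.*2.+1)%N by rewrite -[LHS]odd_double_half op.
have p3 : (2 < p)%N by move: pp op; case: p {hz z p2} => [|[|[|]]].
apply: (@legF_inj 'F_p p) => //.
- exact: pchar_Fp.
- exact: leg_cases.
- by constructor 3.
have hzp : z ^+ p./2 != 1.
  rewrite -(prim_order_dvd hz); apply/negP => /dvdn_leq; lia.
rewrite -euler_criterion // natr_Zp rmorphN1.
have /eqP: (z ^+ p./2) ^+ 2 = 1.
  by rewrite -exprM -[RHS](prim_expr_order hz) muln2; congr (_ ^+ _); lia.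
by rewrite sqrf_eq1 (negPf hzp) => /eqP.
Qed.

Section GaussSum.
Variables (p q : nat) (F : fieldType) (z : F).
Hypotheses (pp : prime p) (op : odd p) (qq : prime q) (oq : odd q).
Hypotheses (hF : q \in [pchar F]) (hz : p.-primitive_root z) (npq : p != q).

Let e (x : 'F_p) : F := z ^+ (x : nat).
Let chi (x : 'F_p) : int := leg p (x : nat).

Let e_nat n : e n%:R = z ^+ n.
Proof. by rewrite /e val_Fp_nat // prim_expr_mod. Qed.
Let eD x y : e (x + y) = e x * e y.
Proof. by rewrite -{1}[x]natr_Zp -{1}[y]natr_Zp -natrD e_nat exprD. Qed.
Let chi_nat n : chi n%:R = leg p n.
Proof. by rewrite /chi val_Fp_nat // leg_mod. Qed.
Let chiM x y : chi (x * y) = chi x * chi y.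
Proof. by rewrite -{1}[x]natr_Zp -{1}[y]natr_Zp -natrM chi_nat legM. Qed.
Let chi0 : chi 0 = 0.
Proof. by apply/eqP; rewrite /chi leg_eq0 dvdn0. Qed.

Let chi_sqr x : x != 0 -> chi x * chi x = 1.
Proof.
move=> x0; have : chi x != 0 by rewrite leg_eq0 -Fp_eq0 // natr_Zp.
by rewrite /chi; case: (leg_cases p x) => ->.
Qed.

Let sum_chi : \sum_x chi x = 0.
Proof.
have [n hn] := leg_sum0 pp op.
have n0 : n%:R != 0 :> 'F_p by rewrite Fp_eq0 // -leg_eq0 hn.
have : \sum_x chi x = - \sum_x chi x.
  rewrite {1}(reindex_inj (mulfI n0)) /= -sumrN; apply: eq_bigr => x _.
  by rewrite chiM chi_nat hn mulN1r.
lia.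
Qed.

Let sum_e (c : 'F_p) : c != 0 -> \sum_x e (c * x) = 0.
Proof.
move=> c0; transitivity (\sum_x e x); first by rewrite [RHS](reindex_inj (mulfI c0)).
have e1 : e 1 != 1.
  rewrite -[1]/(1%:R) e_nat expr1 -[z]expr1 -(prim_order_dvd hz) dvdn1.
  by rewrite gtn_eqF ?prime_gt1.
have : e 1 * \sum_x e x = \sum_x e x.
  by rewrite mulr_sumr [RHS](reindex_inj (addrI 1)) /=; apply: eq_bigr => x _; rewrite eD.
move/eqP; rewrite -subr_eq0 -{2}[\sum_x _]mul1r -mulrBl mulf_eq0 subr_eq0 (negPf e1).
by move/eqP.
Qed.

(** The quadratic Gauss sum, formed with a root of unity in characteristic [q] rather than over the
    complex numbers, so that raising to the power [q] is a ring morphism. *)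
Let g : F := \sum_x (chi x)%:~R * e x.

Let g_sqr : g ^+ 2 = (chi (-1))%:~R * p%:R.
Proof.
have -> : g ^+ 2 = \sum_x \sum_y (chi (x * y))%:~R * e (x + y).
  rewrite expr2 /g mulr_suml; apply: eq_bigr => x _.
  rewrite mulr_sumr; apply: eq_bigr => y _.
  by rewrite chiM rmorphM eD /= mulrACA.
have -> : \sum_x \sum_y (chi (x * y))%:~R * e (x + y) =
   \sum_(x | x != 0) \sum_y (chi y)%:~R * e ((1 + y) * x).
  rewrite (bigD1 0) //= big1 ?add0r => [|y _]; last by rewrite mul0r chi0 mul0r.
  (* Replacing [y] by [x * y] leaves only [chi y], since [chi x] squares to 1; the sum over [x] then
     involves roots of unity alone. *)
  apply: eq_bigr => x x0; rewrite (reindex_inj (mulfI x0)) /=.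
  apply: eq_bigr => y _; rewrite mulrA !chiM chi_sqr // mul1r.
  by congr (_ * e _); ring.
rewrite exchange_big /=.
transitivity (\sum_y (chi y)%:~R * ((if y == -1 then p%:R else 0) - 1) : F).
  apply: eq_bigr => y _; rewrite -mulr_sumr; congr (_ * _).
  have -> : \sum_(x | x != 0) e ((1 + y) * x) = \sum_x e ((1 + y) * x) - 1.
    by rewrite [in RHS](bigD1 0) //= mulr0 /e expr0 addrC addrK.
  congr (_ - _); case: eqP => [->|/eqP y1].
    rewrite subrr (eq_bigr (fun=> 1)) => [|x _]; last by rewrite mul0r /e expr0.
    by rewrite sumr_const card_Fp.
  by apply: sum_e; rewrite addrC -[1]opprK subr_eq0.
rewrite (eq_bigr (fun y => (chi y)%:~R * (if y == -1 then p%:R else 0) - (chi y)%:~R)).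
  rewrite sumrB (bigD1 (-1)) //= eqxx big1 ?addr0.
    by rewrite -rmorph_sum /= sum_chi subr0.
  by move=> y /negPf ->; rewrite mulr0.
by move=> y _; rewrite mulrBr mulr1.
Qed.

Let g_q : g ^+ q = (leg p q)%:~R * g.
Proof.
have q0 : q%:R != 0 :> 'F_p by rewrite Fp_eq0 // dvdn_prime2.
rewrite -(pFrobenius_autE hF) rmorph_sum /= /g [in RHS](reindex_inj (mulfI q0)) /= mulr_sumr.
apply: eq_bigr => x _; rewrite pFrobenius_autE exprMn mulrA -rmorphM /= chiM mulrA chi_nat.
have -> : leg p q * leg p q = 1 by rewrite -chi_nat chi_sqr.
rewrite mul1r; congr (_ * _).
  rewrite -rmorphXn /=; congr (_%:~R); rewrite /chi.
  case: (leg_cases p x) => ->; first by rewrite expr0n; case: (q) oq.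
    by rewrite expr1n.
  by rewrite -signr_odd oq expr1.
by rewrite -{2}[x]natr_Zp -natrM e_nat /e -exprM mulnC.
Qed.

(** Two evaluations of [g ^+ q] are compared: Frobenius gives [leg p q] times [g], while [g_sqr] and
    Euler's criterion modulo [q] give the right-hand side times [g]. *)
Lemma gauss_sum_leg : leg p q = leg p p.-1 ^+ q./2 * leg q p.
Proof.
have q2 : q = (q./2.*2.+1)%N by rewrite -[LHS]odd_double_half oq.
have chiN1 : chi (-1) = leg p p.-1.
  rewrite -chi_nat; congr chi; apply/eqP; rewrite eq_sym -subr_eq0 opprK.
  by rewrite natr1 prednK ?prime_gt0 // Fp_eq0.
have hp : p%:R != 0 :> F.
  by rewrite -(dvdn_pcharf hF) dvdn_prime2 // eq_sym.
have g0 : g != 0.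
  have : g ^+ 2 != 0.
    rewrite g_sqr mulf_neq0 // chiN1.
    have : leg p p.-1 != 0.
      rewrite leg_eq0; apply/negP => /dvdn_leq; have := prime_gt1 pp; lia.
    case: (leg_cases p p.-1) => -> // _; rewrite ?rmorphN1 ?oppr_eq0 ?rmorph1 ?oner_neq0 //.
  by rewrite expf_eq0.
have hg : (leg p q)%:~R = (chi (-1))%:~R ^+ q./2 * p%:R ^+ q./2 :> F.
  by apply: (mulIf g0); rewrite -g_q {1}q2 exprSr -mul2n exprM g_sqr exprMn.
apply: (legF_inj hF oq).
- exact: leg_cases.
- have : [\/ leg p p.-1 ^+ q./2 = 0, leg p p.-1 ^+ q./2 = 1 | leg p p.-1 ^+ q./2 = -1].
    case: (leg_cases p p.-1) => ->; rewrite ?expr1n ?expr0n; last first.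
    - by rewrite -signr_odd; case: odd; [constructor 3|constructor 2].
    - by constructor 2.
    - by case: eqP; [constructor 2|constructor 1].
  by case=> ->; case: (leg_cases q p) => ->; rewrite ?mul0r ?mul1r ?mulr0 ?mulr1 ?mulN1r ?opprK;
    [constructor 1|constructor 1|constructor 1|constructor 1|constructor 2|constructor 3|constructor 1|constructor 3|constructor 2].
rewrite hg rmorphM rmorphXn /= chiN1; congr (_ * _).
have := euler_criterion p qq oq; rewrite -natrX.
have hn (m n : nat) : m%:R = n%:R :> 'F_q -> m%:R = n%:R :> F.
  by move/eqP; rewrite Fp_eq // => /eqP h; rewrite -(GRing.natr_mod_pchar hF) h GRing.natr_mod_pchar.
rewrite -natrX; case: (leg_cases q p) => ->.
- by move/(@hn _ 0%N).
- by move/(@hn _ 1%N).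
move=> h; apply/eqP; rewrite rmorphN1 -subr_eq0 opprK natr1.
by apply/eqP/(@hn _ 0%N); rewrite -natr1 h rmorphN1 addNr.
Qed.
End GaussSum.

Lemma legN1 (p : nat) : prime p -> odd p -> leg p p.-1 = (-1) ^+ p./2.
Proof.
move=> pp op; apply: (@legF_inj 'F_p p) => //.
- exact: pchar_Fp.
- exact: leg_cases.
- by rewrite -signr_odd; case: odd; [constructor 3|constructor 2].
rewrite -euler_criterion // rmorphXn /= rmorphN1; congr (_ ^+ _).
by apply/eqP; rewrite -subr_eq0 opprK natr1 prednK ?prime_gt0 // Fp_eq0.
Qed.

Theorem quadratic_reciprocity (p q : nat) : prime p -> odd p -> prime q -> odd q -> p != q ->
  leg p q = (-1) ^+ (p./2 * q./2) * leg q p.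
Proof.
move=> pp op qq oq npq.
have p1 : (0 < p.-1)%N by have := prime_gt1 pp; lia.
have [F hF cF] := pPrimePowerField qq p1.
have [z] := finField_prim_root F; rewrite cF => hz.
(* By Fermat's theorem the field with [q ^ p.-1] elements contains a primitive [p]-th root of
   unity. *)
have hd : (p %| (q ^ p.-1).-1)%N.
  rewrite -subn1 -eqn_mod_dvd ?expn_gt0 ?prime_gt0 //.
  apply/eqP; rewrite -totient_prime //; apply: Euler_exp_totient.
  by rewrite coprime_sym prime_coprime // dvdn_prime2.
rewrite (gauss_sum_leg pp op qq oq hF (dvdn_prim_root hz hd) npq).
by rewrite legN1 // exprM.
Qed.

(** The same method with a primitive eighth root of unity [z] in the field of [q ^ 2] elements:
    [z + z ^+ 7] is a square root of 2, and Frobenius fixes or negates it according to [q] modulo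
    8. *)
Lemma leg_2 (q : nat) : prime q -> odd q ->
  leg q 2 = if (q %% 8)%N \in [:: 1; 7]%N then 1 else -1.
Proof.
move=> qq oq; have [F hF cF] := @pPrimePowerField q 2 qq isT.
have [z0] := finField_prim_root F; rewrite cF => hz0.
have hd : (8 %| (q ^ 2).-1)%N.
  rewrite -subn1 -eqn_mod_dvd ?expn_gt0 ?prime_gt0 // -modnXm.
  have : (q %% 8 %% 2 = 1)%N by rewrite modn_dvdm // modn2 oq.
  have := ltn_pmod q (isT : 0 < 8)%N.
  by case: (q %% 8)%N => [|[|[|[|[|[|[|[|]]]]]]]].
have hz := dvdn_prim_root hz0 hd; set z := _ ^+ _ in hz.
have z4 : z ^+ 4 = -1.
  have /eqP : (z ^+ 4) ^+ 2 = 1 by rewrite -exprM (prim_expr_order hz).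
  by rewrite sqrf_eq1 -(prim_order_dvd hz) /= => /eqP.
pose g := z + z ^+ 7.
have g2 : g ^+ 2 = 2%:R.
  have -> : g ^+ 2 = z ^+ 2 + 2%:R * (z ^+ 4) ^+ 2 + (z ^+ 4) ^+ 3 * z ^+ 2 by rewrite /g; ring.
  by rewrite z4; ring.
have h2 : 2%:R != 0 :> F.
  rewrite -(dvdn_pcharf hF) dvdn_prime2 //; apply/eqP => h; by rewrite h in oq.
have g0 : g != 0 by move: h2; rewrite -g2 expf_eq0.
have q2 : q = (q./2.*2.+1)%N by rewrite -[LHS]odd_double_half oq.
have hg : g ^+ q = (if (q %% 8)%N \in [:: 1; 7]%N then 1 else -1) * g.
  have hzq (k : nat) : (z ^+ k) ^+ q = z ^+ (q %% 8 * k).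
    by rewrite -exprM -[RHS](prim_expr_mod hz) modnMml mulnC (prim_expr_mod hz).
  rewrite -(pFrobenius_autE hF) rmorphD /= !pFrobenius_autE -{1}[z]expr1 !hzq.
  have : (q %% 8 %% 2 = 1)%N by rewrite modn_dvdm // modn2 oq.
  have := ltn_pmod q (isT : 0 < 8)%N; rewrite /g.
  have z7 : z ^+ 7 = - z ^+ 3 by rewrite (exprD z 4 3) z4 mulN1r.
  have z21 : z ^+ (3 * 7) = - z by rewrite -[(3 * 7)%N]/(4 * 5 + 1)%N exprD exprM z4; ring.
  have z35 : z ^+ (5 * 7) = z ^+ 3 by rewrite -[(5 * 7)%N]/(4 * 8 + 3)%N exprD exprM z4; ring.
  have z5 : z ^+ 5 = - z by rewrite (exprD z 4 1) z4 mulN1r.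
  have z49 : z ^+ (7 * 7) = z by rewrite -[(7 * 7)%N]/(4 * 12 + 1)%N exprD exprM z4; ring.
  case: (q %% 8)%N => [|[|[|[|[|[|[|[|]]]]]]]] // _ _; rewrite ?muln1 ?mul1n ?z21 ?z35 ?z49 ?z7 ?z5 ?expr1 /=; ring.
apply: (legF_inj hF oq).
- exact: leg_cases.
- by case: ifP; [constructor 2|constructor 3].
have hg' : 2%:R ^+ q./2 = (if (q %% 8)%N \in [:: 1; 7]%N then 1 else -1) :> F.
  by apply: (mulIf g0); rewrite -hg {2}q2 exprSr -mul2n exprM g2.
transitivity (2%:R ^+ q./2 : F); last by rewrite hg'; case: ifP.
have := euler_criterion 2 qq oq; rewrite -!natrX.
have hn (m n : nat) : m%:R = n%:R :> 'F_q -> m%:R = n%:R :> F.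
  by move/eqP; rewrite Fp_eq // => /eqP h; rewrite -(GRing.natr_mod_pchar hF) h GRing.natr_mod_pchar.
case: (leg_cases q 2) => ->.
- by move/(@hn _ 0%N).
- by move/(@hn _ 1%N).
move=> h; apply/esym/eqP; rewrite rmorphN1 -subr_eq0 opprK natr1.
by apply/eqP/(@hn _ 0%N); rewrite -natr1 h rmorphN1 addNr.
Qed.

Lemma leg_prod (p : nat) (s : seq nat) : prime p -> odd p ->
  leg p (\prod_(q <- s) q)%N = \prod_(q <- s) leg p q.
Proof.
move=> pp op; elim: s => [|q s IH]; first by rewrite !big_nil leg1.
by rewrite !big_cons legM // IH.
Qed.

Lemma odd_prod_primes (s : seq nat) : all odd s -> odd (\prod_(q <- s) q)%N.
Proof.
by elim: s => [|q s IH] /=; rewrite ?big_nil // big_cons oddM => /andP[-> /IH ->].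
Qed.

Lemma jacobi_reciprocity (p : nat) (s : seq nat) :
  prime p -> odd p -> all prime s -> all odd s -> p \notin s ->
  (\prod_(q <- s) q = 1 %[mod 4])%N ->
  \prod_(q <- s) leg q p = leg p (\prod_(q <- s) q)%N.
Proof.
move=> pp op ps os nps h1; rewrite leg_prod //.
have -> : \prod_(q <- s) leg q p = (-1) ^+ (p./2 * (\prod_(q <- s) q)%N./2) * \prod_(q <- s) leg p q.
  elim: s ps os nps {h1} => [|q s IH] /=; first by rewrite !big_nil muln0 mulr1.
  move=> /andP[pq ps] /andP[oq os]; rewrite inE negb_or => /andP[npq nps].
  rewrite !big_cons IH // quadratic_reciprocity // 1?eq_sym //.
  have := odd_prod_primes os; set a := (\prod_(j <- s) j)%N => oa.
  (* Modulo 2, halving turns products of odd numbers into sums, so the signs collected from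
     reciprocity depend on the whole product only; as this is 1 modulo 4, they cancel. *)
  have -> : (q * a)./2 = (q./2 + a./2 + 2 * (q./2 * a./2))%N.
    rewrite -[in LHS](odd_double_half q) -[in LHS](odd_double_half a) oq oa !add1n.
    rewrite mulnS mulSn -!muln2; lia.
  rewrite mulrACA -exprD; congr (_ * _).
  rewrite (mulnDr _ (_ + _)) (mulnDr _ q./2) !exprD.
  have -> k : (-1) ^+ (p./2 * (2 * k)) = 1 :> int by rewrite mulnCA exprM sqrrN !expr1n.
  by rewrite mulr1 [(q./2 * _)%N]mulnC.
have os' := odd_prod_primes os; set a := (\prod_(j <- s) j)%N in h1 os' *.
have -> : a./2 = (a %/ 4 * 2)%N.
  by clear -h1; lia.
by rewrite mulnA exprM sqrr_sign mul1r.
Qed.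

Lemma jacobi_2 (s : seq nat) : all prime s -> all odd s ->
  \prod_(q <- s) leg q 2 = if (\prod_(q <- s) q %% 8)%N \in [:: 1; 7]%N then 1 else -1.
Proof.
elim: s => [|q s IH] /=; first by rewrite !big_nil.
move=> /andP[pq ps] /andP[oq os]; rewrite !big_cons IH // leg_2 // -modnMm.
have := odd_prod_primes os; set a := (\prod_(j <- s) j)%N => oa.
have : (q %% 8 %% 2 = 1)%N by rewrite modn_dvdm // modn2 oq.
have : (a %% 8 %% 2 = 1)%N by rewrite modn_dvdm // modn2 oa.
have := ltn_pmod q (isT : 0 < 8)%N; have := ltn_pmod a (isT : 0 < 8)%N.
by case: (q %% 8)%N => [|[|[|[|[|[|[|[|]]]]]]]]; case: (a %% 8)%N => [|[|[|[|[|[|[|[|]]]]]]]].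
Qed.

(** * Legendre's theorem on ternary quadratic forms *)

Lemma PoszX (n k : nat) : (n ^ k)%N%:Z = n%:Z ^+ k.
Proof. by elim: k => // k IH; rewrite expnS PoszM IH exprS. Qed.

Lemma nat_sqrt (n : nat) : exists a : nat, (a ^ 2 <= n < a.+1 ^ 2)%N.
Proof.
have hex : exists a, (n < a.+1 ^ 2)%N by exists n; rewrite expnS expn1; nia.
exists (ex_minn hex); case: ex_minnP => -[|a] ha hmin; rewrite ha andbT //.
by rewrite leqNgt; apply/negP => /hmin; rewrite ltnn.
Qed.

(** Thue's argument: two points of the box share all three residues, and their difference is
    taken. *)
Lemma pigeonhole3 (a b c t A C l m n : nat) :
  (0 < t)%N -> (0 < A)%N -> (0 < C)%N -> (t * A * C < a.+1 * b.+1 * c.+1)%N ->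
  exists x y z : int, [/\ `|x| <= a%:Z, `|y| <= b%:Z & `|z| <= c%:Z] /\
    [/\ (x, y, z) != 0, (t%:Z %| x + l%:Z * y)%Z, (A%:Z %| y + m%:Z * z)%Z
      & (C%:Z %| x + n%:Z * z)%Z].
Proof.
move=> t0 A0 C0 hlt.
pose f (u : 'I_a.+1 * 'I_b.+1 * 'I_c.+1) : 'I_t * 'I_A * 'I_C :=
  (Ordinal (ltn_pmod (u.1.1 + l * u.1.2) t0), Ordinal (ltn_pmod (u.1.2 + m * u.2) A0),
   Ordinal (ltn_pmod (u.1.1 + n * u.2) C0)).
have /injectivePn [[[x y] z] [[[x' y'] z'] /= hne [h1 h2 h3]]] : ~~ injectiveb f.
  apply: contraTN hlt => /injectiveP /leq_card.
  by rewrite !card_prod !card_ord -leqNgt.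
have dvd d (u v : nat) : (u %% d = v %% d)%N -> (d%:Z %| u%:Z - v%:Z)%Z.
  by move=> h; rewrite -eqz_mod_dvd; apply/eqP; rewrite !modz_nat h.
exists (x%:Z - x'%:Z), (y%:Z - y'%:Z), (z%:Z - z'%:Z); split.
  have hd (e : nat) (u v : 'I_e.+1) : `|u%:Z - v%:Z| <= e%:Z.
    move: (ltn_ord u) (ltn_ord v); move: (u : nat) (v : nat) => {}u {}v.
    by move=> hu hv; rewrite ler_norml; apply/andP; split; lia.
  by split; apply: hd.
move/dvd: h1; move/dvd: h2; move/dvd: h3; rewrite !PoszD !PoszM => h3 h2 h1; split.
- apply: contraNneq hne => -[hx hy hz].
  have he (e : nat) (u v : 'I_e.+1) : u%:Z - v%:Z = 0 -> u = v.
    by move/eqP; rewrite subr_eq0 eqz_nat => /eqP h; apply: val_inj.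
  by rewrite (he _ _ _ hx) (he _ _ _ hy) (he _ _ _ hz).
- by apply: eq_ind h1 => /=; congr (_ %| _)%Z; ring.
- by apply: eq_ind h2 => /=; congr (_ %| _)%Z; ring.
- by apply: eq_ind h3 => /=; congr (_ %| _)%Z; ring.
Qed.

(** Meant for the three terms of a conic, with [P] the product of its coefficients. The quotients -1
    and 2 occur only at the ends of the ranges, where a product of two coefficients would be a
    square. *)
Lemma int_quotient_cases (P u v w k : int) : 0 < P -> 0 <= u -> u <= P -> 0 <= v -> v <= P ->
  0 <= w -> w <= P -> u + v - w = k * P -> [\/ w = P /\ u + v = 0, k = 0, k = 1 | u = P].
Proof.
move=> P0 u0 u1 v0 v1 w0 w1 e.
have k1 : -1 <= k by rewrite -(ler_pM2r P0) -e mulN1r; clear e; lia.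
have k2 : k <= 2 by rewrite -(ler_pM2r P0) -e mulr_natl; clear e; lia.
have : [\/ k = -1, k = 0, k = 1 | k = 2].
  clear -k1 k2; have : k = -1 \/ k = 0 \/ k = 1 \/ k = 2 by lia.
  by case=> [|[|[|]]]; [constructor 1|constructor 2|constructor 3|constructor 4].
case=> kE; rewrite kE ?mulN1r in e.
- by constructor 1; split; lia.
- by constructor 2.
- by constructor 3.
- by constructor 4; lia.
Qed.

Lemma int_quad_eq0 (d u : int) : 0 < d -> d * u ^+ 2 = 0 -> u = 0.
Proof. by move=> d0 /eqP; rewrite mulf_eq0 expf_eq0 /= gt_eqF //= => /eqP. Qed.

(** Modulo each coefficient the form vanishes on a linear condition, so a small point makes it [k]
    times [A * C * t]. The two nonsquare hypotheses leave [k = 0], which is a solution, and [k = 1],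
    which an identity turns into one. *)
Lemma legendre_conic (A C t l m n : nat) :
  (0 < A)%N -> (0 < C)%N -> (0 < t)%N ->
  coprime A C -> coprime A t -> coprime C t ->
  (t %| A * l ^ 2 + C)%N -> (C * m ^ 2 = t %[mod A])%N -> (A * n ^ 2 = t %[mod C])%N ->
  (forall z, z ^ 2 <> A * C)%N -> (forall z, z ^ 2 <> C * t)%N ->
  exists x y z : int, z != 0 /\ A%:Z * x ^+ 2 + C%:Z * y ^+ 2 = t%:Z * z ^+ 2.
Proof.
move=> A0 C0 t0 cAC cAt cCt hl hm hn nAC nCt.
have [a /andP[a1 a2]] := nat_sqrt (C * t).
have [b /andP[b1 b2]] := nat_sqrt (A * t).
have [c /andP[c1 c2]] := nat_sqrt (A * C).
(* The sides are integer square roots, which balances both needs: the box has more than [t * A * C]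
   points, yet each term of the form stays at most [t * A * C]. *)
have hlt : (t * A * C < a.+1 * b.+1 * c.+1)%N.
  rewrite -(@ltn_exp2r _ _ 2) // !expnMn.
  apply: (@leq_ltn_trans ((C * t) * (A * t) * (A * C))%N); first by rewrite leq_eqVlt; apply/orP; left; apply/eqP; ring.
  by apply: ltn_mul => //; apply: ltn_mul.
have [x [y [z [[hx hy hz] [hne h1 h2 h3]]]]] := pigeonhole3 l m n t0 A0 C0 hlt.
pose Q : int := A%:Z * x ^+ 2 + C%:Z * y ^+ 2 - t%:Z * z ^+ 2.
have dt : (t%:Z %| Q)%Z.
  have -> : Q = A%:Z * (x - l%:Z * y) * (x + l%:Z * y) + ((A * l ^ 2 + C)%:Z) * y ^+ 2 - t%:Z * z ^+ 2.
    by rewrite PoszD PoszM PoszX /Q; ring.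
  apply: rpredB; last exact: dvdz_mulr.
  by apply: rpredD; [exact: dvdz_mull | exact: dvdz_mulr].
have dA : (A%:Z %| Q)%Z.
  have /eqP := hm; rewrite -(eqz_nat) -!modz_nat eqz_mod_dvd PoszM PoszX => hm'.
  have -> : Q = A%:Z * x ^+ 2 + C%:Z * (y - m%:Z * z) * (y + m%:Z * z) + (C%:Z * m%:Z ^+ 2 - t%:Z) * z ^+ 2.
    by rewrite /Q; ring.
  apply: rpredD; last exact: dvdz_mulr.
  by apply: rpredD; [rewrite dvdz_mulr | exact: dvdz_mull].
have dC : (C%:Z %| Q)%Z.
  have /eqP := hn; rewrite -(eqz_nat) -!modz_nat eqz_mod_dvd PoszM PoszX => hn'.
  have -> : Q = C%:Z * y ^+ 2 + A%:Z * (x - n%:Z * z) * (x + n%:Z * z) + (A%:Z * n%:Z ^+ 2 - t%:Z) * z ^+ 2.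
    by rewrite /Q; ring.
  apply: rpredD; last exact: dvdz_mulr.
  by apply: rpredD; [rewrite dvdz_mulr | exact: dvdz_mull].
have /dvdzP [k hk] : ((A * C * t)%:Z %| Q)%Z.
  by rewrite !PoszM !Gauss_dvdz ?dA ?dC ?dt // coprimezE ?abszM //= coprimeMl cAt cCt.
have sq (u : int) (d e : nat) : `|u| <= d%:Z -> (d ^ 2 <= e)%N -> u ^+ 2 <= e%:Z.
  move=> hu hd; rewrite -[u ^+ 2]real_normK ?num_real //; have: (`|u| ^+ 2 <= d%:Z ^+ 2) by rewrite lerXn2r ?nnegrE //.
  by move/le_trans; apply; rewrite -PoszX lez_nat.
have hx2 := sq _ _ _ hx a1; have hy2 := sq _ _ _ hy b1; have hz2 := sq _ _ _ hz c1.
have ex2 (u : int) : exists v : nat, u ^+ 2 = (v ^ 2)%N%:Z.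
  by exists `|u|%N; rewrite -abszX abszE; rewrite ger0_norm ?sqr_ge0.
have A0' : 0 < A%:Z by []. have C0' : 0 < C%:Z by []. have t0' : 0 < t%:Z by [].
have hAx : A%:Z * x ^+ 2 <= (A * C * t)%:Z.
  by rewrite -mulnA PoszM ler_pM2l.
have hCy : C%:Z * y ^+ 2 <= (A * C * t)%:Z.
  by rewrite mulnAC [(_ * C)%N]mulnC PoszM ler_pM2l.
have htz : t%:Z * z ^+ 2 <= (A * C * t)%:Z.
  by rewrite mulnC PoszM ler_pM2l.
have P0 : 0 < (A * C * t)%:Z by rewrite !PoszM !mulr_gt0.
have hAx0 : 0 <= A%:Z * x ^+ 2 by rewrite mulr_ge0 ?sqr_ge0 // ltW.
have hCy0 : 0 <= C%:Z * y ^+ 2 by rewrite mulr_ge0 ?sqr_ge0 // ltW.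
have htz0 : 0 <= t%:Z * z ^+ 2 by rewrite mulr_ge0 ?sqr_ge0 // ltW.
have [[htP _]|k0|k0|hAP] := int_quotient_cases P0 hAx0 hAx hCy0 hCy htz0 htz hk.
- have [v hv] := ex2 z; move: htP; rewrite hv -PoszM => -[] /eqP.
  by rewrite mulnC eqn_pmul2r // => /eqP /nAC.
- move: hk; rewrite k0 mul0r => /eqP; rewrite subr_eq0 => /eqP hk.
  exists x, y, z; split => //; apply: contraNneq hne => z0.
  have /eqP : A%:Z * x ^+ 2 + C%:Z * y ^+ 2 = 0 by rewrite hk z0 expr0n mulr0.
  rewrite paddr_eq0 // => /andP[/eqP hx0 /eqP hy0].
  by rewrite z0 (int_quad_eq0 A0' hx0) (int_quad_eq0 C0' hy0).
- exists (x * z + C%:Z * y), (y * z - A%:Z * x), (z ^+ 2 + A%:Z * C%:Z); split.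
    by rewrite gt_eqF // ltr_wpDl ?sqr_ge0 // mulr_gt0.
  have e1 : A%:Z * x ^+ 2 + C%:Z * y ^+ 2 = t%:Z * (z ^+ 2 + A%:Z * C%:Z).
    move/eqP: hk; rewrite k0 mul1r /Q subr_eq => /eqP ->; rewrite !PoszM; ring.
  (* Brahmagupta: multiply by the norm z^2 + AC. *)
  transitivity ((A%:Z * x ^+ 2 + C%:Z * y ^+ 2) * (z ^+ 2 + A%:Z * C%:Z)); first by ring.
  by rewrite e1; ring.
- have [v hv] := ex2 x; move: hAP; rewrite hv -PoszM -mulnA => -[] /eqP.
  by rewrite eqn_pmul2l // => /eqP /nCt.
Qed.

(** * Von Mangoldt's function and Chebyshev's bound *)

Lemma filter_dvdn_iota (d x : nat) : (0 < d)%N ->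
  perm_eq [seq n <- index_iota 1 x.+1 | (d %| n)%N] [seq (d * e)%N | e <- index_iota 1 (x %/ d).+1].
Proof.
move=> d0; apply: uniq_perm; first by rewrite filter_uniq ?iota_uniq.
  by rewrite map_inj_uniq ?iota_uniq // => u v /eqP; rewrite eqn_pmul2l // => /eqP.
move=> n; rewrite mem_filter mem_index_iota !ltnS; apply/andP/mapP.
  case=> /dvdnP[e ->]; rewrite muln_gt0 => /andP[/andP[e0 _] h].
  by exists e; rewrite 1?mulnC // mem_index_iota ltnS e0 leq_divRL.
case=> e; rewrite mem_index_iota ltnS leq_divRL // mulnC => /andP[e0 h] ->.
by rewrite dvdn_mulr // muln_gt0 d0 e0.
Qed.

(** The inductive step, on the exponent of [p], for the divisor sums below. *)
Lemma filter_dvdn_prime_pow (p k m : nat) : prime p -> (0 < m)%N -> coprime p m ->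
  perm_eq (divisors (p ^ k.+1 * m))
    (divisors (p ^ k * m) ++ [seq (p ^ k.+1 * e)%N | e <- divisors m]).
Proof.
move=> pp m0 cpm; have p0 := prime_gt0 pp.
apply: uniq_perm; first exact: divisors_uniq.
  rewrite cat_uniq divisors_uniq map_inj_uniq ?divisors_uniq ?andbT.
    apply/hasPn => _ /mapP[e he ->]; rewrite -dvdn_divisors ?muln_gt0 ?expn_gt0 ?p0 //.
    rewrite expnSr -mulnA dvdn_pmul2l ?expn_gt0 ?p0 //; apply/negP => h.
    have : (p %| m)%N by apply: dvdn_trans h; apply: dvdn_mulr.
    by apply/negP; rewrite -prime_coprime.
  by move=> u v /eqP; rewrite eqn_pmul2l ?expn_gt0 ?p0 // => /eqP.
move=> n; rewrite mem_cat -!dvdn_divisors ?muln_gt0 ?expn_gt0 ?p0 //.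
apply/idP/orP; last first.
  case=> [h|/mapP[e]].
    by apply: dvdn_trans h _; rewrite dvdn_pmul2r // dvdn_exp2l.
  by rewrite -dvdn_divisors // => h ->; rewrite dvdn_pmul2l // expn_gt0 p0.
move=> h; have n0 : (0 < n)%N by apply: dvdn_gt0 h; rewrite muln_gt0 expn_gt0 p0.
have [e cpe ne] := pfactor_coprime pp n0.
have em : (e %| m)%N.
  rewrite -(@Gauss_dvdr _ (p ^ k.+1)) ?coprimeXr 1?coprime_sym //.
  by apply: dvdn_trans h; rewrite ne dvdn_mulr.
have hl : (logn p n <= k.+1)%N.
  rewrite -(@dvdn_Pexp2l p) ?prime_gt1 // -(@Gauss_dvdl _ _ m) ?coprimeXl //.
  by apply: dvdn_trans h; rewrite {2}ne dvdn_mull.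
case: (ltngtP (logn p n) k.+1) hl => // [hl _|hl _].
  by left; rewrite ne mulnC dvdn_mul // dvdn_exp2l.
by right; apply/mapP; exists e; rewrite -?dvdn_divisors // ne hl mulnC.
Qed.

Lemma prime_pow_ind (P : nat -> Prop) : P 1%N ->
  (forall p k m, prime p -> (0 < m)%N -> coprime p m -> P m -> P (p ^ k * m)%N) ->
  forall n, (0 < n)%N -> P n.
Proof.
move=> P1 PM n; elim/ltn_ind: n => n IH n0.
have [n1|n1] := leqP n 1; first by have -> : n = 1%N by lia.
have pp := pdiv_prime n1; have [m cpm nE] := pfactor_coprime pp n0.
have m0 : (0 < m)%N by move: n0; rewrite nE muln_gt0 => /andP[].
rewrite nE mulnC; apply: PM => //; apply: IH => //.
rewrite [X in (_ < X)%N]nE -{1}[m]muln1 ltn_pmul2l // -{1}(expn0 (pdiv n)) ltn_exp2l ?prime_gt1 //.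
by rewrite logn_gt0 mem_primes pp n0 pdiv_dvd.
Qed.

Section Sums.
Variable R : realType.

Lemma sum_divisors_swap (F : nat -> nat -> R) (x : nat) :
  \sum_(1 <= n < x.+1) \sum_(d <- divisors n) F d n =
  \sum_(1 <= d < x.+1) \sum_(1 <= e < (x %/ d).+1) F d (d * e)%N.
Proof.
transitivity (\sum_(1 <= n < x.+1) \sum_(1 <= d < x.+1 | (d %| n)%N) F d n).
  apply: eq_big_nat => n /andP[n0]; rewrite ltnS => nx.
  rewrite -[RHS]big_filter; apply: perm_big; apply: uniq_perm; first exact: divisors_uniq.
    by rewrite filter_uniq ?iota_uniq.
  move=> d; rewrite mem_filter mem_index_iota -dvdn_divisors // ltnS.
  apply/idP/andP => [h|[] //]; split=> //.
  by rewrite (dvdn_gt0 n0 h) (leq_trans (dvdn_leq n0 h)).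
rewrite (exchange_big_dep_nat predT) //=; apply: eq_big_nat => d /andP[d0 _].
rewrite -big_filter (perm_big _ (filter_dvdn_iota x d0)) big_map /=.
by apply: eq_bigr.
Qed.

Definition vonMangoldt (n : nat) : R :=
  if (1 < n)%N && (n == pdiv n ^ logn (pdiv n) n)%N then ln (pdiv n)%:R else 0.

Lemma vonMangoldt_ge0 n : 0 <= vonMangoldt n.
Proof.
by rewrite /vonMangoldt; case: ifP => // _; rewrite ln_ge0 // ler1n pdiv_gt0.
Qed.

Lemma vonMangoldt_neq0 n : vonMangoldt n != 0 ->
  exists p k, [/\ prime p, n = (p ^ k.+1)%N & vonMangoldt n = ln p%:R].
Proof.
rewrite /vonMangoldt; case: ifP => [/andP[n1 /eqP hn] _|_]; last by rewrite eqxx.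
exists (pdiv n), (logn (pdiv n) n).-1; split=> //; first exact: pdiv_prime.
rewrite prednK // logn_gt0 mem_primes pdiv_prime // pdiv_dvd; lia.
Qed.

Lemma vonMangoldt_pow p k : prime p -> vonMangoldt (p ^ k.+1) = ln p%:R.
Proof.
move=> pp; rewrite /vonMangoldt pdiv_pfactor // pfactorK // eqxx.
by rewrite -{1}(exp1n k.+1) ltn_exp2r // prime_gt1.
Qed.

Lemma sum_vonMangoldt n : (0 < n)%N -> \sum_(d <- divisors n) vonMangoldt d = ln n%:R.
Proof.
move: n; apply: prime_pow_ind => [|p k m pp m0 cpm IH].
  by rewrite (_ : divisors 1 = [:: 1%N]) // big_seq1 ln1 /vonMangoldt.
have p0 := prime_gt0 pp.
elim: k => [|k IHk]; first by rewrite expn0 mul1n.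
rewrite (perm_big _ (filter_dvdn_prime_pow k pp m0 cpm)) big_cat /= IHk big_map.
(* Any [e] other than 1 has a prime factor different from [p], so [p ^ k.+1 * e] is not a prime
   power. *)
have -> : \sum_(e <- divisors m) vonMangoldt (p ^ k.+1 * e) = ln p%:R.
  rewrite (bigD1_seq 1%N) ?divisors_uniq -?dvdn_divisors //= muln1 vonMangoldt_pow //.
  rewrite big_seq_cond big1 ?addr0 // => e /andP[]; rewrite -dvdn_divisors // => em e1.
  apply/eqP/negPn/negP => /vonMangoldt_neq0 [q [j [qq hq _]]].
  have pq : p = q.
    have : (p %| q ^ j.+1)%N by rewrite -hq expnS -mulnA dvdn_mulr.
    by rewrite Euclid_dvdX // andbT dvdn_prime2 // => /eqP.
  have : coprime p e by apply: coprime_dvdr em cpm.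
  have e2 : (1 < e)%N by move: (dvdn_gt0 m0 em) e1; lia.
  have : (pdiv e %| p ^ j.+1)%N by rewrite pq -hq dvdn_mull // pdiv_dvd.
  rewrite Euclid_dvdX ?pdiv_prime // andbT dvdn_prime2 ?pdiv_prime // => /eqP pe.
  by rewrite prime_coprime // -pe pdiv_dvd.
rewrite -lnM ?posrE ?ltr0n ?muln_gt0 ?expn_gt0 ?p0 // -natrM.
by congr (ln _%:R); rewrite expnSr; ring.
Qed.

Definition psi (x : nat) : R := \sum_(1 <= d < x.+1) vonMangoldt d.

Lemma sum_ln_floor (x : nat) :
  \sum_(1 <= n < x.+1) ln n%:R = \sum_(1 <= d < x.+1) vonMangoldt d * (x %/ d)%:R.
Proof.
transitivity (\sum_(1 <= n < x.+1) \sum_(d <- divisors n) vonMangoldt d).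
  by apply: eq_big_nat => n /andP[n0 _]; rewrite sum_vonMangoldt.
rewrite (sum_divisors_swap (fun d _ => vonMangoldt d)); apply: eq_bigr => d _.
by rewrite sumr_const_nat subn1 mulr_natr.
Qed.

(** In other words, the central binomial coefficient is at most exp(2x). *)
Lemma sum_ln_double (x : nat) :
  \sum_(1 <= n < x.*2.+1) (ln n%:R : R) <= (\sum_(1 <= n < x.+1) ln n%:R) *+ 2 + x%:R *+ 2.
Proof.
elim: x => [|x IH]; first by rewrite double0 !big_nil mul0rn addr0.
rewrite doubleS 2?big_nat_recr //= [in leRHS]big_nat_recr //=.
have h : (ln x.*2.+1%:R : R) + ln x.*2.+2%:R <= ln x.+1%:R *+ 2 + 2.
  have l2 : (ln 2 : R) <= 1.
    by rewrite -[leRHS]expRK ler_ln ?posrE ?expR_gt0 //; apply: le_trans (expR_ge1Dx 1).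
  have e2 : ln x.*2.+2%:R = ln x.+1%:R + ln 2 :> R.
    by rewrite -doubleS -muln2 natrM lnM ?posrE.
  have : ln x.*2.+1%:R <= ln x.*2.+2%:R :> R by rewrite ler_ln ?posrE ?ltr0n // ler_nat.
  by rewrite e2 => h3; lra.
rewrite -[X in _ <= _ + X *+ 2]natr1; lra.
Qed.

(** Chebyshev's argument: in ln (2y)! - 2 ln y! the coefficient of [vonMangoldt d] is nonnegative,
    and at least 1 for y < d <= 2y, so [psi] grows by at most 2y from y to 2y. *)
Lemma psi_le (x : nat) : psi x <= 4 * x%:R.
Proof.
have hdbl y : psi y.*2 <= psi y + 2 * y%:R.
  rewrite mulr_natl.
  have h0 := sum_ln_double y; rewrite !sum_ln_floor in h0.
  have h1 : \sum_(1 <= d < y.+1) vonMangoldt d * (y %/ d)%:R =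
            \sum_(1 <= d < y.*2.+1) vonMangoldt d * (y %/ d)%:R.
    rewrite [RHS](@big_cat_nat _ _ _ y.+1) //=; last by rewrite ltnS -addnn leq_addr.
    rewrite [X in _ = _ + X]big_nat_cond [X in _ = _ + X]big1 ?addr0 // => d.
    by rewrite andbT => /andP[yd _]; rewrite divn_small // mulr0.
  have h2 : psi y.*2 - psi y <= \sum_(1 <= d < y.*2.+1) vonMangoldt d * (y.*2 %/ d)%:R -
      (\sum_(1 <= d < y.*2.+1) vonMangoldt d * (y %/ d)%:R) *+ 2.
    rewrite /psi (@big_cat_nat _ _ _ y.+1 1 y.*2.+1) //=; last by rewrite ltnS -addnn leq_addr.
    rewrite addrAC subrr add0r -sumrMnl -sumrB.
    rewrite [leRHS](@big_cat_nat _ _ _ y.+1) //=; last by rewrite ltnS -addnn leq_addr.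
    apply: ler_wpDl.
      apply: sumr_ge0 => d _; rewrite -mulrnAr -mulrBr mulr_ge0 ?vonMangoldt_ge0 //.
      rewrite subr_ge0 -mulr_natr -natrM ler_nat; case: d => [|d]; first by rewrite !divn0.
      by rewrite leq_divRL // mulnAC -muln2 leq_mul2r leq_divM orbT.
    apply: ler_sum_nat => d /andP[yd dy].
    rewrite [(y %/ d)%N]divn_small // mulr0 mul0rn subr0 ler_peMr ?vonMangoldt_ge0 //.
    by rewrite ler1n divn_gt0 ?dy //; lia.
  rewrite h1 in h0; set u := psi _ in h2 *; set v := psi _ in h2 *; lra.
elim/ltn_ind: x => x IH.
have [x1|x1] := leqP x 1.
  have : psi x <= 0.
    by case: x x1 {IH} => [|[|]] // _; rewrite /psi ?big_nil ?big_nat1 /vonMangoldt.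
  by move/le_trans; apply; rewrite mulr_ge0.
have hx : x = (odd x + x./2.*2)%N by rewrite odd_double_half.
have := hdbl x./2; set y := x./2 in hx *.
have {}IH : psi y <= 4 * y%:R by apply: IH; rewrite /y; lia.
(* An odd [x] costs one more term, bounded by [x]; the constant 4 leaves room for it. *)
clearbody y; case: (odd x) hx => hx hd.
  have -> : psi x = psi y.*2 + vonMangoldt x by rewrite hx add1n /psi big_nat_recr.
  have hL : vonMangoldt x <= x%:R.
    rewrite /vonMangoldt; case: ifP => // _; apply: (@le_trans _ _ (ln x%:R)).
      rewrite ler_ln ?posrE ?ltr0n ?pdiv_gt0 //; last lia.
      by rewrite ler_nat pdiv_leq //; lia.
    by apply/ltW/ln_sublinear; rewrite ltr0n; lia.
  have hxR : x%:R = 1 + y%:R * 2 :> R by rewrite hx natrD -muln2 natrM.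
  rewrite hxR in hL *; move: (vonMangoldt x) (psi y) (psi y.*2) hL IH hd => a b c hL IH hd; lra.
have -> : x = y.*2 by [].
rewrite -[in leRHS]muln2 natrM; move: (psi y) (psi y.*2) IH hd => b c IH hd; have y0 : 0 <= y%:R :> R by []; lra.
Qed.
End Sums.

(** * Partial summation and sums of real characters *)

Lemma abel_bound (R : realType) (c f : nat -> R) (m n : nat) (B : R) :
  (forall k, `|\sum_(m <= i < k) c i| <= B) ->
  (forall i, (m <= i)%N -> f i.+1 <= f i) -> (forall i, (m <= i)%N -> 0 <= f i) ->
  `|\sum_(m <= i < n) c i * f i| <= B * f m.
Proof.
move=> hB fdec f0; have B0 : 0 <= B by apply: le_trans (hB 0%N); apply: normr_ge0.
have [nm|mn] := leqP n m; first by rewrite big_geq // normr0 mulr_ge0 ?f0.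
pose S k := \sum_(m <= i < k) c i.
have parts k : (m <= k)%N -> \sum_(m <= i < k) c i * f i =
    S k * f k + \sum_(m <= i < k) S i.+1 * (f i - f i.+1).
  elim: k => [|k IH] mk; first by rewrite /S !big_geq // mul0r addr0.
  have [mk'|mk'] := leqP m k; last by rewrite /S !big_geq // mul0r addr0.
  rewrite !(@big_nat_recr _ _ _ k) //= IH // /S (@big_nat_recr _ _ _ k) //=; ring.
rewrite parts 1?ltnW //; apply: le_trans (ler_normD _ _) _.
have hsum k : (m <= k)%N -> `|\sum_(m <= i < k) S i.+1 * (f i - f i.+1)| <= B * (f m - f k).
  elim: k => [|k IH] mk.
    by have -> : m = 0%N by [move: mk; rewrite leqn0 => /eqP]; rewrite big_geq // normr0 subrr mulr0.
  have [mk'|mk'] := leqP m k; last first.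
    have -> : m = k.+1 by apply/eqP; rewrite eqn_leq mk.
    by rewrite big_geq // normr0 subrr mulr0.
  rewrite big_nat_recr //=; apply: le_trans (ler_normD _ _) _.
  have -> : B * (f m - f k.+1) = B * (f m - f k) + B * (f k - f k.+1) by ring.
  apply: lerD; first exact: IH.
  have hf : 0 <= f k - f k.+1 by rewrite subr_ge0 fdec.
  by rewrite normrM (ger0_norm hf) ler_wpM2r //; apply: hB.
have -> : B * f m = B * f n + B * (f m - f n) by ring.
apply: lerD; last exact: hsum (ltnW mn).
have hf := f0 n (ltnW mn); rewrite normrM (ger0_norm hf) ler_wpM2r //; exact: hB.
Qed.

(** Vanishing at numbers not coprime to [M] is not demanded, so a character stays one modulo every
    multiple of its modulus; characters of different conductors can thus share a common [M]. *)
Definition real_char (M : nat) (chi : nat -> int) : Prop :=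
  [/\ chi 1%N = 1, forall m n, chi (m * n)%N = chi m * chi n,
      forall n, chi (n + M)%N = chi n,
      forall n, [\/ chi n = 0, chi n = 1 | chi n = -1]
    & forall n, coprime n M -> chi n != 0].

Definition nonprincipal (M : nat) (chi : nat -> int) : Prop :=
  exists2 a, coprime a M & chi a = -1.

Section CharSum.
Variables (M : nat) (chi : nat -> int).
Hypotheses (M0 : (0 < M)%N) (hchi : real_char M chi).

Lemma char_mod n : chi (n %% M)%N = chi n.
Proof.
case: hchi => _ _ per _ _; rewrite {2}(divn_eq n M) addnC.
by elim: (n %/ M)%N => [|k IH]; rewrite ?mul0n ?addn0 // mulSn addnCA addnC per.
Qed.

Lemma char_norm_le1 n : `|chi n| <= 1.
Proof. by case: hchi => _ _ _ /(_ n) [] -> _. Qed.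

Lemma char_pow n k : chi (n ^ k)%N = chi n ^+ k.
Proof.
case: hchi => h1 hM _ _ _.
by elim: k => [|k IH]; rewrite ?expn0 // expnS hM IH exprS.
Qed.

Hypothesis hnp : nonprincipal M chi.

Lemma char_sum_period m : \sum_(m <= i < m + M) chi i = 0.
Proof.
case: hchi => _ hM per _ _; elim: m => [|m IH].
  rewrite add0n big_mkord; have [a ca ha] := hnp.
  (* Multiplication by [a] permutes the residues and, as [chi a = -1], changes the sign of the
     sum. *)
  pose h (i : 'I_M) : 'I_M := Ordinal (ltn_pmod (a * i) M0).
  have hinj : injective h.
    have wl (i j : 'I_M) : (i <= j)%N -> h i = h j -> i = j.
      move=> ij [] /esym/eqP; rewrite eqn_mod_dvd ?leq_mul2l ?ij ?orbT // -mulnBr.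
      rewrite Gauss_dvdr 1?coprime_sym // => hd; apply: val_inj => /=; apply/eqP.
      rewrite eqn_leq ij /= -subn_eq0; apply/negPn/negP; rewrite -lt0n => h0.
      have := dvdn_leq h0 hd; have := ltn_ord j; lia.
    by move=> i j hij; have [ij|/ltnW ji] := leqP i j; [exact: wl|apply/esym/wl].
  have : \sum_(i < M) chi i = - \sum_(i < M) chi i.
    rewrite {1}(reindex_inj hinj) /= -sumrN; apply: eq_bigr => i _.
    by rewrite char_mod hM ha mulN1r.
  by clear; move: (\sum_(i < M) _) => x; lia.
have e1 : \sum_(m <= i < m + M) chi i = chi m + \sum_(m.+1 <= i < m + M) chi i.
  by rewrite big_ltn // -{1}[m]addn0 ltn_add2l.
rewrite addSn big_nat_recr /=; last by rewrite -addn1 leq_add2l.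
by rewrite per addrC -e1 IH.
Qed.

Lemma char_sum_bound m n : `|\sum_(m <= i < n) chi i| <= M%:Z.
Proof.
elim/ltn_ind: n => n IH; have [nM|Mn] := leqP n (m + M).
  apply: le_trans (ler_norm_sum _ _ _) _.
  apply: (@le_trans _ _ (\sum_(m <= i < n) 1)); first by apply: ler_sum => i _; apply: char_norm_le1.
  rewrite sumr_const_nat -[1 *+ _]/((n - m)%N%:R) natz lez_nat; lia.
rewrite (@big_cat_nat _ _ _ (n - M)) //=; [|lia|lia].
have -> : \sum_(n - M <= i < n) chi i = 0 by rewrite -[in X in \sum_(_ <= i < X) _](@subnK M n) ?char_sum_period //; lia.
by rewrite addr0 IH //; lia.
Qed.
End CharSum.

(** * Non-vanishing of real L-functions at 1 *)

Section CharDivisorSum.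
Variables (M : nat) (chi : nat -> int).
Hypothesis hchi : real_char M chi.

Let r n := \sum_(d <- divisors n) chi d.

Let r1 : r 1 = 1.
Proof. by case: hchi => h1 _ _ _ _; rewrite /r (_ : divisors 1 = [:: 1%N]) // big_seq1. Qed.

Let r_pow p k m : prime p -> (0 < m)%N -> coprime p m ->
  r (p ^ k * m) = (\sum_(j < k.+1) chi p ^+ j) * r m.
Proof.
move=> pp m0 cpm; elim: k => [|k IH].
  by rewrite big_ord_recr big_ord0 /= expn0 mul1n add0r mul1r.
rewrite /r (perm_big _ (filter_dvdn_prime_pow k pp m0 cpm)) big_cat /= -/(r _) IH big_map.
rewrite [in RHS]big_ord_recr /= mulrDl; congr (_ + _); rewrite mulr_sumr.
by apply: eq_bigr => e _; case: (hchi) => _ hM _ _ _; rewrite hM (char_pow hchi).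
Qed.

Let geom_ge0 (c : int) k : [\/ c = 0, c = 1 | c = -1] ->
  0 <= \sum_(j < k.+1) c ^+ j /\ (~~ odd k -> 1 <= \sum_(j < k.+1) c ^+ j).
Proof.
case=> ->.
- rewrite big_ord_recl expr0 big1 ?addr0 //= => j _; by rewrite exprS mul0r.
- have -> : \sum_(j < k.+1) (1 : int) ^+ j = k.+1%:R.
    by rewrite (eq_bigr (fun=> 1)) => [|j _]; rewrite ?expr1n // sumr_const card_ord.
  by rewrite natz.
have -> : \sum_(j < k.+1) (-1 : int) ^+ j = (~~ odd k)%:R.
  elim: k => [|k IH]; first by rewrite big_ord_recr big_ord0 /= add0r.
  by rewrite big_ord_recr /= IH -signr_odd /=; case: (odd k).
by case: odd.
Qed.

(** The divisor sum is multiplicative, and its factor at [p ^ k] is a geometric sum in [chi p]: it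
    is 1, [k + 1], or alternately 1 and 0, and never 0 for even [k]. *)
Lemma char_divisor_sum_ge0 n : (0 < n)%N -> 0 <= \sum_(d <- divisors n) chi d.
Proof.
move: n; apply: prime_pow_ind => [|p k m pp m0 cpm IH]; first by rewrite -/(r 1) r1.
rewrite -/(r _) r_pow // mulr_ge0 //.
by case: (hchi) => _ _ _ hv _; case: (geom_ge0 k (hv p)).
Qed.

Lemma char_divisor_sum_sqr n : (0 < n)%N -> 1 <= \sum_(d <- divisors (n * n)) chi d.
Proof.
move: n; apply: prime_pow_ind => [|p k m pp m0 cpm IH]; first by rewrite -/(r _) r1.
have -> : (p ^ k * m * (p ^ k * m) = p ^ k.*2 * (m * m))%N.
  by rewrite -addnn expnD; ring.
rewrite -/(r _) r_pow ?muln_gt0 ?m0 ?coprimeMr ?cpm //.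
case: (hchi) => _ _ _ hv _; case: (geom_ge0 k.*2 (hv p)) => _; rewrite odd_double => /(_ isT) h.
by rewrite -[1]mulr1 ler_pM.
Qed.
End CharDivisorSum.

Section LNonvanishing.
Variables (R : realType) (M : nat) (chi : nat -> int).
Hypotheses (M0 : (0 < M)%N) (hchi : real_char M chi) (hnp : nonprincipal M chi).

Let chR n : R := (chi n)%:~R.

Lemma char_weighted_bound (f : nat -> R) (m n : nat) :
  (forall i, (m <= i)%N -> f i.+1 <= f i) -> (forall i, (m <= i)%N -> 0 <= f i) ->
  `|\sum_(m <= i < n) chR i * f i| <= M%:R * f m.
Proof.
apply: abel_bound => k; rewrite /chR -rmorph_sum /= -intr_norm.
by rewrite -[M%:R]/(M%:Z%:~R) ler_int; apply: char_sum_bound.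
Qed.

Definition Lsum (x : nat) : R := \sum_(1 <= n < x.+1) chR n * n%:R^-1.

Lemma Lsum_tail x y : (x <= y)%N -> `|Lsum y - Lsum x| <= M%:R / x.+1%:R.
Proof.
move=> xy; rewrite /Lsum (@big_cat_nat _ _ _ x.+1) //= addrAC subrr add0r.
apply: char_weighted_bound => i xi.
  by rewrite lef_pV2 ?posrE ?ltr0n ?ler_nat //; lia.
by rewrite invr_ge0.
Qed.

Let sq n : R := Num.sqrt n%:R.
Let sq0 n : 0 <= sq n. Proof. exact: sqrtr_ge0. Qed.
Let sq_gt0 n : (0 < n)%N -> 0 < sq n. Proof. by move=> n0; rewrite sqrtr_gt0 ltr0n. Qed.
Let sq_le m n : (m <= n)%N -> sq m <= sq n. Proof. by move=> mn; rewrite ler_wsqrtr // ler_nat. Qed.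
Let sq_sqr n : sq n * sq n = n%:R. Proof. by rewrite -expr2 sqr_sqrtr. Qed.
Let sqM m n : sq (m * n) = sq m * sq n. Proof. by rewrite /sq natrM sqrtrM. Qed.
Let sqV_le m n : (0 < m)%N -> (m <= n)%N -> (sq n)^-1 <= (sq m)^-1.
Proof. by move=> m0 mn; rewrite lef_pV2 ?posrE ?sq_gt0 ?sq_le //; apply: leq_trans mn. Qed.

(* [B y] is the partial sum of n^(-1/2); [B y - 2 sqrt y] converges. *)
Let B (y : nat) : R := \sum_(1 <= e < y.+1) (sq e)^-1.

(** With a and b the square roots of y and y + 1, b - a = 1 / (a + b) lies between 1 / (2b) and 1 /
    (2a). *)
Let B_step y : (0 < y)%N ->
  0 <= (B y - 2 * sq y) - (B y.+1 - 2 * sq y.+1) <= (sq y)^-1 - (sq y.+1)^-1.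
Proof.
have BS : B y.+1 = B y + (sq y.+1)^-1 by rewrite /B big_nat_recr.
move=> y0; rewrite BS; set S := B y.
have a0 := sq_gt0 y0; have b0 := sq_gt0 (ltn0Sn y).
have ab : sq y <= sq y.+1 by apply: sq_le.
have e : sq y.+1 * sq y.+1 = sq y * sq y + 1 by rewrite !sq_sqr natr1.
set a := sq y in a0 ab e *; set b := sq y.+1 in b0 ab e *.
have h : (b - a) = (b + a)^-1.
  apply: (@mulIf _ (b + a)); first by rewrite gt_eqF // addr_gt0.
  by rewrite mulVf ?gt_eqF ?addr_gt0 //; lra.
have -> : (S - 2 * a) - (S + b^-1 - 2 * b) = 2 * (b + a)^-1 - b^-1 by rewrite -h; ring.
have h1 : b^-1 <= 2 * (b + a)^-1.
  by rewrite -[2]invrK -invfM lef_pV2 ?posrE ?mulr_gt0 ?invr_gt0 ?addr_gt0 //; lra.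
have h2 : 2 * (b + a)^-1 <= a^-1.
  by rewrite -[2]invrK -invfM lef_pV2 ?posrE ?mulr_gt0 ?invr_gt0 ?addr_gt0 //; lra.
by apply/andP; split; lra.
Qed.

Let B_cauchy y z : (0 < y)%N -> (y <= z)%N ->
  0 <= (B y - 2 * sq y) - (B z - 2 * sq z) <= (sq y)^-1 - (sq z)^-1.
Proof.
move=> y0; elim: z => [|z IH]; first by case: y y0.
rewrite leq_eqVlt => /orP[/eqP <-|]; first by rewrite !subrr lexx.
rewrite ltnS => yz; have /andP[h1 h2] := IH yz.
have /andP[h3 h4] := B_step (leq_trans y0 yz).
by apply/andP; split; lra.
Qed.

Let B_le y : B y <= 2 * sq y.
Proof.
case: y => [|y]; first by rewrite /B big_geq // mulr_ge0.
have /andP[h _] := @B_cauchy 1 y.+1 isT isT.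
have s1 : sq 1 = 1 by rewrite /sq sqrtr1.
by move: h; rewrite {1}/B big_nat1 s1 invr1; lra.
Qed.

(** Stands for the limit of [B y - 2 * sq y]; its value at [D * D] is close enough, and no limit has
    to be taken. *)
Let c0 D : R := B (D * D) - 2 * sq (D * D).

Let c0_le D : (0 < D)%N -> `|c0 D| <= 2.
Proof.
move=> D0; have D2 : (0 < D * D)%N by rewrite muln_gt0 D0.
have /andP[h1 h2] := @B_cauchy 1 _ isT D2.
have s1 : sq 1 = 1 by rewrite /sq sqrtr1.
have h3 : 0 <= (sq (D * D))^-1 by rewrite invr_ge0.
move: h1 h2; rewrite {1 3}/B big_nat1 s1 invr1 -/(c0 D) => h1 h2.
by rewrite ler_norml; apply/andP; split; lra.
Qed.

(** As [d <= D], the quotient [y] is at least [D]. Replacing the constant by [c0 D] and the square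
    root of [y] by that of the unrounded quotient costs at most [(sq y)^-1] each. *)
Let B_main D d : (0 < d)%N -> (d <= D)%N ->
  `|B (D * D %/ d) - (2 * D%:R / sq d + c0 D)| <= 2 / sq D.
Proof.
move=> d0 dD; have D0 : (0 < D)%N by apply: leq_trans dD.
set y := (D * D %/ d)%N.
have yD : (D <= y)%N by rewrite leq_divRL // leq_mul2l dD orbT.
have yDD : (y <= D * D)%N by apply: leq_div.
have y0 : (0 < y)%N by apply: leq_trans yD.
have /andP[h1 h2] := B_cauchy y0 yDD; rewrite -/(c0 D) in h1 h2.
have h3 : 0 <= (sq (D * D))^-1 by rewrite invr_ge0.
have h4 : (sq y)^-1 <= (sq D)^-1 by apply: sqV_le.
pose t : R := D%:R / sq d.
have t2 : t * t = (D * D)%:R / d%:R.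
  by rewrite /t natrM -(sq_sqr d) invfM; ring.
have d0R : 0 < d%:R :> R by rewrite ltr0n.
have t0 : 0 <= t by rewrite mulr_ge0 ?invr_ge0.
have yt : y%:R <= t * t.
  by rewrite t2 ler_pdivlMr // -natrM ler_nat leq_divM.
have ty : t * t <= y%:R + 1.
  by rewrite t2 ler_pdivrMr // natr1 -natrM ler_nat ltnW // ltn_ceil.
have sy0 := sq_gt0 y0; have sD0 := sq_gt0 D0.
have syt : sq y <= t.
  by rewrite -(ler_pXn2r (n:=2)) ?nnegrE // !expr2 sq_sqr.
have h5 : 2 * (t - sq y) <= (sq y)^-1.
  rewrite -(ler_pM2r sy0) mulVf ?gt_eqF //; have := sq_sqr y; nra.
have -> : B y - (2 * D%:R / sq d + c0 D) = (B y - 2 * sq y - c0 D) - 2 * (t - sq y) by rewrite /t; ring.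
by rewrite ler_norml; apply/andP; split; lra.
Qed.

Let G (D : nat) : R :=
  \sum_(1 <= n < (D * D).+1) (\sum_(d <- divisors n) chi d)%:~R * (sq n)^-1.

(** All terms are nonnegative, and the term at [n = k ^ 2] is at least [1 / k]: the harmonic sum is
    a lower bound. *)
Let G_ge D : ln D.+1%:R <= G D.
Proof.
apply: (@le_trans _ _ (\sum_(1 <= k < D.+1) k%:R^-1)).
  elim: D => [|D IH]; first by rewrite ln1 big_geq.
  rewrite big_nat_recr //=; apply: (@le_trans _ _ (ln D.+1%:R + D.+1%:R^-1)); last by rewrite lerD2r.
  have h : D.+2%:R = D.+1%:R * (1 + D.+1%:R^-1) :> R.
    by rewrite mulrDr mulr1 mulfV ?pnatr_eq0 // natr1.
  have hp : 0 < D.+1%:R^-1 :> R by rewrite invr_gt0.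
  rewrite h lnM ?posrE ?addr_gt0 // lerD2l; apply: le_ln1Dx.
  by apply: lt_trans hp; rewrite ltrN10.
rewrite /G; elim: D => [|D IH]; first by rewrite !big_geq.
have hDD : ((D * D).+1 <= (D.+1 * D.+1).+1)%N by rewrite ltnS leq_mul.
have hDy : (D * D < D.+1 * D.+1)%N by rewrite ltn_mul.
set y := (D.+1 * D.+1)%N in hDD hDy *.
rewrite big_nat_recr //= [leRHS](@big_cat_nat _ _ _ (D * D).+1) //=.
apply: lerD => //.
have pos n : (0 < n)%N -> 0 <= (\sum_(d <- divisors n) chi d)%:~R * (sq n)^-1 :> R.
  by move=> n0; rewrite mulr_ge0 ?invr_ge0 // ler0z (char_divisor_sum_ge0 hchi).
rewrite big_nat_recr //=.
apply: (@le_trans _ _ ((\sum_(d <- divisors y) chi d)%:~R * (sq y)^-1)).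
  rewrite {2}/y sqM sq_sqr ler_peMl ?invr_ge0 // -[1]/(1%:~R) ler_int.
  by apply: (char_divisor_sum_sqr hchi).
rewrite lerDr big_nat_cond; apply: sumr_ge0 => n; rewrite andbT => /andP[hn _].
by apply: pos; apply: leq_ltn_trans hn.
Qed.

(** Dirichlet's hyperbola method, the pairs with [d * e <= D * D] being split at [d = D]. For
    [d <= D] the sum over [e] is [B]: its main term gives [Lsum D], its constant a bounded character
    sum, its error at most 4. For larger [d] the sum over [d] is done first; partial summation
    bounds it by [M / sq D], against [B D <= 2 * sq D]. *)
Let G_le D : (0 < D)%N -> G D <= 2 * D%:R * `|Lsum D| + 4 * M%:R + 4.
Proof.
move=> D0; set x := (D * D)%N.
have xD : (D < x.+1)%N by rewrite ltnS leq_pmulr.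
have -> : G D = \sum_(1 <= d < x.+1) \sum_(1 <= e < (x %/ d).+1) chR d / sq d * (sq e)^-1.
  rewrite /G; transitivity (\sum_(1 <= n < x.+1) \sum_(d <- divisors n) chR d * (sq n)^-1).
    by apply: eq_bigr => n _; rewrite rmorph_sum mulr_suml.
  rewrite (sum_divisors_swap (fun d n => chR d * (sq n)^-1)).
  by apply: eq_bigr => d _; apply: eq_bigr => e _; rewrite sqM invfM mulrA.
rewrite (@big_cat_nat _ _ _ D.+1) //=.
have h1 : \sum_(1 <= d < D.+1) \sum_(1 <= e < (x %/ d).+1) chR d / sq d * (sq e)^-1 <=
   2 * D%:R * `|Lsum D| + 2 * M%:R + 4.
  have -> : \sum_(1 <= d < D.+1) \sum_(1 <= e < (x %/ d).+1) chR d / sq d * (sq e)^-1 =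
    2 * D%:R * Lsum D + c0 D * (\sum_(1 <= d < D.+1) chR d * (sq d)^-1) +
    \sum_(1 <= d < D.+1) chR d / sq d * (B (x %/ d) - (2 * D%:R / sq d + c0 D)).
    rewrite /Lsum !mulr_sumr -!big_split /=; apply: eq_big_nat => d /andP[d0 _].
    by rewrite -mulr_sumr -/(B _) -(sq_sqr d) invfM; ring.
  rewrite -addrA; apply: le_trans (lerD (ler_norm _) (ler_norm _)) _.
  rewrite normrM ger0_norm ?mulr_ge0 // -addrA lerD2l.
  apply: le_trans (ler_normD _ _) _; apply: lerD.
    rewrite normrM ler_pM //; first exact: c0_le.
    have := @char_weighted_bound (fun n => (sq n)^-1) 1 D.+1.
    have -> : sq 1 = 1 by rewrite /sq sqrtr1.
    rewrite invr1 mulr1; apply => i i0; last by rewrite invr_ge0.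
    exact: sqV_le.
  apply: le_trans (ler_norm_sum _ _ _) _.
  apply: (@le_trans _ _ (\sum_(1 <= d < D.+1) (sq d)^-1 * (2 / sq D))).
    apply: ler_sum_nat => d /andP[d0 dD].
    rewrite normrM ler_pM ?normr_ge0 //; last exact: B_main.
    rewrite normrM (ger0_norm (_ : 0 <= (sq d)^-1)) ?invr_ge0 // ler_piMl ?invr_ge0 //.
    by rewrite -intr_norm -[1]/(1%:~R) ler_int (char_norm_le1 hchi).
  rewrite -mulr_suml -/(B D) mulrA ler_pdivrMr ?sq_gt0 //.
  by have := B_le D; lra.
apply: le_trans (lerD h1 (ler_norm _)) _.
have h2 : `|\sum_(D.+1 <= d < x.+1) \sum_(1 <= e < (x %/ d).+1) chR d / sq d * (sq e)^-1| <= 2 * M%:R.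
  have -> : \sum_(D.+1 <= d < x.+1) \sum_(1 <= e < (x %/ d).+1) chR d / sq d * (sq e)^-1 =
      \sum_(1 <= e < D.+1) (sq e)^-1 * \sum_(D.+1 <= d < (x %/ e).+1) chR d * (sq d)^-1.
    transitivity (\sum_(D.+1 <= d < x.+1) \sum_(1 <= e < D.+1 | (d * e <= x)%N) chR d / sq d * (sq e)^-1).
      apply: eq_big_nat => d /andP[Dd _]; have d0 : (0 < d)%N by apply: leq_ltn_trans Dd.
      rewrite (@big_nat_widen _ _ _ 1 _ D.+1) /=; last first.
        by rewrite ltnS -(leq_pmul2r d0); apply: leq_trans (leq_divM _ _) _; rewrite leq_mul2l ltnW ?orbT.
      by apply: eq_bigl => e; rewrite ltnS leq_divRL // mulnC.
    rewrite (exchange_big_dep_nat predT) //=; apply: eq_big_nat => e /andP[e0 eD].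
    rewrite mulr_sumr [RHS](@big_nat_widen _ _ _ D.+1 _ x.+1) /=; last by apply: leq_div.
    by apply: eq_big => d; [rewrite ltnS leq_divRL | move=> _; rewrite mulrC].
  apply: le_trans (ler_norm_sum _ _ _) _.
  apply: (@le_trans _ _ (\sum_(1 <= e < D.+1) (sq e)^-1 * (M%:R * (sq D)^-1))).
    apply: ler_sum_nat => e /andP[e0 eD].
    rewrite normrM (ger0_norm (_ : 0 <= (sq e)^-1)) ?invr_ge0 // ler_pM ?invr_ge0 //.
    apply: le_trans (@char_weighted_bound (fun n => (sq n)^-1) _ _ _ _) _ => [i Di|i Di|].
    - by apply: sqV_le => //; apply: leq_ltn_trans Di.
    - by rewrite invr_ge0.
    by rewrite ler_wpM2l // sqV_le.
  rewrite -mulr_suml -/(B D) mulrA ler_pdivrMr ?sq_gt0 //.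
  by have := B_le D; have : 0 <= M%:R :> R by []; nra.
lra.
Qed.

(** [G D] grows at least like ln D, whereas [G_le] would keep it bounded if [Lsum D] were as small
    as 1 / D. One large [D] thus gives a lower bound there, and [Lsum_tail] carries it to all later
    [x]. *)
Lemma Lsum_nonvanishing : exists2 c : R, 0 < c & exists x0, forall x, (x0 <= x)%N -> c <= `|Lsum x|.
Proof.
(* Here 4M + 4 is lost in [G_le] and 2M in the tail; the remaining 1 yields the constant 1 /
   (2D). *)
have [D] : exists D : nat, 6 * M%:R + 5 <= (ln D.+1%:R : R).
  pose t : R := expR (6 * M%:R + 5); exists (Num.trunc t).
  rewrite -[leLHS]expRK ler_ln ?posrE ?expR_gt0 ?ltr0n //.
  by apply/ltW/truncnS_gt.
case: D => [|D] hD; first by move: hD; rewrite ln1; have : 0 <= M%:R :> R by []; lra.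
have D0 : 0 < D.+1%:R :> R by [].
exists (2 * D.+1%:R)^-1; first by rewrite invr_gt0 mulr_gt0.
exists D.+1 => x Dx.
have h1 := le_trans hD (le_trans (G_ge _) (G_le (ltn0Sn D))).
have h2 := Lsum_tail Dx.
have h3 : `|Lsum D.+1| <= `|Lsum x| + M%:R / D.+2%:R.
  have -> : Lsum D.+1 = Lsum x - (Lsum x - Lsum D.+1) by ring.
  by apply: le_trans (ler_normB _ _) _; rewrite lerD2l.
have h4 : D.+1%:R * (M%:R / D.+2%:R) <= M%:R :> R.
  by rewrite mulrA ler_pdivrMr // mulrC ler_wpM2l // ler_nat.
rewrite -[X in X <= _]mul1r ler_pdivrMr ?mulr_gt0 //.
move: h1 h2 h3 h4; set u := `|Lsum x|; set v := `|Lsum _|; set w := M%:R / _.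
set d := D.+1%:R in D0 *; move=> h1 _ h3 h4; nra.
Qed.
End LNonvanishing.

(** * Primes with prescribed values of real characters *)

Section Mertens.
Variables (R : realType) (M : nat) (chi : nat -> int).
Hypotheses (M0 : (0 < M)%N) (hchi : real_char M chi) (hnp : nonprincipal M chi).
Let chR n : R := (chi n)%:~R.

Let chR_norm n : `|chR n| <= 1.
Proof. by rewrite -intr_norm -[1]/(1%:~R) ler_int (char_norm_le1 hchi). Qed.

Let H (x : nat) : R := \sum_(1 <= n < x.+1) chR n * (ln n%:R / n%:R).

Let H_bound : exists C, forall x, `|H x| <= C.
Proof.
(* The function ln n / n decreases only from n >= e on, so the terms before [N0] are bounded
   trivially. *)
pose N0 := (Num.trunc (expR 1 : R)).+1.
have hN0 n : (N0 <= n)%N -> 1 <= ln n%:R :> R.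
  move=> hn; have n0 : (0 < n)%N by apply: leq_trans hn.
  rewrite -[leLHS]expRK ler_ln ?posrE ?expR_gt0 ?ltr0n //.
  by apply: (@le_trans _ _ N0%:R); [apply/ltW/truncnS_gt | rewrite ler_nat].
have f0 n : 0 <= ln n%:R / n%:R :> R.
  case: n => [|n]; first by rewrite invr0 mulr0.
  by rewrite mulr_ge0 ?invr_ge0 // ln_ge0 // ler1n.
have f1 n : ln n%:R / n%:R <= 1 :> R.
  case: n => [|n]; first by rewrite invr0 mulr0.
  by rewrite ler_pdivrMr // mul1r ltW // ln_sublinear.
have fdec n : (N0 <= n)%N -> ln n.+1%:R / n.+1%:R <= ln n%:R / n%:R :> R.
  move=> hn; have n0 : 0 < n%:R :> R by rewrite ltr0n; apply: leq_trans hn.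
  have h1 := hN0 n hn.
  have hl : ln n.+1%:R <= ln n%:R + n%:R^-1 :> R.
    have e : n.+1%:R = n%:R * (1 + n%:R^-1) :> R by rewrite mulrDr mulr1 mulfV ?gt_eqF // natr1.
    have hp : 0 < n%:R^-1 :> R by rewrite invr_gt0.
    rewrite e lnM ?posrE ?addr_gt0 // lerD2l; apply: le_ln1Dx.
    by apply: lt_trans hp; rewrite ltrN10.
  rewrite ler_pdivrMr // mulrAC ler_pdivlMr //.
  apply: le_trans (ler_wpM2r (ltW n0) hl) _.
  by rewrite mulrDl mulVf ?gt_eqF // -[n.+1%:R]natr1 mulrDr mulr1 lerD2l.
exists (N0%:R + M%:R * (ln N0%:R / N0%:R)) => x.
have small y : (y <= N0)%N -> `|\sum_(1 <= n < y) chR n * (ln n%:R / n%:R)| <= N0%:R.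
  move=> yN; apply: le_trans (ler_norm_sum _ _ _) _.
  apply: (@le_trans _ _ (\sum_(1 <= n < y) 1)).
    apply: ler_sum => n _; rewrite normrM (ger0_norm (f0 n)) -[leRHS]mulr1.
    by apply: ler_pM.
  by rewrite sumr_const_nat ler_nat; lia.
have [xN|Nx] := leqP x.+1 N0.
  apply: le_trans (small _ xN) _; rewrite lerDl mulr_ge0 //.
rewrite /H (@big_cat_nat _ _ _ N0) //=; last exact: ltnW.
apply: le_trans (ler_normD _ _) _; apply: lerD; first exact: small.
exact: (char_weighted_bound M0 hchi hnp).
Qed.

Let T (x : nat) : R := \sum_(1 <= d < x.+1) chR d * vonMangoldt R d * d%:R^-1.

Let H_T x : H x = \sum_(1 <= d < x.+1) chR d * vonMangoldt R d * d%:R^-1 * Lsum R chi (x %/ d).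
Proof.
transitivity (\sum_(1 <= n < x.+1) \sum_(d <- divisors n) chR n * vonMangoldt R d * n%:R^-1).
  apply: eq_big_nat => n /andP[n0 _]; rewrite -mulr_suml -mulr_sumr sum_vonMangoldt //; ring.
rewrite (sum_divisors_swap (fun d n => chR n * vonMangoldt R d * n%:R^-1)).
apply: eq_bigr => d _; rewrite /Lsum mulr_sumr; apply: eq_bigr => e _.
by rewrite /chR; case: hchi => _ -> _ _ _; rewrite rmorphM natrM invfM /=; ring.
Qed.

(** By [H_T] the bounded sum [H x] is this sum with weights [Lsum (x %/ d)]. Replacing each weight
    by [Lsum x] costs at most [M * d / x] per term, in total [M * psi x / x <= 4 * M]; then one
    divides by [Lsum x], which stays away from 0. *)
Lemma char_mertens : exists C, forall x, `|\sum_(1 <= d < x.+1) chR d * vonMangoldt R d * d%:R^-1| <= C.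
Proof.
have [C1 hC1] := H_bound.
have [c c0 [x0 hx0]] := Lsum_nonvanishing R M0 hchi hnp.
have C10 : 0 <= C1 by apply: le_trans (hC1 0%N); apply: normr_ge0.
have MR0 : 0 <= M%:R :> R by [].
have K0 : 0 <= (C1 + 4 * M%:R) / c by rewrite mulr_ge0 ?invr_ge0 ?addr_ge0 ?mulr_ge0 // ltW.
exists ((C1 + 4 * M%:R) / c + 4 * x0.+1%:R) => x; rewrite -/(T x).
have [xx0|x0x] := ltnP x x0.+1.
  apply: (@le_trans _ _ (4 * x0.+1%:R)); last by rewrite lerDr.
  apply: (@le_trans _ _ (psi R x)); last first.
    by apply: le_trans (psi_le R x) _; rewrite ler_pM2l // ler_nat ltnW.
  apply: le_trans (ler_norm_sum _ _ _) _; apply: ler_sum_nat => d /andP[d0 _].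
  rewrite !normrM (ger0_norm (vonMangoldt_ge0 R d)) [`|d%:R^-1|]ger0_norm ?invr_ge0 //.
  rewrite mulrAC ler_piMl ?vonMangoldt_ge0 // -[leRHS]mulr1 ler_pM ?invr_ge0 //.
  by rewrite invf_le1 ?ltr0n // ler1n.
have x1 : (0 < x)%N by apply: leq_trans x0x.
have xR : 0 < x%:R :> R by rewrite ltr0n.
have hLT : Lsum R chi x * T x = H x - \sum_(1 <= d < x.+1) chR d * vonMangoldt R d * d%:R^-1 * (Lsum R chi (x %/ d) - Lsum R chi x).
  rewrite H_T -sumrB /T mulr_sumr; apply: eq_bigr => d _; ring.
have hE : `|\sum_(1 <= d < x.+1) chR d * vonMangoldt R d * d%:R^-1 * (Lsum R chi (x %/ d) - Lsum R chi x)| <= 4 * M%:R.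
  apply: le_trans (ler_norm_sum _ _ _) _.
  apply: (@le_trans _ _ (\sum_(1 <= d < x.+1) vonMangoldt R d * (M%:R / x%:R))).
    apply: ler_sum_nat => d /andP[d0 _].
    have d0R : 0 < d%:R :> R by rewrite ltr0n.
    rewrite !normrM (ger0_norm (vonMangoldt_ge0 R d)) [`|d%:R^-1|]ger0_norm ?invr_ge0 //.
    rewrite [`|chR d| * _]mulrC -!mulrA ler_wpM2l ?vonMangoldt_ge0 //.
    apply: (@le_trans _ _ (1 * (d%:R^-1 * (M%:R / (x %/ d).+1%:R)))).
      apply: ler_pM; rewrite ?mulr_ge0 ?invr_ge0 ?normr_ge0 //.
      rewrite ler_wpM2l ?invr_ge0 // distrC; apply: (Lsum_tail R M0 hchi hnp); exact: leq_div.
    rewrite mul1r mulrCA ler_wpM2l // -invfM lef_pV2 ?posrE ?mulr_gt0 ?ltr0n //.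
    by rewrite -natrM ler_nat mulnC ltnW // ltn_ceil.
  rewrite -mulr_suml -/(psi R x) mulrA ler_pdivrMr //.
  have := psi_le R x; nra.
have : c * `|T x| <= C1 + 4 * M%:R.
  apply: (@le_trans _ _ (`|Lsum R chi x| * `|T x|)).
    by rewrite ler_wpM2r // hx0 // ltnW.
  by rewrite -normrM hLT; apply: le_trans (ler_normB _ _) _; apply: lerD.
rewrite mulrC -ler_pdivlMr // => h; apply: le_trans h _; by rewrite lerDl.
Qed.
End Mertens.

(** Both sides are compared with ln (2y)!: its upper half of factors alone gives y ln y, and
    [sum_ln_floor] without the rounding bounds it above. *)
Lemma vonMangoldt_sum_ge (R : realType) (y : nat) : (0 < y)%N ->
  ln y%:R <= 2 * \sum_(1 <= d < y.*2.+1) vonMangoldt R d * d%:R^-1.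
Proof.
move=> y0; have yR : 0 < y%:R :> R by rewrite ltr0n.
have h1 : y%:R * ln y%:R <= \sum_(1 <= n < y.*2.+1) (ln n%:R : R).
  rewrite (@big_cat_nat _ _ _ y.+1) //=; last by rewrite ltnS -addnn leq_addr.
  apply: ler_wpDl.
    rewrite big_nat_cond; apply: sumr_ge0 => n; rewrite andbT => /andP[n0 _].
    by rewrite ln_ge0 // ler1n.
  apply: (@le_trans _ _ (\sum_(y.+1 <= n < y.*2.+1) ln y%:R)).
    by rewrite sumr_const_nat subSS -addnn addnK mulr_natl.
  apply: ler_sum_nat => n /andP[yn _].
  by rewrite ler_ln ?posrE ?ltr0n ?ler_nat //; [exact: ltnW|apply: leq_ltn_trans yn].
have h2 : \sum_(1 <= n < y.*2.+1) (ln n%:R : R) <= y.*2%:R * \sum_(1 <= d < y.*2.+1) vonMangoldt R d * d%:R^-1.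
  rewrite sum_ln_floor mulr_sumr; apply: ler_sum_nat => d /andP[d0 _].
  rewrite mulrCA ler_wpM2l ?vonMangoldt_ge0 // ler_pdivlMr ?ltr0n // -natrM ler_nat.
  exact: leq_divM.
have := le_trans h1 h2; rewrite -muln2 natrM -mulrA ler_pM2l //.
Qed.

(** Only powers of the primes dividing [M] contribute, and for each such prime a geometric series of
    ratio at most 1/2 remains. *)
Lemma vonMangoldt_sum_noncoprime (R : realType) (M : nat) : (0 < M)%N ->
  exists C : R, forall x, \sum_(1 <= d < x.+1 | ~~ coprime d M) vonMangoldt R d * d%:R^-1 <= C.
Proof.
move=> M0; exists (\sum_(p <- primes M) ln p%:R) => x.
have lnp p : prime p -> 0 <= ln p%:R :> R by move=> pp; rewrite ln_ge0 // ler1n prime_gt0.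
apply: (@le_trans _ _ (\sum_(1 <= d < x.+1) \sum_(p <- primes M) \sum_(1 <= k < x.+1)
    (d == p ^ k)%N%:R * (ln p%:R / d%:R) : R)).
  rewrite big_mkcond; apply: ler_sum_nat => d /andP[d0 dx].
  have pos : 0 <= \sum_(p <- primes M) \sum_(1 <= k < x.+1) (d == p ^ k)%N%:R * (ln p%:R / d%:R) :> R.
    rewrite big_seq; apply: sumr_ge0 => p; rewrite mem_primes => /andP[pp _].
    by apply: sumr_ge0 => k _; rewrite !mulr_ge0 ?invr_ge0 // lnp.
  case: ifP => // hc; have [->|/vonMangoldt_neq0 [p [k [pp dE ->]]]] := eqVneq (vonMangoldt R d) 0.
    by rewrite mul0r.
  have pM : p \in primes M.
    rewrite mem_primes pp M0 /=; move: hc; rewrite dE coprime_pexpl //.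
    by rewrite prime_coprime // negbK.
  rewrite (big_rem p) //= (bigD1_seq k.+1) ?iota_uniq //=; last first.
    rewrite mem_index_iota /=; apply: leq_trans dx; rewrite dE ltnS.
    by apply/ltnW/ltn_expl/prime_gt1.
  rewrite dE eqxx mul1r -addrA lerDl addr_ge0 //.
    by apply: sumr_ge0 => j _; rewrite !mulr_ge0 ?invr_ge0 // lnp.
  rewrite big_seq; apply: sumr_ge0 => q /mem_rem; rewrite mem_primes => /andP[qq _].
  by apply: sumr_ge0 => j _; rewrite !mulr_ge0 ?invr_ge0 // lnp.
rewrite exchange_big /= big_seq [leRHS]big_seq; apply: ler_sum => p; rewrite mem_primes => /andP[pp _].
rewrite exchange_big /=; apply: (@le_trans _ _ (\sum_(1 <= k < x.+1) ln p%:R * (2^-1) ^+ k)).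
  apply: ler_sum_nat => k /andP[k0 _].
  apply: (@le_trans _ _ (ln p%:R / (p ^ k)%N%:R)).
    have [h|h] := boolP ((p ^ k)%N \in index_iota 1 x.+1).
      rewrite (bigD1_seq (p ^ k)%N) ?iota_uniq //= eqxx mul1r big1 ?addr0 // => d /negPf ->.
      by rewrite mul0r.
    rewrite big_seq big1 ?mulr_ge0 ?invr_ge0 ?lnp // => d hd.
    by case: eqP => [e|]; rewrite ?mul0r // -e hd in h *.
  rewrite ler_wpM2l ?lnp // exprVn natrX lef_pV2 ?posrE ?exprn_gt0 ?ltr0n ?prime_gt0 //.
  by rewrite lerXn2r ?nnegrE // ler_nat prime_gt1.
rewrite -mulr_sumr ler_piMr ?lnp //.
have -> : \sum_(1 <= k < x.+1) (2^-1 : R) ^+ k = 1 - 2^-1 ^+ x.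
  elim: x => [|x IH]; first by rewrite big_geq // expr0 subrr.
  rewrite big_nat_recr //= IH exprS; lra.
by rewrite gerBl exprn_ge0 // invr_ge0.
Qed.

Section PrimePattern.
Variables (R : realType) (M : nat) (I : eqType) (chi : I -> nat -> int) (eps : I -> int).
Hypothesis M0 : (0 < M)%N.

(** A detector of sign patterns: for signs [eps], it is nonnegative and, at numbers coprime to [M],
    nonzero only where every [chi q] equals [eps q]. *)
Let P (qs : seq I) (n : nat) : int := \prod_(q <- qs) (1 + eps q * chi q n).
Let T (qs : seq I) (phi : nat -> int) (x : nat) : R :=
  \sum_(1 <= d < x.+1) (phi d * P qs d)%:~R * vonMangoldt R d * d%:R^-1.

Let T_cons q qs phi x :
  T (q :: qs) phi x = T qs phi x + (eps q)%:~R * T qs (fun n => phi n * chi q n) x.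
Proof.
rewrite /T mulr_sumr -big_split /=; apply: eq_bigr => d _.
rewrite /P big_cons !mulrDl !mul1r mulrDr !rmorphD !rmorphM /=; ring.
Qed.

Lemma real_charM phi1 phi2 : real_char M phi1 -> real_char M phi2 ->
  real_char M (fun n => phi1 n * phi2 n).
Proof.
case=> a1 a2 a3 a4 a5 [b1 b2 b3 b4 b5]; split.
- by rewrite a1 b1.
- by move=> m n; rewrite a2 b2; ring.
- by move=> n; rewrite a3 b3.
- move=> n; case: (a4 n) => ->; case: (b4 n) => ->;
    by [constructor 1|constructor 2|constructor 3].
by move=> n cn; rewrite mulf_neq0 ?a5 ?b5.
Qed.

(** Expanding [P] gives [phi] times products of the [chi q]. All of them take the value -1 at the
    same [a], so they are nonprincipal and [char_mertens] applies; the induction generalises [phi]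
    to expand one factor at a time. *)
Let T_bounded qs : (forall q, q \in qs -> real_char M (chi q)) ->
  forall phi, real_char M phi ->
  (exists a, [/\ coprime a M, phi a = -1 & forall q, q \in qs -> chi q a = 1]) ->
  exists C, forall x, `|T qs phi x| <= C.
Proof.
elim: qs => [|q qs IH] hqs phi hphi [a [ca pa ha]].
  have hnp : nonprincipal M phi by exists a.
  have [C hC] := char_mertens R M0 hphi hnp; exists C => x.
  rewrite /T (eq_bigr (fun d => (phi d)%:~R * vonMangoldt R d * d%:R^-1)) // => d _.
  by rewrite /P big_nil mulr1.
have hqs' q' : q' \in qs -> real_char M (chi q').
  by move=> hq'; apply: hqs; rewrite inE hq' orbT.
have hq : real_char M (chi q) by apply: hqs; rewrite inE eqxx.
have [C1 hC1] : exists C, forall x, `|T qs phi x| <= C.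
  apply: IH => //; exists a; split=> // q' hq'; by apply: ha; rewrite inE hq' orbT.
have [C2 hC2] : exists C, forall x, `|T qs (fun n => phi n * chi q n) x| <= C.
  apply: IH => //; first exact: real_charM.
  exists a; split=> //; first by rewrite pa ha ?mulr1 // inE eqxx.
  by move=> q' hq'; apply: ha; rewrite inE hq' orbT.
exists (C1 + `|(eps q)%:~R| * C2) => x; rewrite T_cons.
apply: le_trans (ler_normD _ _) _; apply: lerD => //.
by rewrite normrM ler_wpM2l.
Qed.

(** A triangular condition: every product over a nonempty sublist is nonprincipal, as the witness
    for its first member shows. *)
Fixpoint independent (qs : seq I) : Prop :=
  if qs is q :: qs' then
    (exists a, [/\ coprime a M, chi q a = -1 & forall q', q' \in qs' -> chi q' a = 1])
    /\ independent qs'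
  else True.

Let T_lower qs : (forall q, q \in qs -> real_char M (chi q)) -> independent qs ->
  exists C, forall x, \sum_(1 <= d < x.+1) vonMangoldt R d * d%:R^-1 <= T qs (fun=> 1) x + C.
Proof.
elim: qs => [|q qs IH] hqs.
  exists 0 => x; rewrite addr0 /T le_eqVlt; apply/orP; left; apply/eqP.
  by apply: eq_bigr => d _; rewrite /P big_nil mulr1 mul1r.
have hqs' q' : q' \in qs -> real_char M (chi q').
  by move=> hq'; apply: hqs; rewrite inE hq' orbT.
have hq : real_char M (chi q) by apply: hqs; rewrite inE eqxx.
move=> [ha /(IH hqs') [C hC]].
have [C2 hC2] := T_bounded hqs' hq ha.
exists (C + `|(eps q)%:~R| * C2) => x; rewrite T_cons.
have -> : T qs (fun n => 1 * chi q n) x = T qs (chi q) x.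
  by apply: eq_bigr => d _; rewrite mul1r.
apply: le_trans (hC x) _; rewrite -addrA lerD2l addrCA lerDl.
rewrite -lerBlDl sub0r; apply: le_trans (ler_norm _) _.
by rewrite normrN normrM ler_wpM2l.
Qed.

(** Up to a bounded error the sum weighted by [P] is at least the unweighted one, which diverges; so
    some prime power coprime to [M] has the pattern. The sign -1 makes its exponent odd, and then
    the prime itself has the pattern. *)
Lemma prime_pattern (qs : seq I) :
  (forall q, q \in qs -> real_char M (chi q)) -> independent qs ->
  (forall q, q \in qs -> eps q = 1 \/ eps q = -1) ->
  (exists2 q, q \in qs & eps q = -1) ->
  exists p, [/\ prime p, coprime p M & forall q, q \in qs -> chi q p = eps q].
Proof.
move=> hqs hind heps [q0 q0s eq0].
have P_ge0 n : 0 <= P qs n.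
  rewrite /P big_seq; apply: prodr_ge0 => q hq.
  by case: (hqs q hq) => _ _ _ hv _; case: (hv n) => ->; case: (heps q hq) => ->.
have P_le n : P qs n <= 2 ^+ (size qs).
  rewrite /P; elim: (qs) (hqs) (heps) => [|q s IH] h1 h2; first by rewrite big_nil expr0.
  have sub q' : q' \in s -> q' \in q :: s by rewrite inE orbC => ->.
  rewrite big_cons exprS; apply: ler_pM.
  - case: (h1 q (mem_head _ _)) => _ _ _ hv _.
    by case: (hv n) => ->; case: (h2 q (mem_head _ _)) => ->.
  - rewrite big_seq; apply: prodr_ge0 => q' /sub hq; case: (h1 q' hq) => _ _ _ hv _.
    by case: (hv n) => ->; case: (h2 q' hq) => ->.
  - case: (h1 q (mem_head _ _)) => _ _ _ hv _.
    by case: (hv n) => ->; case: (h2 q (mem_head _ _)) => ->.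
  by apply: IH => q' /sub hq; [apply: h1|apply: h2].
have [d [cd Pd Ld]] : exists d, [/\ coprime d M, P qs d != 0 & vonMangoldt R d != 0].
  apply: contrapT => hno.
  have [C hC] := T_lower hqs hind; have [C' hC'] := vonMangoldt_sum_noncoprime R M0.
  have hT x : T qs (fun=> 1) x <= 2 ^+ size qs * C'.
    apply: (@le_trans _ _ (2 ^+ size qs * \sum_(1 <= d < x.+1 | ~~ coprime d M) vonMangoldt R d * d%:R^-1)); last first.
      by rewrite ler_wpM2l ?exprn_ge0.
    rewrite mulr_sumr [leRHS]big_mkcond; apply: ler_sum_nat => d _.
    rewrite mul1r; case: ifPn => [_|/negPn cd].
      rewrite -mulrA ler_wpM2r ?mulr_ge0 ?invr_ge0 ?vonMangoldt_ge0 //.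
      by rewrite -[2 ^+ _ : R]/((2%:~R) ^+ _) -rmorphXn /= ler_int.
    have [->|hL] := eqVneq (vonMangoldt R d) 0; first by rewrite mulr0 mul0r.
    have [->|hP] := eqVneq (P qs d) 0; first by rewrite !mul0r.
    by case: hno; exists d.
  pose B : R := 2 * (2 ^+ size qs * C' + C); pose y := (Num.trunc (expR B)).+1.
  have : ln y%:R <= B.
    apply: le_trans (vonMangoldt_sum_ge R (ltn0Sn _)) _; rewrite ler_pM2l //.
    by apply: le_trans (hC _) _; rewrite lerD2r.
  apply/negP; rewrite -ltNge -[B]expRK ltr_ln ?posrE ?expR_gt0 ?ltr0n //.
  exact: truncnS_gt.
have [p [k [pp dE _]]] := vonMangoldt_neq0 Ld.
have cp : coprime p M by move: cd; rewrite dE coprime_pexpl.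
have val q : q \in qs -> chi q p ^+ k.+1 = eps q.
  move=> hq; have hr := hqs q hq; rewrite -(char_pow hr) -dE.
  have : 1 + eps q * chi q d != 0.
    by apply: contraNneq Pd => h; rewrite /P (big_rem q) //= h mul0r.
  case: hr => _ _ _ hv /(_ d cd); case: (hv d) => -> // _;
    by case: (heps q hq) => -> //; rewrite ?mulr1 ?mulrN1 ?addrN.
have K0 : (0 < k.+1)%N by []; move: (k.+1) K0 val => K K0 {dE k} val.
exists p; split=> // q hq; rewrite -(val q hq).
have ok : odd K.
  apply/negPn/negP => ek; have := val q0 q0s.
  case: (hqs q0 q0s) => _ _ _ hv _; rewrite -(odd_double_half K) (negPf ek) add0n -mul2n exprM eq0.
  by case: (hv p) => ->; rewrite ?expr0n ?sqrrN ?expr1n //; case: eqP.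
case: (hqs q hq) => _ _ _ hv _; case: (hv p) => ->.
- by rewrite expr0n gtn_eqF.
- by rewrite expr1n.
- by rewrite -signr_odd ok expr1.
Qed.
End PrimePattern.

Lemma independent_uniq (M : nat) (I : eqType) (chi : I -> nat -> int) (qs : seq I) : uniq qs ->
  (forall q, q \in qs -> exists a, [/\ coprime a M, chi q a = -1 &
     forall q', q' \in qs -> q' != q -> chi q' a = 1]) ->
  independent M chi qs.
Proof.
elim: qs => //= q qs IH /andP[qn uq] h; split.
  have [a [ca qa ha]] := h q (mem_head _ _); exists a; split=> // q' hq'.
  by apply: ha; rewrite ?inE ?hq' ?orbT //; apply: contraNneq qn => <-.
apply: IH => // q' hq'; have [|a [ca qa ha]] := h q'; first by rewrite inE hq' orbT.
by exists a; split=> // q'' hq''; apply: ha; rewrite inE hq'' orbT.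
Qed.

(** [chi4] and [chi8] are the characters of Q(i) and Q(sqrt 2); together they fix an odd number
    modulo 8. *)
Definition chi4 (n : nat) : int := if (n %% 4 == 1)%N then 1 else if (n %% 4 == 3)%N then -1 else 0.
Definition chi8 (n : nat) : int :=
  if (n %% 8)%N \in [:: 1; 7]%N then 1 else if (n %% 8)%N \in [:: 3; 5]%N then -1 else 0.

Lemma real_char_leg (M q : nat) : prime q -> odd q -> (q %| M)%N -> real_char M (leg q).
Proof.
move=> qq oq qM; split.
- exact: leg1.
- by move=> m n; rewrite legM.
- by move=> n; rewrite -leg_mod -modnDmr (eqP qM) addn0 leg_mod.
- exact: leg_cases.
move=> n cn; rewrite leg_eq0 -prime_coprime // coprime_sym.
exact: coprime_dvdr qM cn.
Qed.

Lemma real_char_chi4 (M : nat) : (8 %| M)%N -> real_char M chi4.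
Proof.
move=> hM; have h4 : (4 %| M)%N by apply: dvdn_trans hM.
split=> //.
- move=> m n; rewrite /chi4 -modnMm; have := ltn_pmod m (isT : 0 < 4)%N; have := ltn_pmod n (isT : 0 < 4)%N.
  by case: (m %% 4)%N => [|[|[|[|]]]] //; case: (n %% 4)%N => [|[|[|[|]]]].
- by move=> n; rewrite /chi4 -modnDmr (eqP h4) addn0.
- by move=> n; rewrite /chi4; case: ifP; [constructor 2|case: ifP; [constructor 3|constructor 1]].
move=> n cn; have : odd n by rewrite -coprimen2; apply: coprime_dvdr cn; apply: dvdn_trans hM.
move=> on; have : (n %% 4 %% 2 = 1)%N by rewrite modn_dvdm // modn2 on.
rewrite /chi4; have := ltn_pmod n (isT : 0 < 4)%N.
by case: (n %% 4)%N => [|[|[|[|]]]].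
Qed.

Lemma real_char_chi8 (M : nat) : (8 %| M)%N -> real_char M chi8.
Proof.
move=> hM; split=> //.
- move=> m n; rewrite /chi8 -modnMm; have := ltn_pmod m (isT : 0 < 8)%N; have := ltn_pmod n (isT : 0 < 8)%N.
  by case: (m %% 8)%N => [|[|[|[|[|[|[|[|]]]]]]]] //; case: (n %% 8)%N => [|[|[|[|[|[|[|[|]]]]]]]].
- by move=> n; rewrite /chi8 -modnDmr (eqP hM) addn0.
- by move=> n; rewrite /chi8; case: ifP; [constructor 2|case: ifP; [constructor 3|constructor 1]].
move=> n cn; have : odd n by rewrite -coprimen2; apply: coprime_dvdr cn; apply: dvdn_trans hM.
move=> on; have : (n %% 8 %% 2 = 1)%N by rewrite modn_dvdm // modn2 on.
rewrite /chi8; have := ltn_pmod n (isT : 0 < 8)%N.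
by case: (n %% 8)%N => [|[|[|[|[|[|[|[|]]]]]]]].
Qed.

Lemma coprime_prod_primes (p : nat) (s : seq nat) : prime p -> all prime s -> p \notin s ->
  coprime p (\prod_(q <- s) q).
Proof.
move=> pp; elim: s => [|q s IH] /=; first by rewrite big_nil coprimen1.
move=> /andP[qq qs]; rewrite inE negb_or => /andP[npq nps].
by rewrite big_cons coprimeMr IH // andbT prime_coprime // dvdn_prime2.
Qed.

Lemma dvdn_prod_mem (q : nat) (s : seq nat) : q \in s -> (q %| \prod_(j <- s) j)%N.
Proof. by move=> h; rewrite (big_rem q) //= dvdn_mulr. Qed.

Lemma mod_coprime1 (a m : nat) : (a = 1 %[mod m])%N -> coprime a m.
Proof. by move=> h; rewrite -coprime_modl h coprime_modl coprime1n. Qed.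

Theorem primes_with_residues (R : realType) (qs : seq nat) (eps : nat -> int) (e4 e8 : int) :
  uniq qs -> all prime qs -> all odd qs ->
  (forall q, q \in qs -> eps q = 1 \/ eps q = -1) -> e4 = 1 \/ e4 = -1 -> e8 = 1 \/ e8 = -1 ->
  exists t, [/\ prime t, chi4 t = e4, chi8 t = e8 & forall q, q \in qs -> leg q t = eps q].
Proof.
move=> uq pq oq heps he4 he8.
(* The extra prime [q0] only serves to make one prescribed sign equal to -1. *)
have [q0 hq0 pq0] := prime_above (\max_(q <- qs) q + 2).
have q0s : q0 \notin qs.
  apply/negP => h; have : (q0 <= \max_(q <- qs) q)%N by apply: (@leq_bigmax_seq _ _ predT id).
  lia.
have oq0 : odd q0 by case/even_prime: pq0 => // e; lia.
pose qs' := q0 :: qs; have pq' : all prime qs' by rewrite /= pq0.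
have oq' : all odd qs' by rewrite /= oq0.
have uq' : uniq qs' by rewrite /= q0s.
pose Q := (\prod_(q <- qs') q)%N.
have oQ : odd Q by apply: odd_prod_primes.
(* The labels 4 and 8 are not prime, so they can index [chi4] and [chi8] beside the primes, which
   index their Legendre symbols. *)
pose M := (8 * Q)%N; pose chi (q : nat) := if q == 4 then chi4 else if q == 8 then chi8 else leg q.
have Q0 : (0 < Q)%N by case: (Q) oQ.
have M0 : (0 < M)%N by rewrite muln_gt0.
have c8 : coprime 8 Q by rewrite (_ : 8 = 2 ^ 3)%N // coprimeXl ?coprime2n.
have chiE q : q \in qs' -> chi q = leg q.
  move=> hq; rewrite /chi; have := allP pq' q hq.
  by case: (q =P 4) => [->//|_]; case: (q =P 8) => [->|].
have n4 : 4 \notin qs' by apply/negP => /(allP pq').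
have n8 : 8 \notin qs' by apply/negP => /(allP pq').
have hchi q : q \in [:: 4, 8 & qs']%N -> real_char M (chi q).
  have h8 : (8 %| M)%N by rewrite dvdn_mulr.
  rewrite !inE => /orP[/eqP ->|/orP[/eqP ->|hq]]; [exact: real_char_chi4|exact: real_char_chi8|].
  have hq' : q \in qs' by rewrite inE.
  rewrite chiE //; apply: real_char_leg; [exact: (allP pq')|exact: (allP oq')|].
  by rewrite dvdn_mull // dvdn_prod_mem.
have two_adic (r : nat) : exists a, (a = r %[mod 8])%N /\ (a = 1 %[mod Q])%N.
  exists (chinese 8 Q r 1); split; [exact: chinese_modl|exact: chinese_modr].
have leg_one a q : (a = 1 %[mod Q])%N -> q \in qs' -> chi q a = 1.
  move=> ha hq; rewrite chiE // -leg_mod -(modn_dvdm _ (dvdn_prod_mem hq)) ha.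
  by rewrite (modn_dvdm _ (dvdn_prod_mem hq)) leg_mod leg1 // (allP pq').
pose eps' q := if q == 4 then e4 else if q == 8 then e8 else if q == q0 then -1 else eps q.
have [| | | |t [pt ct ht]] := @prime_pattern R M nat chi eps' M0 [:: 4, 8 & qs']%N.
- exact: hchi.
- apply: independent_uniq.
    by rewrite 2!cons_uniq uq' andbT inE negb_or n4 n8.
  move=> q; rewrite 2!inE => /orP[/eqP ->|/orP[/eqP ->|hq]].
  (* Modulo 8, the residue 7 is negative for [chi4] only, and 5 below for [chi8] only. *)
  + have [a [a8 aQ]] := two_adic 7%N; exists a; split.
    * by rewrite coprimeMr (mod_coprime1 aQ) andbT -coprime_modl a8.
    * by rewrite /chi /= /chi4 -(@modn_dvdm 8) // a8.
    move=> q'; rewrite 2!inE => /orP[/eqP -> //|/orP[/eqP -> _|hq' _]]; last exact: leg_one.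
    by rewrite /chi /= /chi8 a8.
  + have [a [a8 aQ]] := two_adic 5%N; exists a; split.
    * by rewrite coprimeMr (mod_coprime1 aQ) andbT -coprime_modl a8.
    * by rewrite /chi /= /chi8 a8.
    move=> q'; rewrite 2!inE => /orP[/eqP -> _|/orP[/eqP -> //|hq' _]]; last exact: leg_one.
    by rewrite /chi /= /chi4 -(@modn_dvdm 8) // a8.
  have [qq qo] := (allP pq' q hq, allP oq' q hq).
  have [b hb] := leg_sum0 qq qo.
  pose N := (8 * \prod_(j <- rem q qs') j)%N.
  have MN : M = (q * N)%N by rewrite /M /Q (big_rem q hq) /= /N; ring.
  have cqN : coprime q N.
    rewrite coprimeMr (_ : 8 = 2 ^ 3)%N // coprimeXr ?coprimen2 //; apply: coprime_prod_primes => //.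
      by apply/allP => j /mem_rem; apply: (allP pq').
    by rewrite mem_rem_uniqF.
  exists (chinese q N b 1); set a := chinese _ _ _ _.
  have aq : (a = b %[mod q])%N by apply: chinese_modl.
  have aN : (a = 1 %[mod N])%N by apply: chinese_modr.
  have lqa : leg q a = -1 by rewrite -leg_mod aq leg_mod.
  split.
  + rewrite MN coprimeMr (mod_coprime1 aN) andbT coprime_sym prime_coprime //.
    by rewrite -leg_eq0 lqa.
  + by rewrite chiE.
  have a8 : (a = 1 %[mod 8])%N.
    by rewrite -(@modn_dvdm N) ?dvdn_mulr // aN modn_dvdm ?dvdn_mulr.
  move=> q'; rewrite 2!inE => /orP[/eqP -> _|/orP[/eqP -> _|hq' nq]].
  + by rewrite /chi /= /chi4 -(@modn_dvdm 8) // a8.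
  + by rewrite /chi /= /chi8 a8.
  have hN : (q' %| N)%N.
    by rewrite dvdn_mull // dvdn_prod_mem // mem_rem_uniq // inE nq.
  rewrite chiE // -leg_mod -(modn_dvdm _ hN) aN (modn_dvdm _ hN) leg_mod leg1 //.
  exact: (allP pq').
- move=> q; rewrite !inE /eps' => /orP[/eqP -> //|/orP[/eqP -> //|]].
  case: ifP => // _; case: ifP => // _; case: ifP => [_ _|_ /= hq]; [by right|exact: heps].
- by exists q0; rewrite ?inE ?eqxx ?orbT // /eps' eqxx; case: eqP (pq0) => [->|_] //; case: eqP => [->|].
exists t; split=> //.
- by have := ht 4 (mem_head _ _).
- by have := ht 8; rewrite !inE /= => /(_ isT).
move=> q hq; have hq' : q \in qs' by rewrite inE hq orbT.
rewrite -(chiE _ hq') ht ?inE ?hq ?orbT // /eps'.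
have -> : (q == 4) = false by apply: contraNF n4 => /eqP <-.
have -> : (q == 8) = false by apply: contraNF n8 => /eqP <-.
by have -> : (q == q0) = false by apply: contraNF q0s => /eqP <-.
Qed.

(** * Integrality certificates over the rationals *)

Lemma squarefree_part (n : nat) : (0 < n)%N ->
  exists s g, [/\ uniq s, all prime s & n = (\prod_(q <- s) q * g ^ 2)%N].
Proof.
elim/ltn_ind: n => n IH n0; have [n1|n1] := leqP n 1.
  by exists [::], 1%N; rewrite big_nil; split=> //; lia.
have pp := pdiv_prime n1; set p := pdiv n in pp; have /dvdnP[m nE] := pdiv_dvd n.
rewrite -/p in nE; have m0 : (0 < m)%N by move: n0; rewrite nE muln_gt0 => /andP[].
have [|s [g [us ps mE]]] := IH m _ m0; first by rewrite nE ltn_Pmulr // prime_gt1.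
have [hp|hp] := boolP (p \in s).
  exists (rem p s), (p * g)%N; split; first exact: rem_uniq.
    by apply/allP => q /mem_rem; apply: (allP ps).
  by rewrite nE mE (big_rem p hp) /=; ring.
exists (p :: s), g; split=> /=; rewrite ?hp ?pp // big_cons nE {1}mE; ring.
Qed.

Lemma sqrt_mod_prod (n : nat) (s : seq nat) : uniq s -> all prime s ->
  (forall q, q \in s -> exists x, (x ^ 2 = n %[mod q])%N) ->
  exists x, (x ^ 2 = n %[mod \prod_(q <- s) q])%N.
Proof.
elim: s => [|q s IH] /=; first by exists 0%N; rewrite big_nil !modn1.
move=> /andP[qs us] /andP[pq ps] h.
have [x hx] := h q (mem_head _ _).
have [|y hy] := IH us ps; first by move=> r hr; apply: h; rewrite inE hr orbT.
rewrite big_cons; set Q := (\prod_(j <- s) j)%N in hy *.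
have cq : coprime q Q by apply: coprime_prod_primes.
exists (chinese q Q x y); apply/eqP; rewrite chinese_remainder //.
by apply/andP; split; apply/eqP; rewrite -?hx -?hy -modnXm ?chinese_modl ?chinese_modr // modnXm.
Qed.

Lemma solve_linear_mod (A x t : nat) : coprime A t -> exists l, (A * l = x %[mod t])%N.
Proof.
move=> c; exists (chinese A t 0 x %/ A)%N; rewrite mulnC divnK ?chinese_modr //.
by rewrite /dvdn chinese_modl // mod0n.
Qed.

Lemma solve_quadratic_mod (A n t x : nat) : coprime A t -> (x ^ 2 = A * n %[mod t])%N ->
  exists l, (A * l ^ 2 = n %[mod t])%N.
Proof.
move=> c hx; have [l hl] := solve_linear_mod x c; exists l; apply/eqP.
have [u hu] := solve_linear_mod 1 c.
have e (v : nat) : (u * (A * v) = v %[mod t])%N.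
  by rewrite mulnA [(u * A)%N]mulnC -modnMml hu modnMml mul1n.
apply/eqP; rewrite -[RHS]e -[LHS]e -modnMmr -[RHS]modnMmr; congr (_ * _ %% _)%N.
have -> : (A * (A * l ^ 2) = (A * l) ^ 2)%N by rewrite expnMn mulnA mulnn.
by rewrite -hx -modnXm hl modnXm.
Qed.

Lemma square_neq_2odd (z o : nat) : odd o -> (z ^ 2 <> 2 * o)%N.
Proof.
move=> oo; have [oz|ez] := boolP (odd z); move=> h.
  by have := congr1 odd h; rewrite oddX oz oddM.
have : (z = z./2.*2)%N by rewrite even_halfK.
by move: oo h; clear; lia.
Qed.

(** * Solvability of the norm form equation *)

Section Completeness.
Variables (R : realType) (c : nat) (ps : seq nat).
Let kap := (4 * c).-1.
Let N := (2 * \prod_(p <- ps) p)%N.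
Hypotheses (ups : uniq ps) (pps : all prime ps) (ops : all odd ps) (pk : prime kap).
Hypothesis irr : forall p x, p \in 2%N :: ps -> ~~ (p %| x ^ 2 + x + c)%N.

Let c_odd : odd c.
Proof. by have := irr 0 (mem_head 2%N ps); rewrite dvdn2 add0n negbK. Qed.

Let kap_odd : odd kap.
Proof. by rewrite /kap; move: c_odd; clear; lia. Qed.

(** Modulo [kap] the polynomial x^2 + x + c has the double root (kap - 1) / 2, because 4 (x^2 + x +
    c) = (2x + 1)^2 + kap. *)
Let kap_notin : kap \notin ps.
Proof.
apply/negP => hk; have := irr kap./2 (_ : kap \in 2%N :: ps); rewrite inE hk orbT => /(_ isT) /negP; apply.
rewrite -(@Gauss_dvdr _ 4); last by rewrite (_ : 4 = 2 ^ 2)%N // coprimeXr // coprimen2.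
have -> : (4 * (kap./2 ^ 2 + kap./2 + c) = kap * kap.+1)%N.
  have h4 : (4 * c = kap.+1)%N by rewrite /kap prednK // muln_gt0 /=; case: (c) c_odd.
  have h2 : (kap = kap./2.*2.+1)%N by rewrite -[LHS]odd_double_half kap_odd.
  by rewrite !mulnDr h4; move: h2; set h := kap./2; move=> ->; rewrite -muln2; ring.
exact: dvdn_mulr.
Qed.

Let cs := kap :: ps.
Let ucs : uniq cs. Proof. by rewrite /= kap_notin. Qed.
Let pcs : all prime cs. Proof. by rewrite /= pk. Qed.
Let ocs : all odd cs. Proof. by rewrite /= kap_odd. Qed.

Lemma norm_form_solution (k : int) : exists w U V : rat,
  4 + N%:R * ((4 * kap%:R * k%:~R) ^+ 2 + kap%:R * w ^+ 2) = U ^+ 2 + kap%:R * V ^+ 2.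
Proof.
pose C := (2 * \prod_(p <- cs) p)%N.
have CE : C = (N * kap)%N by rewrite /C big_cons /N; ring.
have oC := odd_prod_primes ocs.
have C0 : (0 < C)%N by rewrite muln_gt0 /=; case: (\prod_(p <- cs) p)%N oC.
(* Four times [B0] is the left side without the term in [w], whose coefficient is [C]. The factor
   [4 * kap] prescribed with [k] makes [B0] equal to 1 modulo 8 and modulo every prime of [cs], and
   this passes to the squarefree part [A] up to squares. *)
pose B0 := (1 + 4 * C * (kap * `|k| ^ 2))%N.
have [s [g [us ps' BE]]] := squarefree_part (ltn0Sn _ : (0 < B0)%N).
set A := (\prod_(q <- s) q)%N in BE.
have BC (p : nat) : (p %| 4 * C)%N -> (B0 = 1 %[mod p])%N.
  by move=> h; rewrite -modnDmr (eqP (dvdn_mulr _ h)) addn0.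
have cBC : coprime B0 C by apply: mod_coprime1; apply: BC; exact: dvdn_mull.
have cAC : coprime A C by apply: coprime_dvdl cBC; rewrite BE dvdn_mulr.
have cgC : coprime g C by apply: coprime_dvdl cBC; rewrite BE dvdn_mull // dvdn_exp.
have oA : odd A by rewrite -coprimen2; apply: coprime_dvdr cAC; exact: dvdn_mulr.
have og : odd g by rewrite -coprimen2; apply: coprime_dvdr cgC; exact: dvdn_mulr.
have os : all odd s by apply/allP => q hq; apply: dvdn_odd oA; exact: dvdn_prod_mem.
have A0 : (0 < A)%N by case: (A) oA.
have A8 : (A = 1 %[mod 8])%N.
  have g8 : (g ^ 2 = 1 %[mod 8])%N.
    rewrite -modnXm; have := ltn_pmod g (isT : 0 < 8)%N.
    have : (g %% 8 %% 2 = 1)%N by rewrite modn_dvdm // modn2 og.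
    by case: (g %% 8)%N => [|[|[|[|[|[|[|[|]]]]]]]].
  have <- : (A * g ^ 2 = A %[mod 8])%N by rewrite -modnMmr g8 modnMmr muln1.
  rewrite -BE; apply: BC.
  by rewrite /C mulnA dvdn_mulr.
have pC p : p \in cs -> (p %| C)%N by move=> hp; rewrite dvdn_mull // dvdn_prod_mem.
have legA p : p \in cs -> leg p A = 1.
  move=> hp; have [pp op] := (allP pcs p hp, allP ocs p hp).
  have npg : ~~ (p %| g)%N.
    by rewrite -prime_coprime // coprime_sym; apply: coprime_dvdr cgC; exact: pC.
  rewrite -[LHS]mulr1 -(leg_sqr pp op npg) -legM // mulnn -BE.
  by rewrite -leg_mod (BC p (dvdn_mull 4 (pC _ hp))) leg_mod leg1 // -mulnn leg_sqr.
have s_cs q : q \in s -> q \notin cs.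
  move=> hq; apply/negP => hc; have qq := allP pcs q hc.
  have : coprime q q.
    by apply: coprime_dvdl (dvdn_prod_mem hq) _; apply: coprime_dvdr (pC q hc) _.
  by rewrite prime_coprime // dvdnn.
have legC q : q \in s -> leg q C = 1 \/ leg q C = -1.
  move=> hq; have qq := allP ps' q hq.
  have : leg q C != 0.
    rewrite leg_eq0 -prime_coprime //.
    by apply: coprime_dvdl (dvdn_prod_mem hq) _.
  by case: (leg_cases q C) => ->; [|left|right].
(* Chosen so that [A * t] is a square modulo [C] and [C * t] modulo [A]; with [t] equal to 1 modulo
   8, reciprocity will take care of the condition modulo [t]. *)
pose eps q := if q \in cs then 1 else leg q C.
have [||||t [pt t4 t8 ht]] := @primes_with_residues R (cs ++ s) eps 1 1 _ _ _ _ (or_introl erefl) (or_introl erefl).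
- rewrite cat_uniq ucs us andbT; apply/hasPn => q; exact: s_cs.
- by rewrite all_cat pcs.
- by rewrite all_cat ocs.
- move=> q; rewrite mem_cat /eps; case: ifP => [_ _|_ /= hq]; [by left|exact: legC].
have tm : (t %% 8 = 1)%N.
  move: t4 t8; rewrite /chi4 /chi8 -(@modn_dvdm 8 t 4) //; have := ltn_pmod t (isT : 0 < 8)%N.
  by case: (t %% 8)%N => [|[|[|[|[|[|[|[|]]]]]]]].
have ot : odd t by move: tm; clear; lia.
have t0 := prime_gt0 pt.
have t2e : ~~ odd t./2 by move: tm; clear; lia.
have lc p : p \in cs -> leg p t = 1 by move=> hp; rewrite ht ?mem_cat ?hp // /eps hp.
have ls q : q \in s -> leg q t = leg q C.
  by move=> hq; rewrite ht ?mem_cat ?hq ?orbT // /eps (negPf (s_cs q hq)).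
have rec q : prime q -> odd q -> leg q t != 0 -> leg t q = leg q t.
  move=> qq oq; rewrite leg_eq0 dvdn_prime2 // eq_sym => tq.
  by rewrite quadratic_reciprocity // -signr_odd oddM (negPf t2e) expr0 mul1r.
have lt2 : leg t 2 = 1 by rewrite leg_2 // tm.
have ltC : leg t C = 1.
  rewrite /C legM // lt2 mul1r leg_prod // big_seq big1 // => p hp.
  by rewrite rec ?lc // ?(allP pcs) ?(allP ocs).
(* By reciprocity this is the product of [leg q C] over the primes [q] of [A]. The factor 2 of [C]
   contributes 1 as [A] is 1 modulo 8, and an odd prime [p] of [C] contributes [leg p A = 1]. *)
have ltA : leg t A = 1.
  rewrite /A leg_prod // (eq_big_seq (fun q => leg q C)); last first.
    move=> q hq; rewrite rec ?ls // ?(allP ps') ?(allP os) //.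
    by case: (legC q hq) => ->.
  rewrite (eq_big_seq (fun q => leg q 2 * \prod_(p <- cs) leg q p)); last first.
    by move=> q hq; rewrite /C legM ?leg_prod // ?(allP ps') ?(allP os).
  rewrite big_split /= jacobi_2 // -/A A8 /= mul1r exchange_big /= big_seq big1 // => p hp.
  rewrite jacobi_reciprocity // ?(allP pcs) ?(allP ocs) // -/A ?legA //.
    by apply/negP => /s_cs; rewrite hp.
  by rewrite -(@modn_dvdm 8) // A8.
have tneg : leg t t.-1 = 1 by rewrite legN1 // -signr_odd (negPf t2e).
have tA : coprime A t by rewrite coprime_sym prime_coprime // -leg_eq0 ltA.
have tC : coprime C t by rewrite coprime_sym prime_coprime // -leg_eq0 ltC.
have sqrt_neg n : leg t n = 1 -> exists l, (t %| l ^ 2 + n)%N.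
  move=> hn; have : leg t (t.-1 * n) = 1 by rewrite legM // tneg hn.
  case/leg_eq1_sqrt => x hx; exists x; rewrite /dvdn -modnDml hx modnDml.
  by rewrite -mulSnr prednK // modnMr.
have [l hl] : exists l, (t %| A * l ^ 2 + C)%N.
  have [|x hx] := sqrt_neg (A * C)%N; first by rewrite legM // ltA ltC.
  have [l hl] := solve_linear_mod x tA; exists l.
  rewrite -(@Gauss_dvdr _ A) 1?coprime_sym // mulnDr.
  have -> : (A * (A * l ^ 2) = (A * l) ^ 2)%N by rewrite expnMn mulnA mulnn.
  by rewrite /dvdn -modnDml -modnXm hl modnXm modnDml.
have [m hm] : exists m, (C * m ^ 2 = t %[mod A])%N.
  have [|x hx] := @sqrt_mod_prod (C * t) s us ps'.
    move=> q hq; apply: leg_eq1_sqrt; rewrite legM ?ls // ?(allP ps') ?(allP os) //.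
    by case: (legC q hq) => ->.
  by apply: solve_quadratic_mod hx; rewrite coprime_sym.
have [n hn] : exists n, (A * n ^ 2 = t %[mod C])%N.
  have [||| x hx] := @sqrt_mod_prod (A * t) (2%N :: cs).
  - rewrite cons_uniq ucs andbT; apply/negP => /(allP ocs) //.
  - by rewrite /= pk.
  - move=> q; rewrite inE => /orP[/eqP ->|hq].
      by exists (A * t)%N; rewrite !modn2 oddX.
    by apply: leg_eq1_sqrt; rewrite legM ?legA ?lc // ?(allP pcs) ?(allP ocs).
  by move: hx; rewrite big_cons => hx; apply: solve_quadratic_mod cAC hx.
have [|| x [y [z [z0 hxyz]]]] := legendre_conic A0 C0 t0 cAC tA tC hl hm hn.
- by move=> z; rewrite /C mulnCA; apply: square_neq_2odd; rewrite oddM oA.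
- by move=> z; rewrite /C -mulnA; apply: square_neq_2odd; rewrite oddM oC.
have lkt : leg kap t = 1 by apply: lc; rewrite mem_head.
have ltk : leg t kap = 1 by rewrite rec // lkt.
have tk : coprime kap t by rewrite coprime_sym prime_coprime // -leg_eq0 ltk.
have [l' hl'] := sqrt_neg kap ltk.
have [n' hn'] := leg_eq1_sqrt lkt.
have [||||| y1 [z1 [e1 [e10 he1]]]] := @legendre_conic 1 kap t l' 0 n' isT (prime_gt0 pk) t0 (coprime1n _) (coprime1n _) tk.
- by rewrite mul1n.
- by rewrite !modn1.
- by rewrite mul1n.
- move=> v /(congr1 (logn kap)). rewrite mul1n lognX (logn_prime kap pk) eqxx; clear; lia.
- move=> v /(congr1 (logn kap)); rewrite lognX lognM ?prime_gt0 // (logn_prime kap pk) (logn_prime kap pt) eqxx.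
  by rewrite [kap == t](_ : _ = false) /=; [clear; lia|apply/negbTE; rewrite -dvdn_prime2 // -prime_coprime // tk].
(* Otherwise [C * y ^ 2 = t * z ^ 2], whose sides have 2-adic valuations of different parity. *)
have x0 : x != 0.
  apply/eqP => x0; move: hxyz; rewrite x0 expr0n mulr0 add0r.
  move/(congr1 absz); rewrite !abszM /= !mulnn => h.
  have z0' : (0 < `|z|)%N by rewrite absz_gt0.
  have y0' : (0 < `|y|)%N.
    rewrite lt0n; apply/eqP => y0; move/eqP: h; rewrite y0 muln0 eq_sym muln_eq0 expn_eq0 /= andbT.
    by rewrite !gtn_eqF.
  move/(congr1 (logn 2)): h; rewrite !lognM ?expn_gt0 ?z0' ?y0' //; last by case: (\prod_(p <- cs) p)%N oC.
  rewrite ?lognX (@logn_coprime 2 (\prod_(p <- cs) p)) ?coprime2n // (@logn_coprime 2 t) ?coprime2n //.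
  by rewrite (logn_prime 2 (isT : prime 2)) eqxx; clear; lia.
have B0E : B0 = (1 + 4 * C * (kap * `|k| ^ 2))%N by [].
clear -hxyz he1 BE CE B0E x0 e10; clearbody C A B0 N kap.
have castE (a b : int) : a = b -> a%:~R = b%:~R :> rat by move=> ->.
have := castE _ _ hxyz; rewrite !(rmorphD, rmorphM, rmorphXn) /= -!pmulrn => E1.
have := castE _ _ he1; rewrite !(rmorphD, rmorphM, rmorphXn) /= -!pmulrn => E2.
have E3 : 1 + 4 * (N%:R * kap%:R) * (kap%:R * k%:~R ^+ 2) = A%:R * g%:R ^+ 2 :> rat.
  have -> : A%:R * g%:R ^+ 2 = B0%:R :> rat by rewrite BE natrM natrX.
  have kE : `|k|%N%:R = `|k%:~R| :> rat by rewrite -intr_norm -abszE.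
  rewrite B0E CE !(natrD, natrM) kE -normrM -expr2 ger0_norm ?sqr_ge0 //; ring.
rewrite CE natrM in E1.
have xq : x%:~R != 0 :> rat by rewrite intr_eq0.
have eq0 : e1%:~R != 0 :> rat by rewrite intr_eq0.
(* With this [w] the first conic turns the left side into 4 g^2 t z^2 / x^2, and the second one
   writes t as (y1^2 + kap z1^2) / e1^2. *)
exists (2 * g%:R * y%:~R / x%:~R), (2 * g%:R * z%:~R * y1%:~R / (x%:~R * e1%:~R)),
  (2 * g%:R * z%:~R * z1%:~R / (x%:~R * e1%:~R)).
transitivity (4 * g%:R ^+ 2 * z%:~R ^+ 2 / x%:~R ^+ 2 * ((1 * y1%:~R ^+ 2 + kap%:R * z1%:~R ^+ 2) / e1%:~R ^+ 2) : rat);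
  last by field; rewrite xq eq0.
rewrite E2 mulfK ?expf_neq0 //.
transitivity (4 * g%:R ^+ 2 / x%:~R ^+ 2 * (t%:R * z%:~R ^+ 2) : rat); last by field.
rewrite -E1.
transitivity (4 * (A%:R * g%:R ^+ 2) + 4 * g%:R ^+ 2 * N%:R * kap%:R * y%:~R ^+ 2 / x%:~R ^+ 2 : rat); last by field.
by rewrite -E3; field.
Qed.
End Completeness.

(** * Integrality forced by the norm form equation *)

Lemma pint_norm_form (c p : nat) (y z : int) : prime p ->
  (forall x, ~~ (p %| x ^ 2 + x + c)%N) ->
  (p%:Z %| y ^+ 2 + y * z + c%:Z * z ^+ 2)%Z -> (p%:Z %| y)%Z /\ (p%:Z %| z)%Z.
Proof.
move=> pp irr h.
have pz : (p%:Z %| z)%Z.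
  apply/negPn/negP => nz; have p0 := prime_gt0 pp.
  have cz : coprime `|z| p by rewrite coprime_sym prime_coprime.
  have [u hu] := solve_linear_mod 1 cz.
  have [v hv] : exists v : int, (p%:Z %| z * v - 1)%Z.
    exists (sgz z * u%:Z).
    have -> : z * (sgz z * u%:Z) - 1 = (`|z|%N * u)%N%:Z - 1%N%:Z.
      by rewrite PoszM mulrA [z * sgz z]mulrC -abszEsg.
    by rewrite -eqz_mod_dvd !modz_nat hu.
  pose x := `|(y * v %% p)%Z|%N.
  have xE : (p%:Z %| x%:Z - y * v)%Z.
    have p00 : p%:Z != 0 by rewrite eqz_nat gtn_eqF.
    by rewrite -eqz_mod_dvd /x gez0_abs ?modz_ge0 // modz_mod.
  have := irr x; rewrite -[(p %| _)%N]/(p%:Z %| (x ^ 2 + x + c)%N%:Z)%Z => /negP; apply.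
  rewrite !PoszD (PoszX x 2).
  have -> : x%:Z ^+ 2 + x%:Z + c%:Z = (x%:Z - y * v) * (x%:Z + y * v + 1)
     + v ^+ 2 * (y ^+ 2 + y * z + c%:Z * z ^+ 2)
     - (z * v - 1) * (y * v + c%:Z * (z * v + 1)) by ring.
  by apply: rpredB; [apply: rpredD; [exact: dvdz_mulr|exact: dvdz_mull]|exact: dvdz_mulr].
split=> //; have : (p%:Z %| y ^+ 2)%Z.
  have -> : y ^+ 2 = (y ^+ 2 + y * z + c%:Z * z ^+ 2) - z * (y + c%:Z * z) by ring.
  by apply: rpredB => //; exact: dvdz_mulr.
by rewrite expr2 !dvdzE abszM Euclid_dvdM // orbb.
Qed.

Definition Zloc (N : nat) (q : rat) : Prop :=
  exists (a : int) (b : nat), [/\ (0 < b)%N, coprime b N & q = a%:~R / b%:R].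

(** Anisotropy is used twice. The right side is divisible by [p], hence so are [y] and [z], and it
    is divisible by [p ^ 2]; since [p] divides [N] only once, the form in [x] and [w] is divisible
    by [p] too. *)
Lemma norm_form_descent (c p N : nat) (D x w y z : int) : prime p -> (p %| N)%N -> ~~ (p ^ 2 %| N)%N ->
  (forall x, ~~ (p %| x ^ 2 + x + c)%N) ->
  D ^+ 2 + N%:Z * (x ^+ 2 + x * w + c%:Z * w ^+ 2) = y ^+ 2 + y * z + c%:Z * z ^+ 2 ->
  (p%:Z %| D)%Z -> [/\ (p%:Z %| x)%Z, (p%:Z %| w)%Z, (p%:Z %| y)%Z & (p%:Z %| z)%Z].
Proof.
move=> pp /dvdnP[N' NE] np2 irr e pD; have p0 := prime_gt0 pp.
have p00 : p%:Z != 0 by rewrite eqz_nat gtn_eqF.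
have [py pz] : (p%:Z %| y)%Z /\ (p%:Z %| z)%Z.
  apply: (pint_norm_form pp irr); rewrite -e; apply: rpredD; first exact: dvdz_mulr.
  by rewrite NE PoszM -mulrA dvdz_mull // dvdz_mulr.
have /dvdzP [D' DE] := pD; have /dvdzP[y' yE] := py; have /dvdzP[z' zE] := pz.
have [px pw] : (p%:Z %| x)%Z /\ (p%:Z %| w)%Z.
  apply: (pint_norm_form pp irr); set u := (_ + _ + _).
  have npN : coprimez p%:Z N'%:Z.
    rewrite coprimezE /= prime_coprime //; apply: contra np2 => /dvdnP[k kE].
    by rewrite NE kE -mulnA mulnn dvdn_mull.
  rewrite -(@Gauss_dvdzr _ N'%:Z) // -(@dvdz_mul2r p%:Z) //.
  have -> : N'%:Z * u * p%:Z = N%:Z * u by rewrite NE PoszM; ring.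
  have -> : N%:Z * u = p%:Z * p%:Z * (y' ^+ 2 + y' * z' + c%:Z * z' ^+ 2 - D' ^+ 2).
    by apply: (addrI (D ^+ 2)); rewrite e yE zE DE; ring.
  exact: dvdz_mulr.
by split.
Qed.

(** Over a common denominator [D] of all four numbers, the descent cancels [p] from [D] and every
    numerator until [p] no longer divides [D]. *)
Lemma norm_form_integral (c p N : nat) (X w Y Z : rat) : prime p -> (p %| N)%N -> ~~ (p ^ 2 %| N)%N ->
  (forall x, ~~ (p %| x ^ 2 + x + c)%N) ->
  1 + N%:R * (X ^+ 2 + X * w + c%:R * w ^+ 2) = Y ^+ 2 + Y * Z + c%:R * Z ^+ 2 ->
  Zloc p X /\ Zloc p w.
Proof.
move=> pp pN np2 irr e; have p0 := prime_gt0 pp.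
have : exists (D : nat) (x v y z : int), [/\ (0 < D)%N, X = x%:~R / D%:R, w = v%:~R / D%:R &
    Y = y%:~R / D%:R /\ Z = z%:~R / D%:R].
  have frac (q : rat) : exists (a : int) (b : nat), (0 < b)%N /\ q = a%:~R / b%:R.
    exists (numq q), `|denq q|%N; rewrite absz_gt0 denq_neq0; split=> //.
    by rewrite -[`|denq q|%N%:R]/(`|denq q|%N%:Z%:~R) absz_denq divq_num_den.
  have [a1 [b1 [h1 ->]]] := frac X; have [a2 [b2 [h2 ->]]] := frac w.
  have [a3 [b3 [h3 ->]]] := frac Y; have [a4 [b4 [h4 ->]]] := frac Z.
  have nz (b : nat) : (0 < b)%N -> b%:R != 0 :> rat by move=> b0; rewrite pnatr_eq0 gtn_eqF.
  have [n1 n2 n3 n4] := And4 (nz _ h1) (nz _ h2) (nz _ h3) (nz _ h4).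
  exists (b1 * b2 * b3 * b4)%N, (a1 * (b2 * b3 * b4)%N%:Z), (a2 * (b1 * b3 * b4)%N%:Z),
     (a3 * (b1 * b2 * b4)%N%:Z), (a4 * (b1 * b2 * b3)%N%:Z).
  rewrite !muln_gt0 h1 h2 h3 h4; split=> //; [| |split];
    by rewrite rmorphM /= -pmulrn !natrM; field; rewrite ?n1 ?n2 ?n3 ?n4.
case=> D [x [v [y [z [D0 xE vE [yE zE]]]]]].
elim/ltn_ind: D x v y z D0 xE vE yE zE => D IH x v y z D0 xE vE yE zE.
have DR : D%:R != 0 :> rat by rewrite pnatr_eq0 gtn_eqF.
have [pD|npD] := boolP (p %| D)%N; last first.
  have cD : coprime D p by rewrite coprime_sym prime_coprime.
  by split; [exists x, D|exists v, D].
have eZ : D%:Z ^+ 2 + N%:Z * (x ^+ 2 + x * v + c%:Z * v ^+ 2) = y ^+ 2 + y * z + c%:Z * z ^+ 2.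
  apply: (@intr_inj rat); rewrite !(rmorphD, rmorphM, rmorphXn) /= -!pmulrn.
  move: e; rewrite xE vE yE zE => e.
  transitivity (D%:R ^+ 2 * (1 + N%:R * ((x%:~R / D%:R) ^+ 2 + x%:~R / D%:R * (v%:~R / D%:R) + c%:R * (v%:~R / D%:R) ^+ 2)) : rat); first by field.
  by rewrite e; field.
have [/dvdzP[x' x'E] /dvdzP[v' v'E] /dvdzP[y' y'E] /dvdzP[z' z'E]] := norm_form_descent pp pN np2 irr eZ pD.
have /dvdnP[D' D'E] := pD.
have D'0 : (0 < D')%N by move: D0; rewrite D'E muln_gt0 => /andP[].
have pR : p%:R != 0 :> rat by rewrite pnatr_eq0 gtn_eqF.
have D'R : D'%:R != 0 :> rat by rewrite pnatr_eq0 gtn_eqF.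
apply: (IH D' _ x' v' y' z') => //; first by rewrite D'E ltn_Pmulr // prime_gt1.
- by rewrite xE x'E D'E natrM rmorphM /= -pmulrn; field; rewrite pR D'R.
- by rewrite vE v'E D'E natrM rmorphM /= -pmulrn; field; rewrite pR D'R.
- by rewrite yE y'E D'E natrM rmorphM /= -pmulrn; field; rewrite pR D'R.
- by rewrite zE z'E D'E natrM rmorphM /= -pmulrn; field; rewrite pR D'R.
Qed.

Lemma Zloc_denq (N : nat) (q : rat) : Zloc N q <-> coprime `|denq q| N.
Proof.
split=> [[a [b [b0 cb qE]]]|h]; last first.
  exists (numq q), `|denq q|%N; rewrite absz_gt0 denq_neq0; split=> //.
  by rewrite -[`|denq q|%N%:R]/(`|denq q|%N%:Z%:~R) absz_denq divq_num_den.
apply: coprime_dvdl cb.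
have bR : b%:R != 0 :> rat by rewrite pnatr_eq0 gtn_eqF.
have dR : (denq q)%:~R != 0 :> rat by rewrite intr_eq0 denq_neq0.
have e : numq q * b%:Z = a * denq q.
  apply: (@intr_inj rat); rewrite !rmorphM /= -pmulrn.
  by apply: (mulIf (invr_neq0 dR)); rewrite mulfK // mulrAC divq_num_den qE mulfVK.
have : (`|denq q| %| `|numq q| * b)%N by rewrite -[(_ * b)%N]/(`|numq q| * `|b%:Z|)%N -abszM e abszM dvdn_mull.
by rewrite Gauss_dvdr // coprime_sym coprime_num_den.
Qed.

Lemma ZlocD (N : nat) (q r : rat) : Zloc N q -> Zloc N r -> Zloc N (q + r).
Proof.
move=> [a [b [b0 cb ->]]] [a' [b' [b'0 cb' ->]]].
exists (a * b'%:Z + a' * b%:Z), (b * b')%N; rewrite muln_gt0 b0 coprimeMl cb; split=> //.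
have bR : b%:R != 0 :> rat by rewrite pnatr_eq0 gtn_eqF.
have bR' : b'%:R != 0 :> rat by rewrite pnatr_eq0 gtn_eqF.
by rewrite natrM rmorphD !rmorphM /= -!pmulrn; field; rewrite bR bR'.
Qed.

Lemma ZlocM (N : nat) (q r : rat) : Zloc N q -> Zloc N r -> Zloc N (q * r).
Proof.
move=> [a [b [b0 cb ->]]] [a' [b' [b'0 cb' ->]]].
exists (a * a'), (b * b')%N; rewrite muln_gt0 b0 coprimeMl cb; split=> //.
by rewrite rmorphM natrM /= mulf_div.
Qed.

Lemma Zloc_int (N : nat) (a : int) : Zloc N a%:~R.
Proof. by exists a, 1%N; rewrite coprime1n divr1. Qed.

Lemma Zloc_inv_nat (N k : nat) : (0 < k)%N -> coprime k N -> Zloc N k%:R^-1.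
Proof. by move=> k0 ck; exists 1, k; rewrite mul1r. Qed.

Lemma Zloc_primes (N : nat) (q : rat) : (0 < N)%N ->
  (forall p, prime p -> (p %| N)%N -> Zloc p q) -> Zloc N q.
Proof.
move=> N0 h; apply/Zloc_denq; apply/negPn/negP => hc.
have g1 : (1 < gcdn `|denq q| N)%N.
  by rewrite ltn_neqAle eq_sym hc gcdn_gt0 N0 orbT.
have pp := pdiv_prime g1; set p := pdiv _ in pp.
have pg : (p %| gcdn `|denq q| N)%N by apply: pdiv_dvd.
have /Zloc_denq := h p pp (dvdn_trans pg (dvdn_gcdr _ _)).
by rewrite coprime_sym prime_coprime // (dvdn_trans pg (dvdn_gcdl _ _)).
Qed.

(** The idempotents [e1] and [e2] are the two lowest binary digits of an integer [tau]. What the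
    equation certifies is 2X + w, which is then 4 kap k; the equation in X, w, Y, Z is kept
    undiagonalised so that it speaks about the prime 2. *)
Definition int_cert (N c : nat) (tau : rat) : Prop :=
  exists e1 e2 X w Y Z : rat, [/\ e1 ^+ 2 = e1, e2 ^+ 2 = e2,
    (4 * c).-1%:R * (tau - e1 - 2 * e2) = 2 * X + w &
    1 + N%:R * (X ^+ 2 + X * w + c%:R * w ^+ 2) = Y ^+ 2 + Y * Z + c%:R * Z ^+ 2].

(** Integrality is wanted at the primes of [N0], which may or may not include 2, whereas [N] is
    always even. *)
Definition good_params (N0 N c : nat) : Prop :=
  exists ps, [/\ uniq ps, all prime ps & all odd ps] /\
    [/\ N = (2 * \prod_(p <- ps) p)%N, N0 = (\prod_(p <- ps) p)%N \/ N0 = N,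
        prime (4 * c).-1 & forall p x, p \in 2%N :: ps -> ~~ (p %| x ^ 2 + x + c)%N].

Lemma int_cert_sound (N c p : nat) (tau : rat) : prime p -> (p %| N)%N -> ~~ (p ^ 2 %| N)%N ->
  (forall x, ~~ (p %| x ^ 2 + x + c)%N) -> prime (4 * c).-1 -> coprime (4 * c).-1 p ->
  int_cert N c tau -> Zloc p tau.
Proof.
move=> pp pN np2 irr pk ck [e1 [e2 [X [w [Y [Z [h1 h2 h3 h4]]]]]]].
have [hX hw] := norm_form_integral pp pN np2 irr h4.
have bit (e : rat) : e ^+ 2 = e -> Zloc p e.
  move=> /eqP; rewrite -subr_eq0 -{2}[e]mulr1 expr2 -mulrBr mulf_eq0 subr_eq0.
  by case/orP => /eqP ->; [exact: (Zloc_int p 0)|exact: (Zloc_int p 1)].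
have k0 : (4 * c).-1%:R != 0 :> rat by rewrite pnatr_eq0 gtn_eqF ?prime_gt0.
have -> : tau = (4 * c).-1%:R^-1 * (2 * X + w) + (e1 + 2 * e2).
  by rewrite -h3; field.
have Z2 : Zloc p 2 by exact: (Zloc_int p 2).
apply: ZlocD; last by apply: ZlocD; [exact: bit|apply: ZlocM => //; exact: bit].
apply: ZlocM; first by apply: Zloc_inv_nat => //; exact: prime_gt0.
by apply: ZlocD => //; apply: ZlocM.
Qed.

Lemma int_cert_complete (R : realType) (N0 N c : nat) (tau : int) : good_params N0 N c ->
  int_cert N c tau%:~R.
Proof.
move=> [ps [[us pps ops] [NE _ pk irr]]].
have [k [e1 [e2 [b1 b2 tE]]]] : exists (k : int) (e1 e2 : rat),
    [/\ e1 ^+ 2 = e1, e2 ^+ 2 = e2 & tau%:~R = 4 * k%:~R + e1 + 2 * e2].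
  exists (tau %/ 4)%Z; have := modz_ge0 tau (isT : 4 != 0 :> int).
  have := ltz_pmod tau (isT : (0 : int) < 4).
  have := congr1 (fun x : int => x%:~R : rat) (divz_eq tau 4).
  case: (tau %% 4)%Z => // -[|[|[|[|]]]] //= -> _ _; rewrite rmorphD rmorphM /=.
  - by exists 0, 0; split; ring.
  - by exists 1, 0; split; ring.
  - by exists 0, 1; split; ring.
  - by exists 1, 1; split; ring.
have [w [U [V h]]] := norm_form_solution R us pps ops pk irr k.
have kE : 4 * c%:R = (4 * c).-1%:R + 1 :> rat.
  rewrite -natrM natr1 prednK //; case: (c) pk => [|c'] //.
set kap := (4 * c).-1%:R in kE h *.
(* Back from the diagonal coordinates: 2X + w = 4 kap k and 2Y + Z = U. *)
exists e1, e2, ((4 * kap * k%:~R - w) / 2), w, ((U - V) / 2), V; split => //.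
- by rewrite tE; field.
have cE : c%:R = (kap + 1) / 4 :> rat by rewrite -kE; field.
rewrite cE.
transitivity ((4 + N%:R * ((4 * kap * k%:~R) ^+ 2 + kap * w ^+ 2)) / 4 : rat); first by field.
by rewrite NE h; field.
Qed.

Lemma prime_sqr_notdvd_prod (p : nat) (s : seq nat) : prime p -> uniq s -> all prime s ->
  ~~ (p ^ 2 %| \prod_(q <- s) q)%N.
Proof.
move=> pp us ps; apply/negP => h; have hp : p \in s.
  apply/negPn/negP => hn; have := coprime_prod_primes pp ps hn.
  by rewrite prime_coprime // (dvdn_trans _ h) // dvdn_exp.
move: h; rewrite (big_rem p hp) /= -mulnn dvdn_pmul2l ?prime_gt0 //; apply/negP.
rewrite -prime_coprime //; apply: coprime_prod_primes => //.
  by apply/allP => j /mem_rem; apply: (allP ps).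
by rewrite mem_rem_uniqF.
Qed.

Lemma prime_dvd_prod (p : nat) (s : seq nat) : prime p -> all prime s -> (p %| \prod_(q <- s) q)%N -> p \in s.
Proof.
move=> pp ps h; apply/negPn/negP => hn; have := coprime_prod_primes pp ps hn.
by rewrite prime_coprime // h.
Qed.

Theorem Zloc_certificate (R : realType) (N0 N c : nat) (q : rat) : good_params N0 N c ->
  Zloc N0 q <-> exists s y, [/\ q * (1 + N0%:R * s) = y, int_cert N c s & int_cert N c y].
Proof.
move=> hg; have [ps [[us pps ops] [NE N0E pk irr]]] := hg.
have u2 : uniq (2%N :: ps) by rewrite cons_uniq us andbT; apply/negP => /(allP ops).
have p2 : all prime (2%N :: ps) by rewrite /= pps.
have NE2 : N = (\prod_(p <- 2%N :: ps) p)%N by rewrite big_cons.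
have N0N : (N0 %| N)%N by case: N0E => ->; rewrite ?dvdnn // NE dvdn_mull.
have N0pos : (0 < N)%N.
  by rewrite NE muln_gt0 /=; case: (\prod_(p <- ps) p)%N (odd_prod_primes ops).
have N00 : (0 < N0)%N by apply: dvdn_gt0 N0N.
split.
  move=> [a [b [b0 cb ->]]].
  have bR : b%:R != 0 :> rat by rewrite pnatr_eq0 gtn_eqF.
  have N0R : N0%:R != 0 :> rat by rewrite pnatr_eq0 gtn_eqF.
  pose f := totient N0; have f0 : (0 < f)%N by rewrite totient_gt0.
  have /dvdnP [s sE] : (N0 %| (b ^ f).-1)%N.
    by rewrite -subn1 -eqn_mod_dvd ?expn_gt0 ?b0 //; apply/eqP/Euler_exp_totient.
  have bE : (b ^ f)%:R = 1 + N0%:R * s%:R :> rat.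
    by rewrite -natrM mulnC -sE nat1r prednK // expn_gt0 b0.
  exists s%:R, (a * (b ^ f.-1)%N%:Z)%:~R; split.
  - rewrite -bE rmorphM /= -pmulrn -{1}(prednK f0) expnS natrM; field.
    by rewrite bR.
  - by have := int_cert_complete R s%:Z hg.
  exact: (int_cert_complete R _ hg).
move=> [s [y [hq hs hy]]].
apply: Zloc_primes => // p pp pN0.
have pN : (p %| N)%N by apply: dvdn_trans N0N.
have pin : p \in 2%N :: ps by apply: prime_dvd_prod => //; rewrite -NE2.
have np2 : ~~ (p ^ 2 %| N)%N by rewrite NE2; apply: prime_sqr_notdvd_prod.
have irrp x := irr p x pin.
(* Modulo [(4 * c).-1] the polynomial has a double root, so this prime cannot divide [N]. *)
have ck : coprime (4 * c).-1 p.
  rewrite coprime_sym prime_coprime //; apply/negP => hpk.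
  have pE : p = (4 * c).-1 by apply/eqP; rewrite -dvdn_prime2.
  have c0 : (0 < c)%N by case: (c) pk.
  have := irrp p./2; have p3 : (p %% 4 = 3)%N by rewrite pE; move: c0; clear; lia.
  rewrite -(@Gauss_dvdr _ 4); last by rewrite (_ : 4 = 2 ^ 2)%N // coprimeXr // coprimen2; move: p3; clear; lia.
  move/negP; apply; rewrite (_ : 4 * _ = p * p.+1)%N ?dvdn_mulr //.
  have h4 : (4 * c = p.+1)%N by move: pE c0; clear; lia.
  have h2 : (p = p./2.*2.+1)%N by move: p3; clear; lia.
  by rewrite !mulnDr h4; move: h2; set h := p./2; move=> ->; rewrite -muln2; ring.
have zs := int_cert_sound pp pN np2 irrp pk ck hs.
have zy := int_cert_sound pp pN np2 irrp pk ck hy.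
have [a [b [b0 cb sE]]] := zs.
have bR : b%:R != 0 :> rat by rewrite pnatr_eq0 gtn_eqF.
(* The numerator of [1 + N0 * s]. It is prime to [p], because [p] divides [N0] and not [b], so
   dividing by it preserves [p]-integrality. *)
pose d : int := b%:Z + N0%:Z * a.
have dE : 1 + N0%:R * s = d%:~R / b%:R.
  by rewrite sE /d rmorphD rmorphM /= -!pmulrn; field.
have npd : ~~ (p%:Z %| d)%Z.
  apply/negP => hd; have : (p%:Z %| b%:Z)%Z.
    have -> : b%:Z = d - N0%:Z * a by rewrite /d addrK.
    by apply: rpredB => //; apply: dvdz_mulr.
  by apply/negP; rewrite dvdzE /= -prime_coprime // coprime_sym.
have d0 : d != 0 by apply: contraNneq npd => ->; exact: dvdz0.
have dR : d%:~R != 0 :> rat by rewrite intr_eq0.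
have -> : q = y * (b%:R * (sgz d)%:~R * `|d|%N%:R^-1).
  have hsd : (sgz d)%:~R * `|d|%N%:R^-1 = d%:~R^-1 :> rat.
    have e1 : `|d|%N%:R = (sgz d)%:~R * d%:~R :> rat.
      by rewrite -rmorphM /= -abszEsg.
    by rewrite e1 invfM mulrA mulfV ?mul1r // intr_eq0 sgz_eq0.
  by rewrite -[b%:R * _ * _]mulrA hsd -hq dE; field; rewrite dR bR.
apply: ZlocM => //; apply: ZlocM.
  by apply: ZlocM; [exact: (Zloc_int p b%:Z)|exact: Zloc_int].
by apply: Zloc_inv_nat; rewrite ?absz_gt0 // coprime_sym prime_coprime.
Qed.

(** A zero of x^2 + x + c modulo an odd [p] makes -t, with t = 4c - 1, a square modulo [p]; so t is
    taken with [leg p t] opposite to [leg p p.-1]. Modulo 2, [c] has to be odd, hence t = 3 modulo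
    8. *)
Lemma good_params_exists (R : realType) (ps : seq nat) : uniq ps -> all prime ps -> all odd ps ->
  exists c, prime (4 * c).-1 /\ forall p x, p \in 2%N :: ps -> ~~ (p %| x ^ 2 + x + c)%N.
Proof.
move=> us pps ops.
have [|t [pt t4 t8 ht]] := @primes_with_residues R ps (fun p => - leg p p.-1) (-1) (-1) us pps ops _ (or_intror erefl) (or_intror erefl).
  move=> q hq; have qq := allP pps q hq; have q1 := prime_gt1 qq.
  have : leg q q.-1 != 0 by rewrite leg_eq0; apply/negP => /dvdn_leq; lia.
  by case: (leg_cases q q.-1) => ->; [|right|left].
have tm : (t %% 8 = 3)%N.
  move: t4 t8; rewrite /chi4 /chi8 -(@modn_dvdm 8 t 4) //; have := ltn_pmod t (isT : 0 < 8)%N.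
  by case: (t %% 8)%N => [|[|[|[|[|[|[|[|]]]]]]]].
exists (t.+1 %/ 4)%N.
have tE : (4 * (t.+1 %/ 4) = t.+1)%N by move: tm; clear; lia.
rewrite tE; split=> // p x; rewrite inE => /orP[/eqP ->|hp].
  by rewrite dvdn2; move: tm; clear; case: (boolP (odd x)) => ox tm; rewrite !oddD oddX /= ?ox ?orbT /=; lia.
have [pp op] := (allP pps p hp, allP ops p hp); have p1 := prime_gt1 pp.
apply/negP => hd.
have hd4 : (p %| (2 * x + 1) ^ 2 + t)%N.
  have -> : ((2 * x + 1) ^ 2 + t = 4 * (x ^ 2 + x + t.+1 %/ 4))%N.
    by rewrite [RHS]mulnDr tE -addn1; ring.
  exact: dvdn_mull.
have npx : ~~ (p %| 2 * x + 1)%N.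
  apply/negP => h; have : (p %| t)%N by rewrite -(dvdn_addr _ (_ : p %| (2 * x + 1) ^ 2)%N) // dvdn_exp.
  rewrite -leg_eq0 ht // oppr_eq0 leg_eq0 => /dvdn_leq; lia.
have : leg p ((2 * x + 1) ^ 2) = leg p (p.-1 * t).
  have e : ((2 * x + 1) ^ 2 = p.-1 * t %[mod p])%N.
    apply/eqP; rewrite -(eqn_modDr t) -mulSnr prednK ?prime_gt0 // [(p * t)%N]mulnC modnMl; exact: hd4.
  by rewrite -leg_mod e leg_mod.
rewrite -mulnn leg_sqr // legM // ht // mulrN => /eqP.
by case: (leg_cases p p.-1) => ->.
Qed.

(** * Recursive functions with an oracle *)

Local Open Scope nat_scope.

Section OracleRecursive.
Variable B : set nat.

(** Only total functions are considered: every minimization below comes with a proof that its search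
    succeeds. *)
Definition crec (n : nat) (F : n.-tuple nat -> nat) : Prop :=
  exists f : orec n, forall v, ocomputes B f v (F v).

Lemma crec_ext n (F G : n.-tuple nat -> nat) : F =1 G -> crec F -> crec G.
Proof. by move=> FG [f hf]; exists f => v; rewrite -FG. Qed.

Lemma crec_zero n : @crec n (fun=> 0).
Proof. by exists (OZero n). Qed.

Lemma crec_proj n (i : 'I_n) : crec (fun v => tnth v i).
Proof. by exists (OProj i). Qed.

Lemma crec_comp n k (G : k.-tuple nat -> nat) (F : 'I_k -> n.-tuple nat -> nat) :
  crec G -> (forall i, crec (F i)) -> crec (fun v => G [tuple F i v | i < k]).
Proof.
move=> [g hg] /choice[f hf]; exists (OComp g f) => v /=.
by exists [tuple F i v | i < k] => // i; rewrite tnth_mktuple.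
Qed.

Lemma crec_rec n (F : n.-tuple nat -> nat) (G : n.+2.-tuple nat -> nat) :
  crec F -> crec G ->
  crec (fun v : n.+1.-tuple nat =>
    nat_rect (fun=> nat) (F [tuple of behead v]) (fun i r => G [tuple of i :: r :: [tuple of behead v]]) (thead v)).
Proof.
move=> [f hf] [g hg]; exists (ORec f g) => v /=.
by eexists; split; last reflexivity.
Qed.

Lemma crec_min n (F : n.+1.-tuple nat -> nat) (H : forall v : n.-tuple nat, exists y : nat, F [tuple of y :: v] == 0) :
  crec F -> crec (fun v : n.-tuple nat => ex_minn (H v)).
Proof.
move=> [f hf]; exists (OMin f) => v /=; case: ex_minnP => y /eqP hy hmin; split; first by rewrite -hy.
move=> i iy; exists (F [tuple of i :: v]).-1; rewrite prednK //.
by rewrite lt0n; apply/negP => /hmin; rewrite leqNgt iy.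
Qed.

Definition rec1 (h : nat -> nat) : Prop := crec (fun v : 1.-tuple nat => h (thead v)).
Definition rec2 (h : nat -> nat -> nat) : Prop :=
  crec (fun v : 2.-tuple nat => h (tnth v ord0) (tnth v ord_max)).

Lemma rec1_succ : rec1 succn.
Proof. by exists OSucc. Qed.

Lemma rec1_oracle : rec1 (fun x => `[< B x >]).
Proof.
by exists OOracle => v /=; case: asboolP => h; [left|right].
Qed.

Lemma crec_app1 n h (F : n.-tuple nat -> nat) : rec1 h -> crec F -> crec (fun v => h (F v)).
Proof.
move=> hh hF; apply: (crec_ext _ (crec_comp hh (fun _ : 'I_1 => hF))) => v.
by rewrite /thead tnth_mktuple.
Qed.

Lemma crec_app2 n h (F G : n.-tuple nat -> nat) : rec2 h -> crec F -> crec G ->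
  crec (fun v => h (F v) (G v)).
Proof.
move=> hh hF hG.
apply: (crec_ext _ (crec_comp (F := fun i : 'I_2 => if i == ord0 then F else G) hh _)).
  by move=> v; rewrite !tnth_mktuple.
by move=> i; case: ifP.
Qed.

Lemma crec_tuple n k (G : k.-tuple nat -> nat) (F : n.-tuple nat -> k.-tuple nat) :
  crec G -> (forall i, crec (fun v => tnth (F v) i)) -> crec (fun v => G (F v)).
Proof.
move=> hG hF; apply: (crec_ext _ (crec_comp (F := fun i v => tnth (F v) i) hG hF)) => v.
by congr G; apply: eq_from_tnth => i; rewrite tnth_mktuple.
Qed.

Lemma crec_nat_rect n (F : n.-tuple nat -> nat) (G : n.+2.-tuple nat -> nat) (k : n.-tuple nat -> nat) :
  crec F -> crec G -> crec k ->
  crec (fun v => nat_rect (fun=> nat) (F v) (fun i r => G [tuple of i :: r :: v]) (k v)).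
Proof.
move=> hF hG hk.
apply: (crec_ext _ (crec_tuple (F := fun v => [tuple of k v :: v]) (crec_rec hF hG) _)) => [v|i].
  rewrite theadE; have -> : [tuple of behead (k v :: v)] = v by apply: val_inj.
  by [].
case: (unliftP ord0 i) => [j ->|->]; last exact: hk.
by apply: (crec_ext _ (crec_proj j)) => v; rewrite tnthS.
Qed.

Lemma rec1_comp f g : rec1 f -> rec1 g -> rec1 (fun x => f (g x)).
Proof. exact: crec_app1. Qed.

Lemma rec1_comp2 h f g : rec2 h -> rec1 f -> rec1 g -> rec1 (fun x => h (f x) (g x)).
Proof. exact: crec_app2. Qed.

Lemma rec1_id : rec1 id. Proof. exact: (crec_proj ord0). Qed.

Lemma crec_const n k : @crec n (fun=> k).
Proof. by elim: k => [|k IH]; [exact: crec_zero|exact: (crec_app1 rec1_succ IH)]. Qed.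

Lemma rec1_const k : rec1 (fun=> k). Proof. exact: crec_const. Qed.

Lemma rec2_addn : rec2 addn.
Proof.
have h := crec_nat_rect (crec_proj ord_max) (crec_app1 rec1_succ (crec_proj (inord 1 : 'I_4))) (crec_proj (ord0 : 'I_2)).
apply: (crec_ext _ h) => v; elim: (tnth v ord0) => //= k ->.
by rewrite (tnth_nth 0) /= inordK.
Qed.

Lemma rec2_muln : rec2 muln.
Proof.
have h := crec_nat_rect (crec_zero 2) (crec_app2 rec2_addn (crec_proj (inord 3 : 'I_4)) (crec_proj (inord 1 : 'I_4)))
  (crec_proj (ord0 : 'I_2)).
apply: (crec_ext _ h) => v; elim: (tnth v ord0) => //= k ->.
by rewrite !(tnth_nth 0) /= !inordK.
Qed.

Lemma rec1_nat_rect (a : nat) (g : nat -> nat -> nat) : rec2 g -> rec1 (nat_rect (fun=> nat) a g).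
Proof.
move=> hg; have h := crec_nat_rect (crec_const 1 a)
  (crec_app2 hg (crec_proj (inord 0 : 'I_3)) (crec_proj (inord 1 : 'I_3))) (crec_proj (ord0 : 'I_1)).
apply: (crec_ext _ h) => v; rewrite /thead; elim: (tnth v ord0) => //= k ->.
by rewrite !(tnth_nth 0) /= !inordK.
Qed.

Lemma rec1_ext f g : f =1 g -> rec1 f -> rec1 g.
Proof. by move=> fg; apply: crec_ext => v; rewrite fg. Qed.

Lemma rec2_ext f g : f =2 g -> rec2 f -> rec2 g.
Proof. by move=> fg; apply: crec_ext => v; rewrite fg. Qed.

Lemma rec2_fst f : rec1 f -> rec2 (fun x _ => f x).
Proof. by move=> hf; apply: crec_app1 hf (crec_proj _). Qed.

Lemma rec2_snd f : rec1 f -> rec2 (fun _ y => f y).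
Proof. by move=> hf; apply: crec_app1 hf (crec_proj _). Qed.

Lemma rec2_comp h f g : rec2 h -> rec2 f -> rec2 g -> rec2 (fun x y => h (f x y) (g x y)).
Proof. exact: crec_app2. Qed.

Lemma rec1_pred : rec1 predn.
Proof. by apply: rec1_ext (rec1_nat_rect 0 (rec2_fst rec1_id)); case. Qed.

Lemma rec2_subn : rec2 subn.
Proof.
have h := crec_nat_rect (crec_proj (ord0 : 'I_2)) (crec_app1 rec1_pred (crec_proj (inord 1 : 'I_4))) (crec_proj ord_max).
apply: (crec_ext _ h) => v; elim: (tnth v ord_max) => [|k IH] /=; first by rewrite subn0.
by rewrite (tnth_nth 0) /= inordK //= IH subnS.
Qed.

Lemma rec2_eqn : rec2 (fun x y => x == y).
Proof.
apply: (@rec2_ext (fun x y => 1 - ((x - y) + (y - x)))).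
  by move=> x y; case: eqP; lia.
apply: rec2_comp rec2_subn (rec2_fst (rec1_const 1)) _.
apply: rec2_comp rec2_addn rec2_subn _.
exact: crec_app2 rec2_subn (crec_proj _) (crec_proj _).
Qed.

Lemma rec2_leq : rec2 (fun x y => x <= y).
Proof.
apply: (@rec2_ext (fun x y => x - y == 0)).
  by move=> x y; rewrite subn_eq0.
exact: rec2_comp rec2_eqn rec2_subn (rec2_fst (rec1_const 0)).
Qed.

Lemma rec1_exp2 : rec1 (expn 2).
Proof.
apply: rec1_ext (rec1_nat_rect 1 (rec2_comp rec2_addn (rec2_snd rec1_id) (rec2_snd rec1_id))).
by elim=> //= n ->; rewrite expnS mul2n addnn.
Qed.

Lemma rec1_odd : rec1 odd.
Proof.
apply: rec1_ext (rec1_nat_rect 0 (rec2_comp rec2_subn (rec2_fst (rec1_const 1)) (rec2_snd rec1_id))).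
by elim=> //= n ->; case: odd.
Qed.

Lemma rec1_half : rec1 half.
Proof.
apply: rec1_ext (rec1_nat_rect 0 (rec2_comp rec2_addn (rec2_fst rec1_odd) (rec2_snd rec1_id))).
elim=> // n IH; rewrite [LHS]/= IH; lia.
Qed.

(* The bijection [cons_code a (code s) = code (a :: s)] of CodeSeq, used as a pairing function. *)
Definition cons_code (a b : nat) : nat := 2 ^ a * b.*2.+1.
Definition halve_even (u : nat) : nat := odd u * u + (1 - odd u) * u./2.
Definition odd_part (z : nat) : nat := iter z halve_even z.
Definition tail_code (z : nat) : nat := (odd_part z)./2.

(** Since [a < 2 ^ a], the number itself bounds the halvings required, and further ones leave an odd
    value fixed. *)
Lemma odd_part_cons a b : odd_part (cons_code a b) = b.*2.+1.
Proof.
suff h k : a <= k -> iter k halve_even (cons_code a b) = b.*2.+1.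
  by apply: h; apply: leq_trans (ltnW (ltn_expl a (isT : 1 < 2))) _; rewrite leq_pmulr.
have even_step u : halve_even u.*2 = u by rewrite /halve_even odd_double doubleK; lia.
have stable j : iter j halve_even b.*2.+1 = b.*2.+1.
  by elim: j => //= j ->; rewrite /halve_even /= odd_double; lia.
elim: a k => [|a IH] [|k] // ak; rewrite /cons_code.
- by rewrite mul1n.
- by rewrite mul1n stable.
by rewrite iterSr expnS -mulnA mul2n even_step IH.
Qed.

Lemma head_code_ex z : exists a, 2 ^ a * odd_part z == z.
Proof.
have [->|z0] := posnP z; first by exists 0.
have := CodeSeq.decodeK z; case: (CodeSeq.decode z) => [|a s] /=; first by move=> e; rewrite -e in z0.
by rewrite -/(cons_code _ _) => <-; exists a; rewrite odd_part_cons eqxx.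
Qed.

Definition head_code (z : nat) : nat := ex_minn (head_code_ex z).

Lemma tail_cons a b : tail_code (cons_code a b) = b.
Proof. by rewrite /tail_code odd_part_cons /= uphalf_double. Qed.

Lemma head_cons a b : head_code (cons_code a b) = a.
Proof.
rewrite /head_code; case: ex_minnP => c; rewrite odd_part_cons eqn_pmul2r // eqn_exp2l //.
by move=> /eqP.
Qed.

Lemma tail0 : tail_code 0 = 0. Proof. by []. Qed.

Lemma rec2_cons : rec2 cons_code.
Proof.
apply: rec2_comp rec2_muln (rec2_fst rec1_exp2) _.
by apply: (rec2_snd (f := fun b => b.*2.+1)); apply: rec1_comp rec1_succ _;
  apply: (@rec1_ext (fun x => x + x)) => [x|]; [rewrite addnn|exact: rec1_comp2 rec2_addn rec1_id rec1_id].
Qed.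

Lemma rec1_odd_part : rec1 odd_part.
Proof.
have hg : rec2 (fun _ u => halve_even u).
  apply: (rec2_snd (f := halve_even)).
  apply: rec1_comp2 rec2_addn _ _; first exact: rec1_comp2 rec2_muln rec1_odd rec1_id.
  apply: rec1_comp2 rec2_muln _ rec1_half.
  exact: rec1_comp2 rec2_subn (rec1_const 1) rec1_odd.
have h := crec_nat_rect (crec_proj (ord0 : 'I_1))
  (crec_app2 hg (crec_proj (inord 0 : 'I_3)) (crec_proj (inord 1 : 'I_3))) (crec_proj (ord0 : 'I_1)).
apply: (crec_ext _ h) => v; rewrite /odd_part /thead; elim: {2 3}(tnth v ord0) => //= k ->.
by rewrite !(tnth_nth 0) /= !inordK.
Qed.

Lemma rec1_tail : rec1 tail_code.
Proof. exact: rec1_comp rec1_half rec1_odd_part. Qed.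

Lemma rec1_min (P : nat -> nat -> bool) (H : forall x, exists y, P x y) :
  rec2 (fun x y => P x y) -> rec1 (fun x => ex_minn (H x)).
Proof.
move=> hP; have hF : crec (fun v : 2.-tuple nat => 1 - P (tnth v ord_max) (tnth v ord0)).
  apply: crec_app2 rec2_subn (crec_const _ 1) _.
  exact: crec_app2 hP (crec_proj _) (crec_proj _).
have t0 (v : 1.-tuple nat) (u : nat) : tnth [tuple of u :: v] ord0 = u by [].
have t1 (v : 1.-tuple nat) (u : nat) : tnth [tuple of u :: v] ord_max = thead v.
  by rewrite !(tnth_nth 0) /= /thead (tnth_nth 0).
pose F (v : 2.-tuple nat) := 1 - P (tnth v ord_max) (tnth v ord0).
have e (v : 1.-tuple nat) (u : nat) : (F [tuple of u :: v] == 0) = P (thead v) u.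
  by rewrite /F t0 t1; case: (P (thead v) u).
have hH (v : 1.-tuple nat) : exists y : nat, F [tuple of y :: v] == 0.
  by have [y hy] := H (thead v); exists y; rewrite e.
apply: (crec_ext _ (crec_min hH hF)) => v.
case: ex_minnP => y; rewrite e => hy ymin; case: ex_minnP => z hz zmin.
by apply/eqP; rewrite eqn_leq ymin ?e // zmin.
Qed.

Lemma rec1_head : rec1 head_code.
Proof.
apply: (@rec1_min (fun z a => 2 ^ a * odd_part z == z) head_code_ex).
apply: rec2_comp rec2_eqn _ (rec2_fst rec1_id).
exact: rec2_comp rec2_muln (rec2_snd rec1_exp2) (rec2_fst rec1_odd_part).
Qed.

End OracleRecursive.

(** * Computable functions between coded types *)

Class Code (T : Type) := enc : T -> nat.
#[global] Instance code_nat : Code nat := id.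
#[global] Instance code_bool : Code bool := nat_of_bool.
#[global] Instance code_prod (T U : Type) (cT : Code T) (cU : Code U) : Code (T * U) :=
  fun p => cons_code (enc p.1) (enc p.2).
#[global] Instance code_seq (T : Type) (cT : Code T) : Code (seq T) :=
  fun s => CodeSeq.code (map enc s).

Lemma enc_cons (A : Type) (cA : Code A) (a : A) (s : seq A) :
  enc (a :: s) = cons_code (enc a) (enc s).
Proof. by []. Qed.

Section Computable.
Variable B : set nat.

(** The values of [g] off the codes are unconstrained, so only minimization has to worry about
    numbers that code nothing. *)
Definition computable (T U : Type) (cT : Code T) (cU : Code U) (f : T -> U) : Prop :=
  exists2 g, rec1 B g & forall x, g (enc x) = enc (f x).
Arguments computable {T U cT cU} f.

Section BasicClosure.
Context {T U V A : Type} {cT : Code T} {cU : Code U} {cV : Code V} {cA : Code A}.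

Lemma computable_ext (f g : T -> U) : f =1 g -> computable f -> computable g.
Proof. by move=> fg [h hh hf]; exists h => // x; rewrite hf fg. Qed.

Lemma computable_id : computable (fun x : T => x).
Proof. by exists id; [exact: rec1_id|]. Qed.

Lemma computable_const (c : U) : computable (fun _ : T => c).
Proof. by exists (fun=> enc c); [exact: rec1_const|]. Qed.

Lemma computable_comp (h : U -> V) (f : T -> U) : computable h -> computable f -> computable (fun x => h (f x)).
Proof.
move=> [h' rh eh] [f' rf ef]; exists (fun x => h' (f' x)); first exact: rec1_comp.
by move=> x; rewrite ef eh.
Qed.

Lemma computable_pair (f : T -> U) (g : T -> V) : computable f -> computable g ->
  computable (fun x => (f x, g x)).
Proof.
move=> [f' rf ef] [g' rg eg]; exists (fun x => cons_code (f' x) (g' x)).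
  exact: rec1_comp2 (rec2_cons B) rf rg.
by move=> x; rewrite ef eg.
Qed.

Lemma computable_fst (f : T -> U * V) : computable f -> computable (fun x => (f x).1).
Proof.
move=> [f' rf ef]; exists (fun x => head_code (f' x)); first exact: rec1_comp (rec1_head B) rf.
by move=> x; rewrite ef [LHS]head_cons.
Qed.

Lemma computable_snd (f : T -> U * V) : computable f -> computable (fun x => (f x).2).
Proof.
move=> [f' rf ef]; exists (fun x => tail_code (f' x)); first exact: rec1_comp (rec1_tail B) rf.
by move=> x; rewrite ef [LHS]tail_cons.
Qed.

Lemma computable_nat2 (h : nat -> nat -> nat) (f g : T -> nat) : rec2 B h ->
  computable f -> computable g -> computable (fun x => h (f x) (g x)).
Proof.
move=> rh [f' rf ef] [g' rg eg]; exists (fun x => h (f' x) (g' x)); first exact: rec1_comp2.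
by move=> x; rewrite ef eg.
Qed.

Lemma computable_natb2 (h : nat -> nat -> bool) (f g : T -> nat) : rec2 B (fun x y => h x y) ->
  computable f -> computable g -> computable (fun x => h (f x) (g x)).
Proof.
move=> rh [f' rf ef] [g' rg eg]; exists (fun x => h (f' x) (g' x) : nat).
  exact: (rec1_comp2 (h := fun x y => h x y)).
by move=> x; rewrite ef eg.
Qed.

Lemma computable_nat_of_bool (f : T -> bool) : computable f -> computable (fun x => f x : nat).
Proof. by case=> f' rf ef; exists f'. Qed.

Lemma computable_oracle (f : T -> nat) : computable f -> computable (fun x => `[< B (f x) >]).
Proof.
move=> [f' rf ef]; exists (fun x => `[< B (f' x) >] : nat); first exact: rec1_comp (rec1_oracle B) rf.
by move=> x; rewrite ef.
Qed.

Lemma computable_cons (f : T -> A) (g : T -> seq A) : computable f -> computable g ->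
  computable (fun x => f x :: g x).
Proof.
move=> [f' rf ef] [g' rg eg]; exists (fun x => cons_code (f' x) (g' x)).
  exact: rec1_comp2 (rec2_cons B) rf rg.
by move=> x; rewrite ef eg.
Qed.

Lemma computable_behead (f : T -> seq A) : computable f -> computable (fun x => behead (f x)).
Proof.
move=> [f' rf ef]; exists (fun x => tail_code (f' x)); first exact: rec1_comp (rec1_tail B) rf.
by move=> x; rewrite ef; case: (f x) => [|a s]; [exact: tail0|exact: tail_cons].
Qed.

Lemma computable_nat_rect (z : T -> U) (g : T -> nat -> U -> U) (n : T -> nat) :
  computable z -> computable (fun p : T * nat * U => g p.1.1 p.1.2 p.2) -> computable n ->
  computable (fun x => nat_rect (fun=> U) (z x) (g x) (n x)).
Proof.
move=> [z' rz ez] [g' rg eg] [n' rn en].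
exists (fun x => nat_rect (fun=> nat) (z' x) (fun i r => g' (cons_code (cons_code x i) r)) (n' x)).
  have hg : crec B (fun v : 3.-tuple nat => g' (cons_code (cons_code (tnth v (inord 2)) (tnth v (inord 0))) (tnth v (inord 1)))).
    apply: (crec_app1 rg); apply: (crec_app2 (rec2_cons B)); last exact: crec_proj.
    by apply: (crec_app2 (rec2_cons B)); apply: crec_proj.
  apply: (crec_ext _ (crec_nat_rect rz hg rn)) => v; elim: (n' _) => //= k ->.
  by rewrite !(tnth_nth 0) /= !inordK //= /thead (tnth_nth 0).
by move=> x; rewrite ez en /enc /code_nat; elim: (n x) => //= k ->; exact: (eg (x, k, _)).
Qed.

(* [junk] recognises the naturals that are not codes; the search is made to stop there, since
   minimization is only total when the predicate is satisfiable on every natural number. *)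
Lemma computable_search (junk : nat -> bool) (P : T -> nat -> bool) (H : forall x, exists n, P x n) :
  rec1 B (fun z => junk z) -> (forall x : T, ~~ junk (enc x)) ->
  (forall z, junk z \/ exists x : T, enc x = z) ->
  computable (fun p : T * nat => P p.1 p.2) -> computable (fun x => ex_minn (H x)).
Proof.
move=> rj nj hj [p rp ep].
have hex z : exists n, (0 < p (cons_code z n) + junk z).
  have [jz|[x <-]] := hj z; first by exists 0; rewrite jz addn1.
  by have [n hn] := H x; exists n; rewrite [p _](ep (x, n)) /= hn.
exists (fun z => ex_minn (hex z)).
  apply: (rec1_min (P := fun z n => 0 < p (cons_code z n) + junk z)).
  apply: rec2_comp (rec2_leq B) (rec2_fst (rec1_const B 1)) _.
  apply: rec2_comp (rec2_addn B) _ (rec2_fst rj).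
  exact: crec_app1 rp (rec2_cons B).
move=> x; have e k : (0 < p (cons_code (enc x) k) + junk (enc x)) = P x k.
  by rewrite (negPf (nj x)) addn0 [p _](ep (x, k)) /enc /code_bool /=; case: (P x k).
case: ex_minnP => n; rewrite e => hn nmin; case: ex_minnP => m hm mmin.
by rewrite /enc /code_nat; apply/eqP; rewrite eqn_leq nmin ?e // mmin.
Qed.
End BasicClosure.

Section Conditionals.
Context {T U : Type} {cT : Code T} {cU : Code U}.

Lemma computable_if (b : T -> bool) (f g : T -> U) : computable b -> computable f -> computable g ->
  computable (fun x => if b x then f x else g x).
Proof.
(* A conditional is a recursion whose number of steps is the boolean. *)
move=> hb hf hg; apply: (computable_ext _ (computable_nat_rect (g := fun x _ _ => f x) hg _ (computable_nat_of_bool hb))).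
  by move=> x; case: (b x).
exact: computable_comp hf (computable_fst (computable_fst computable_id)).
Qed.
End Conditionals.

Section BooleansAndFolds.
Context {T U A : Type} {cT : Code T} {cU : Code U} {cA : Code A}.

Lemma computable_and (f g : T -> bool) : computable f -> computable g -> computable (fun x => f x && g x).
Proof.
move=> hf hg; apply: (computable_ext _ (computable_if hf hg (computable_const false))) => x.
by case: (f x).
Qed.

Lemma computable_or (f g : T -> bool) : computable f -> computable g -> computable (fun x => f x || g x).
Proof.
move=> hf hg; apply: (computable_ext _ (computable_if hf (computable_const true) hg)) => x.
by case: (f x).
Qed.

Lemma computable_neg (f : T -> bool) : computable f -> computable (fun x => ~~ f x).
Proof.
move=> hf; apply: (computable_ext _ (computable_if hf (computable_const false) (computable_const true))) => x.
by case: (f x).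
Qed.

Lemma computable_foldl (z : T -> U) (g : T -> U -> A -> U) (l : T -> seq A) :
  computable z -> computable (fun p : T * U * A => g p.1.1 p.1.2 p.2) -> computable l ->
  computable (fun x => foldl (g x) (z x) (l x)).
Proof.
move=> [z' rz ez] [g' rg eg] [l' rl el].
(* The state is the pair (rest of the list, accumulator). *)
pose stp (x : nat) (st : nat) := if head_code st == 0 then st else
  cons_code (tail_code (head_code st)) (g' (cons_code (cons_code x (tail_code st)) (head_code (head_code st)))).
(* The code of the list serves as the number of iterations: it is at least the length, and on an
   exhausted list the step does nothing. *)
pose f x := tail_code (nat_rect (fun=> nat) (cons_code (l' x) (z' x)) (fun _ => stp x) (l' x)).
have rstp : rec2 B stp.
  have rh : rec2 B (fun _ st => head_code st) by apply: rec2_snd; exact: rec1_head.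
  have rhh : rec2 B (fun _ st => head_code (head_code st)).
    by apply: rec2_snd; apply: rec1_comp; exact: rec1_head.
  have rb : rec2 B (fun _ st => head_code st == 0).
    exact: rec2_comp (rec2_eqn B) rh (rec2_fst (rec1_const B 0)).
  apply: (@rec2_ext _ (fun x st => (head_code st == 0) * st + (1 - nat_of_bool (head_code st == 0)) *
     cons_code (tail_code (head_code st)) (g' (cons_code (cons_code x (tail_code st)) (head_code (head_code st)))))).
    by move=> x st; rewrite /stp; case: eqP => _; rewrite ?mul1n ?mul0n ?addn0.
  apply: rec2_comp (rec2_addn B) _ _; first exact: rec2_comp (rec2_muln B) rb (rec2_snd (rec1_id B)).
  apply: rec2_comp (rec2_muln B) _ _; first exact: rec2_comp (rec2_subn B) (rec2_fst (rec1_const B 1)) rb.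
  apply: rec2_comp (rec2_cons B) _ _; first by apply: rec2_snd; apply: rec1_comp (rec1_tail B) (rec1_head B).
  have rr : rec2 B (fun x st => cons_code (cons_code x (tail_code st)) (head_code (head_code st))).
    exact: rec2_comp (rec2_cons B) (rec2_comp (rec2_cons B) (rec2_fst (rec1_id B)) (rec2_snd (rec1_tail B))) rhh.
  exact: (crec_app1 rg rr).
exists f.
  apply: rec1_comp (rec1_tail B) _.
  have hs : crec B (fun v : 3.-tuple nat => stp (tnth v (inord 2)) (tnth v (inord 1))).
    by apply: (crec_app2 rstp); apply: crec_proj.
  have h0 : rec1 B (fun x => cons_code (l' x) (z' x)) by exact: rec1_comp2 (rec2_cons B) rl rz.
  apply: (crec_ext _ (crec_nat_rect h0 hs rl)) => v; elim: {2 4}(l' (thead v)) => //= k ->.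
  by rewrite !(tnth_nth 0) /= !inordK //= /thead (tnth_nth 0).
move=> x; rewrite /f el ez.
have sz : size (l x) <= enc (l x).
  rewrite /enc /code_seq; elim: (l x) => //= a s IH.
  by apply: leq_trans (_ : (CodeSeq.code (map enc s)).*2.+1 <= _); [move: IH; lia|rewrite leq_pmull // expn_gt0].
suff h k s u : size s <= k -> nat_rect (fun=> nat) (cons_code (@enc _ (code_seq cA) s) (@enc _ cU u)) (fun _ => stp (@enc _ cT x)) k =
    cons_code 0 (@enc _ cU (foldl (g x) u s)) by rewrite h // tail_cons.
have shift (F : nat -> nat) y j : nat_rect (fun=> nat) y (fun=> F) j.+1 = nat_rect (fun=> nat) (F y) (fun=> F) j.
  by elim: j => //= j <-.
elim: k s u => [|k IH] [|a s] u //= hs.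
  by rewrite IH // /stp head_cons.
rewrite -[stp _ _]/(nat_rect (fun=> nat) _ (fun _ => stp (enc x)) k.+1) shift {1}/stp head_cons.
rewrite [enc (_ :: _)]enc_cons.
have -> : (cons_code (@enc _ cA a) (@enc _ (code_seq cA) s) == 0) = false by rewrite /cons_code muln_eq0 expn_eq0.
rewrite !tail_cons !head_cons [X in cons_code _ X](eg (x, u, a)).
by rewrite IH.
Qed.
End BooleansAndFolds.
End Computable.
Arguments computable B {T U cT cU} f.

Section ListFunctions.
Context {B : set nat} {T U A : Type} {cT : Code T} {cU : Code U} {cA : Code A}.

Lemma computable_foldr (z : T -> U) (g : T -> A -> U -> U) (l : T -> seq A) :
  computable B z -> computable B (fun p : T * A * U => g p.1.1 p.1.2 p.2) -> computable B l ->
  computable B (fun x => foldr (g x) (z x) (l x)).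
Proof.
move=> hz hg hl.
have hr : computable B (fun x => rev (l x)).
  have e s (t : seq A) : foldl (fun r a => a :: r) t s = catrev s t by elim: s t => //= a s IH t; rewrite IH.
  apply: (computable_ext (f := fun x => foldl (fun r a => a :: r) [::] (l x))) => [x|]; first exact: e.
  apply: (computable_foldl (g := fun _ r a => a :: r)) (computable_const _ _) _ hl.
  apply: computable_cons; first exact: computable_snd (computable_id _).
  exact: computable_snd (computable_fst (computable_id _)).
apply: (computable_ext (f := fun x => foldl (fun u a => g x a u) (z x) (rev (l x)))).
  by move=> x; rewrite foldl_rev.
apply: (computable_foldl (g := fun x u a => g x a u)) hz _ hr.
apply: (computable_comp (f := fun p : T * U * A => (p.1.1, p.2, p.1.2))) hg _.
apply: computable_pair; first apply: computable_pair.
- exact: computable_fst (computable_fst (computable_id _)).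
- exact: computable_snd (computable_id _).
exact: computable_snd (computable_fst (computable_id _)).
Qed.
End ListFunctions.

Section NatFunctions.
Context {B : set nat} {T : Type} {cT : Code T}.
Implicit Types f g : T -> nat.

Lemma computable_add f g : computable B f -> computable B g -> computable B (fun x => f x + g x).
Proof. exact/computable_nat2/rec2_addn. Qed.

Lemma computable_mul f g : computable B f -> computable B g -> computable B (fun x => f x * g x).
Proof. exact/computable_nat2/rec2_muln. Qed.

Lemma computable_sub f g : computable B f -> computable B g -> computable B (fun x => f x - g x).
Proof. exact/computable_nat2/rec2_subn. Qed.

Lemma computable_eqn f g : computable B f -> computable B g -> computable B (fun x => f x == g x).
Proof. exact/(computable_natb2 (h := fun x y => x == y))/rec2_eqn. Qed.

Lemma computable_leq f g : computable B f -> computable B g -> computable B (fun x => f x <= g x).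
Proof. exact/(computable_natb2 (h := leq))/rec2_leq. Qed.

Lemma computable_succ f : computable B f -> computable B (fun x => (f x).+1).
Proof.
move=> hf; apply: (computable_ext (f := fun x => f x + 1)) => [x|]; first by rewrite addn1.
exact: computable_add hf (computable_const _ _).
Qed.

Lemma computable_pred f : computable B f -> computable B (fun x => (f x).-1).
Proof.
move=> hf; apply: (computable_ext (f := fun x => f x - 1)) => [x|]; first by rewrite subn1.
exact: computable_sub hf (computable_const _ _).
Qed.

Lemma computable_odd f : computable B f -> computable B (fun x => odd (f x)).
Proof.
move=> [f' rf ef]; exists (fun x => odd (f' x) : nat); first exact: rec1_comp (rec1_odd B) rf.
by move=> x; rewrite ef.
Qed.

Lemma computable_half f : computable B f -> computable B (fun x => (f x)./2).
Proof.
move=> [f' rf ef]; exists (fun x => (f' x)./2); first exact: rec1_comp (rec1_half B) rf.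
by move=> x; rewrite ef.
Qed.

Lemma computable_decode f : computable B f -> computable B (fun x => CodeSeq.decode (f x)).
Proof.
by move=> [f' rf ef]; exists f' => // x; rewrite ef /enc /code_seq map_id CodeSeq.decodeK.
Qed.

End NatFunctions.

Ltac computable_list_step := fail.
Ltac computable_extra_step := fail.
Ltac computable_step := first [ eassumption | computable_list_step | computable_extra_step
  | match goal with
    | H : computable _ ?h |- computable _ (fun x => ?h (@?f x)) => apply: (computable_comp (f := f) H)
    | H : computable _ (fun p : ?T => ?h p.1 p.2) |- computable _ (fun x => ?h (@?f x) (@?g x)) =>
        refine (computable_comp (h := fun p : T => h p.1 p.2) (f := fun x => (f x, g x)) H _)
    end
  | lazymatch goal with
  | |- computable _ (@fst _ _) => apply: (computable_fst (f := id))
  | |- computable _ (@snd _ _) => apply: (computable_snd (f := id))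
  | |- computable _ id => apply: computable_id
  | |- computable _ (fun x => x) => apply: computable_id
  | |- computable _ (fun _ => ?c) => apply: (computable_const _ c)
  | |- computable _ (fun x => (@?f x).1) => apply: (computable_fst (f := f))
  | |- computable _ (fun x => (@?f x).2) => apply: (computable_snd (f := f))
  | |- computable _ (fun x => (@?f x, @?g x)) => apply: (computable_pair (f := f) (g := g))
  | |- computable _ (fun x => nat_of_bool (@?f x)) => apply: (computable_nat_of_bool (f := f))
  | |- computable _ (fun x => @?f x && @?g x) => apply: (computable_and (f := f) (g := g))
  | |- computable _ (fun x => @?f x || @?g x) => apply: (computable_or (f := f) (g := g))
  | |- computable _ (fun x => ~~ @?f x) => apply: (computable_neg (f := f))
  | |- computable _ (fun x => eq_op (@?f x) (@?g x)) => apply: (computable_eqn (f := f) (g := g))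
  | |- computable _ (fun x => leq (@?f x) (@?g x)) => apply: (computable_leq (f := f) (g := g))
  | |- computable _ (fun x => addn (@?f x) (@?g x)) => apply: (computable_add (f := f) (g := g))
  | |- computable _ (fun x => muln (@?f x) (@?g x)) => apply: (computable_mul (f := f) (g := g))
  | |- computable _ (fun x => subn (@?f x) (@?g x)) => apply: (computable_sub (f := f) (g := g))
  | |- computable _ (fun x => (@?f x).+1) => apply: (computable_succ (f := f))
  | |- computable _ (fun x => (@?f x).-1) => apply: (computable_pred (f := f))
  | |- computable _ (fun x => odd (@?f x)) => apply: (computable_odd (f := f))
  | |- computable _ (fun x => half (@?f x)) => apply: (computable_half (f := f))
  | |- computable _ (fun x => @?f x :: @?g x) => apply: (computable_cons (f := f) (g := g))
  | |- computable _ (fun x => behead (@?f x)) => apply: (computable_behead (f := f))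
  | |- computable _ (fun x => CodeSeq.decode (@?f x)) => apply: (computable_decode (f := f))
  | |- computable _ (fun x => asbool (_ (@?f x))) => apply: (computable_oracle (f := f))
  | |- computable _ (fun x => if _ then _ else _) => apply: computable_if
  | |- computable _ (fun x => nat_rect _ (@?z x) (@?g x) (@?n x)) => apply: (computable_nat_rect (z := z) (g := g) (n := n))
  | |- computable _ (fun x => foldr (@?g x) (@?z x) (@?l x)) => apply: (computable_foldr (z := z) (g := g) (l := l))
  end ]; cbv beta.
Ltac computability := repeat computable_step.

Section MoreListFunctions.
Context {B : set nat} {T U A : Type} {cT : Code T} {cU : Code U} {cA : Code A}.

Lemma computable_map (g : T -> A -> U) (l : T -> seq A) :
  computable B (fun p : T * A => g p.1 p.2) -> computable B l ->
  computable B (fun x => map (g x) (l x)).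
Proof.
move=> hg hl; apply: (computable_ext (f := fun x => foldr (fun a r => g x a :: r) [::] (l x))).
  by move=> x; elim: (l x) => //= a s ->.
computability.
Qed.

Lemma computable_cat (f g : T -> seq A) : computable B f -> computable B g -> computable B (fun x => f x ++ g x).
Proof.
move=> hf hg; apply: (computable_ext (f := fun x => foldr cons (g x) (f x))) => [x|].
  by elim: (f x) => //= a s ->.
computability.
Qed.
End MoreListFunctions.

Ltac computable_list_step ::= lazymatch goal with
  | |- computable _ (fun x => map (@?g x) (@?l x)) => apply: (computable_map (g := g) (l := l))
  | |- computable _ (fun x => @?f x ++ @?g x) => apply: (computable_cat (f := f) (g := g))
  end.

Section DerivedListFunctions.
Context {B : set nat} {T U A : Type} {cT : Code T} {cU : Code U} {cA : Code A}.

Lemma computable_flatten (l : T -> seq (seq A)) : computable B l -> computable B (fun x => flatten (l x)).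
Proof.
move=> hl; apply: (computable_ext (f := fun x => foldr cat [::] (l x))) => //.
apply: (computable_foldr (g := fun _ => cat)); computability.
Qed.

Lemma computable_all (g : T -> A -> bool) (l : T -> seq A) :
  computable B (fun p : T * A => g p.1 p.2) -> computable B l -> computable B (fun x => all (g x) (l x)).
Proof.
move=> hg hl; apply: (computable_ext (f := fun x => foldr (fun a r => g x a && r) true (l x))).
  by move=> x; elim: (l x) => //= a s ->.
computability.
Qed.

Lemma computable_has (g : T -> A -> bool) (l : T -> seq A) :
  computable B (fun p : T * A => g p.1 p.2) -> computable B l -> computable B (fun x => has (g x) (l x)).
Proof.
move=> hg hl; apply: (computable_ext (f := fun x => foldr (fun a r => g x a || r) false (l x))).
  by move=> x; elim: (l x) => //= a s ->.
computability.
Qed.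

Lemma computable_filter (g : T -> A -> bool) (l : T -> seq A) :
  computable B (fun p : T * A => g p.1 p.2) -> computable B l -> computable B (fun x => seq.filter (g x) (l x)).
Proof.
move=> hg hl; apply: (computable_ext (f := fun x => foldr (fun a r => if g x a then a :: r else r) [::] (l x))).
  by move=> x; elim: (l x) => //= a s ->.
computability.
Qed.

Lemma computable_size (l : T -> seq A) : computable B l -> computable B (fun x => size (l x)).
Proof.
move=> hl; apply: (computable_ext (f := fun x => foldr (fun _ r => r.+1) 0 (l x))).
  by move=> x; elim: (l x) => //= a s ->.
computability.
Qed.

Lemma computable_count (g : T -> A -> bool) (l : T -> seq A) :
  computable B (fun p : T * A => g p.1 p.2) -> computable B l -> computable B (fun x => count (g x) (l x)).
Proof.
move=> hg hl; apply: (computable_ext (f := fun x => foldr (fun a r => g x a + r) 0 (l x))).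
  by move=> x; elim: (l x) => //= a s ->.
computability.
Qed.

Lemma computable_nth (d : A) (l : T -> seq A) (i : T -> nat) : computable B l -> computable B i ->
  computable B (fun x => nth d (l x) (i x)).
Proof.
move=> hl hi; apply: (computable_ext
  (f := fun x => foldr (fun a _ => a) d (nat_rect (fun=> seq A) (l x) (fun _ r => behead r) (i x)))).
  move=> x; have -> : nat_rect (fun=> seq A) (l x) (fun _ r => behead r) (i x) = drop (i x) (l x).
    by elim: (i x) => [|j IH] /=; [rewrite drop0|rewrite IH -drop1 drop_drop add1n].
  rewrite -[i x in RHS]addn0 -nth_drop nth0; by case: (drop _ _).
computability.
Qed.

Lemma computable_nseq (n : T -> nat) (f : T -> A) : computable B n -> computable B f ->
  computable B (fun x => nseq (n x) (f x)).
Proof.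
move=> hn hf; apply: (computable_ext (f := fun x => nat_rect (fun=> seq A) [::] (fun _ r => f x :: r) (n x))).
  by move=> x; elim: (n x) => //= j ->.
computability.
Qed.

Lemma computable_iota (m n : T -> nat) : computable B m -> computable B n ->
  computable B (fun x => iota (m x) (n x)).
Proof.
move=> hm hn; apply: (computable_ext (f := fun x => nat_rect (fun=> seq nat) [::] (fun i r => r ++ [:: m x + i]) (n x))).
  by move=> x; elim: (n x) => // j IH; rewrite -[in RHS](addn1 j) iotaD -IH.
computability.
Qed.

Lemma computable_prod (l : T -> seq nat) : computable B l -> computable B (fun x => \prod_(p <- l x) p).
Proof.
move=> hl; apply: (computable_ext (f := fun x => foldr (fun a r => a * r) 1 (l x))).
  by move=> x; elim: (l x) => [|a s /= ->]; rewrite ?big_nil ?big_cons.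
computability.
Qed.

End DerivedListFunctions.
Ltac computable_list_step ::= lazymatch goal with
  | |- computable _ (fun x => map (@?g x) (@?l x)) => apply: (computable_map (g := g) (l := l))
  | |- computable _ (fun x => @?f x ++ @?g x) => apply: (computable_cat (f := f) (g := g))
  | |- computable _ (fun x => flatten (@?l x)) => apply: (computable_flatten (l := l))
  | |- computable _ (fun x => all (@?g x) (@?l x)) => apply: (computable_all (g := g) (l := l))
  | |- computable _ (fun x => has (@?g x) (@?l x)) => apply: (computable_has (g := g) (l := l))
  | |- computable _ (fun x => seq.filter (@?g x) (@?l x)) => apply: (computable_filter (g := g) (l := l))
  | |- computable _ (fun x => count (@?g x) (@?l x)) => apply: (computable_count (g := g) (l := l))
  | |- computable _ (fun x => size (@?l x)) => apply: (computable_size (l := l))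
  | |- computable _ (fun x => nth ?d (@?l x) (@?i x)) => apply: (computable_nth d (l := l) (i := i))
  | |- computable _ (fun x => nseq (@?n x) (@?f x)) => apply: (computable_nseq (n := n) (f := f))
  | |- computable _ (fun x => iota (@?m x) (@?n x)) => apply: (computable_iota (m := m) (n := n))
  | |- computable _ (fun x => \prod_(p <- @?l x) p) => apply: (computable_prod (l := l))
  end.

Section Arithmetic.
Context {B : set nat} {T : Type} {cT : Code T}.
Implicit Types f g : T -> nat.

Lemma computable_dvdn f g : computable B f -> computable B g -> computable B (fun x => f x %| g x).
Proof.
move=> hf hg; apply: (computable_ext (f := fun x => has (fun q => q * f x == g x) (iota 0 (g x).+1))).
  move=> x; apply/hasP/dvdnP => [[q _ /eqP <-]|[q e]]; first by exists q.
  have [f0|f0] := posnP (f x).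
    by exists 0; rewrite ?e ?f0 ?muln0 // mem_iota.
  by exists q; rewrite ?e // mem_iota /= add0n ltnS leq_pmulr.
computability.
Qed.

End Arithmetic.
Ltac computable_extra_step ::= lazymatch goal with
  | |- computable _ (fun x => @?f x %| @?g x) => apply: (computable_dvdn (f := f) (g := g))
  end.

Lemma computable_prime (B : set nat) (T : Type) (cT : Code T) (f : T -> nat) :
  computable B f -> computable B (fun x => prime (f x)).
Proof.
move=> hf; apply: (computable_ext (f := fun x => (1 < f x) && all (fun d => ~~ (d %| f x)) (iota 2 (f x - 2)))).
  move=> x; apply/idP/idP => [/andP[f1 /allP h]|pf].
    apply/primeP; split=> // d df; apply: contraT; rewrite negb_or => /andP[d1 dn].
    have d0 : 0 < d by apply: dvdn_gt0 df; apply: ltnW.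
    have := h d; rewrite df mem_iota; have := dvdn_leq (ltnW f1) df; move: f1 d1 dn d0; clear; lia.
  rewrite prime_gt1 //=; apply/allP => d; rewrite mem_iota => hd; apply/negP => /(prime_nt_dvdP pf).
  by move=> h; have := h _; move: hd (prime_gt1 pf); clear; lia.
computability.
Qed.

(* The only natural number that does not code an element of [nat * seq nat] is [0]. *)
Lemma computable_search_pair (B : set nat) (P : nat * seq nat -> nat -> bool) (H : forall x, exists n, P x n) :
  computable B (fun p : (nat * seq nat) * nat => P p.1 p.2) -> computable B (fun x => ex_minn (H x)).
Proof.
move=> hP; apply: (computable_search (junk := fun z => z == 0)) hP.
- exact: rec1_comp2 (rec2_eqn B) (rec1_id B) (rec1_const B 0).
- by move=> x; rewrite /enc /code_prod muln_eq0 expn_eq0.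
move=> z; have := CodeSeq.decodeK z; case: (CodeSeq.decode z) => [|a s] e; first by left; rewrite -e.
right; exists (a, s); by rewrite -e /enc /code_prod /= {2}/enc /code_seq map_id.
Qed.

Ltac computable_extra_step ::= lazymatch goal with
  | |- computable _ (fun x => @?f x %| @?g x) => apply: (computable_dvdn (f := f) (g := g))
  | |- computable _ (fun x => prime (@?f x)) => apply: (computable_prime (f := f))
  end.

(** * Polynomials as lists of terms *)

(** A term is a coefficient, as a difference of two natural numbers, and a word of variables. This
    avoids signed arithmetic in the recursive functions, and nothing needs to be normalised. *)
Notation term := ((nat * nat) * seq nat)%type.

Section Polynomials.
Implicit Types (v : nat -> rat) (t u : term) (l : seq term).

Definition eval_term v t : rat := ((t.1.1%:R - t.1.2%:R) * \prod_(j <- t.2) v j)%R.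
Definition eval v l : rat := (\sum_(t <- l) eval_term v t)%R.

Definition mul_term t u : term :=
  ((t.1.1 * u.1.1 + t.1.2 * u.1.2, t.1.1 * u.1.2 + t.1.2 * u.1.1), t.2 ++ u.2).
Definition square l : seq term := flatten (map (fun t => map (fun u => mul_term t u) l) l).
Definition sum_squares (ls : seq (seq term)) : seq term := flatten (map square ls).

Lemma eval_mul_term v t u : eval_term v (mul_term t u) = (eval_term v t * eval_term v u)%R.
Proof. by rewrite /eval_term /= big_cat /= !natrD !natrM; ring. Qed.

Lemma eval_square v l : eval v (square l) = (eval v l ^+ 2)%R.
Proof.
rewrite /eval /square big_flatten big_map expr2 mulr_suml; apply: eq_bigr => t _.
by rewrite big_map mulr_sumr; apply: eq_bigr => u _; exact: eval_mul_term.
Qed.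

(** Squares of rationals are nonnegative, so a system of equations becomes a single one, as the
    oracle requires. *)
Lemma eval_sum_squares v ls : eval v (sum_squares ls) = 0%R <-> forall l, l \in ls -> eval v l = 0%R.
Proof.
have -> : eval v (sum_squares ls) = (\sum_(l <- ls) eval v l ^+ 2)%R.
  by rewrite [LHS]big_flatten big_map; apply: eq_bigr => l _; exact: eval_square.
split=> [/eqP|h]; last by rewrite big1_seq // => l /= /h ->; rewrite expr0n.
rewrite psumr_eq0 => [/allP h l /h|l _]; last exact: sqr_ge0.
by rewrite /= sqrf_eq0 => /eqP.
Qed.

Definition word n (e : nat -> nat) : seq nat := flatten (map (fun j => nseq (e j) j) (iota 0 n)).
Definition coef_of_code c : nat * nat := if odd c then (0, c./2.+1) else (c./2, 0).
Definition term_of_code n m : term :=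
  (coef_of_code (nth 0 (CodeSeq.decode m) 0), word n (nth 0 (behead (CodeSeq.decode m)))).
Definition poly_terms k : seq term :=
  map (term_of_code (nth 0 (CodeSeq.decode k) 0)) (behead (CodeSeq.decode k)).

Definition code_coef (c : nat * nat) : nat :=
  if c.2 <= c.1 then 2 * (c.1 - c.2) else (2 * (c.2 - c.1).-1).+1.
Definition code_term n t : nat :=
  CodeSeq.code (code_coef t.1 :: map (fun j => count (fun i => i == j) t.2) (iota 0 n)).
Definition code_poly n l : nat := CodeSeq.code (n :: map (code_term n) l).

Lemma prod_word v n e : (\prod_(j <- word n e) v j = \prod_(j < n) v j ^+ e j)%R.
Proof.
rewrite big_flatten big_map /= -(big_mkord xpredT (fun j => v j ^+ e j)%R) /index_iota subn0.
apply: eq_bigr => j _; elim: (e j) => [|k IH]; first by rewrite big_nil.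
by rewrite /= big_cons IH exprS.
Qed.

Lemma prod_count v n w : all (fun j => j < n) w ->
  (\prod_(j <- w) v j = \prod_(j < n) v j ^+ count (fun i => i == j :> nat) w)%R.
Proof.
elim: w => [|a w IH] /=; first by rewrite big_nil big1.
case/andP=> an /IH e; rewrite big_cons e (bigD1 (Ordinal an)) //= [RHS](bigD1 (Ordinal an)) //=.
rewrite eqxx exprS mulrA; congr (_ * _)%R; apply: eq_bigr => i /negPf hi.
by rewrite eq_sym -val_eqE in hi; rewrite /= in hi; rewrite hi.
Qed.

(** Coding and decoding cancels within coefficients and sorts words, so the term list may change;
    its value does not. *)
Lemma eval_code_poly v n l : (forall t, t \in l -> all (fun j => j < n) t.2) ->
  eval v (poly_terms (code_poly n l)) = eval v l.
Proof.
move=> hl; rewrite /eval /poly_terms CodeSeq.codeK /= -map_comp big_map.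
apply: eq_big_seq => t /hl ht; rewrite /eval_term /= CodeSeq.codeK /=; congr (_ * _)%R.
  rewrite /code_coef /coef_of_code; case: t.1 => a b /=; case: leqP => ab /=.
    by rewrite mul2n odd_double doubleK subr0 natrB.
  rewrite mul2n odd_double /= uphalf_double prednK ?subn_gt0 // natrB; last exact: ltnW.
  by rewrite sub0r opprB.
rewrite prod_word [RHS](prod_count _ ht); apply: eq_bigr => j _; congr (_ ^+ _)%R.
by rewrite (nth_map 0) ?size_iota // nth_iota.
Qed.

Lemma nvars_code_poly n l : poly_nvars (code_poly n l) = n.
Proof. by rewrite /poly_nvars CodeSeq.codeK. Qed.

Lemma HTP_eval (S : set rat) k : HTP S k <->
  exists v, (forall j, j < poly_nvars k -> S (v j)) /\ eval v (poly_terms k) = 0%R.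
Proof.
have e v : meval (fun i : 'I_(poly_nvars k) => v i) (map_mpoly intr (poly_of_code k)) = eval v (poly_terms k).
  rewrite /poly_of_code [map_mpoly _ _]rmorph_sum rmorph_sum /= /eval /poly_terms big_map; apply: eq_bigr => m _.
  rewrite /monomial_of_code /eval_term map_mpolyZ mevalZ map_mpolyX mevalX; congr (_ * _)%R.
    rewrite /= /coef_of_code /int_of_code nth0; case: odd => /=; last by rewrite subr0.
    by rewrite NegzE sub0r rmorphN.
  by rewrite prod_word [nth 0 _ 0]nth0; apply: eq_bigr => i _; rewrite mnmE.
split=> [[v hv ev]|[v [hv ev]]].
  exists (fun j => if insub j is Some i then v i else 0%R); split.
    by move=> j jn; rewrite insubT.
  rewrite -e -[RHS]ev; congr meval; apply/funext => i; by rewrite valK.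
by exists (fun i => v i) => [i|]; [exact: hv|rewrite e].
Qed.
End Polynomials.

Section PolynomialSyntax.
Implicit Types (v : nat -> rat) (p q : seq term).

Definition pvar j : seq term := [:: ((1, 0), [:: j])].
Definition pnat a : seq term := [:: ((a, 0), [::])].
Definition popp p : seq term := map (fun t : term => ((t.1.2, t.1.1), t.2)) p.
Definition pmul p q : seq term := flatten (map (fun t => map (fun u => mul_term t u) q) p).
Definition bounded n p := all (fun t : term => all (fun j => j < n) t.2) p.

Lemma eval_pvar v j : eval v (pvar j) = v j.
Proof. by rewrite /eval big_seq1 /eval_term /= big_seq1; ring. Qed.

Lemma eval_pnat v a : eval v (pnat a) = (a%:R)%R.
Proof. by rewrite /eval big_seq1 /eval_term /= big_nil; ring. Qed.

Lemma eval_cat v p q : eval v (p ++ q) = (eval v p + eval v q)%R.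
Proof. by rewrite /eval big_cat. Qed.

Lemma eval_popp v p : eval v (popp p) = (- eval v p)%R.
Proof. by rewrite /eval big_map -sumrN; apply: eq_bigr => t _; rewrite /eval_term /=; ring. Qed.

Lemma eval_pmul v p q : eval v (pmul p q) = (eval v p * eval v q)%R.
Proof.
rewrite /eval /pmul big_flatten big_map mulr_suml; apply: eq_bigr => t _.
by rewrite big_map mulr_sumr; apply: eq_bigr => u _; exact: eval_mul_term.
Qed.

Definition eval_syntax := (eval_cat, eval_pmul, eval_popp, eval_pvar, eval_pnat).

Lemma bounded_pmul n p q : bounded n p -> bounded n q -> bounded n (pmul p q).
Proof.
move=> /allP hp /allP hq; apply/allP => t /flattenP[s /mapP[a ap ->] /mapP[b bq ->]].
by rewrite all_cat hp ?hq.
Qed.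

Lemma bounded_sum_squares n ls : all (bounded n) ls -> bounded n (sum_squares ls).
Proof.
move=> /allP h; apply/allP => t /flattenP[s /mapP[l lls ->]] ht.
by have /allP := bounded_pmul (h _ lls) (h _ lls); apply.
Qed.

Lemma bounded_poly_terms k : bounded (poly_nvars k) (poly_terms k).
Proof.
apply/allP => t /mapP[m _ ->] /=; apply/allP => j /flattenP[s /mapP[i]].
by rewrite mem_iota nth0 => hi -> /nseqP[-> _].
Qed.

End PolynomialSyntax.

Section Query.
Variables (N0 N c : nat).

Definition pform x y := pmul x x ++ pmul x y ++ pmul (pnat c) (pmul y y).

(* The witnesses [e1], [e2], [X], [w], [Y], [Z] of [int_cert N c (v t)] are the variables from [b] on. *)
Definition cert_eqs t b : seq (seq term) :=
  let x j := pvar (b + j) in let k := pnat (4 * c).-1 in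
  [:: pmul (x 0) (x 0) ++ popp (x 0);
      pmul (x 1) (x 1) ++ popp (x 1);
      pmul k (pvar t ++ popp (x 0) ++ popp (pmul (pnat 2) (x 1))) ++ popp (pmul (pnat 2) (x 2) ++ x 3);
      pnat 1 ++ pmul (pnat N) (pform (x 2) (x 3)) ++ popp (pform (x 4) (x 5))].

(* The variable [i] is certified to lie in [Zloc N0] by the 14 variables from [b] on. *)
Definition loc_eqs i b : seq (seq term) :=
  (pmul (pvar i) (pnat 1 ++ pmul (pnat N0) (pvar b)) ++ popp (pvar b.+1)) ::
  cert_eqs b (b + 2) ++ cert_eqs b.+1 (b + 8).

(** Each of the [n] original variables owns a block of 14 new ones: [s], [y], and six witnesses for
    each of their two certificates. This makes [15 * n] variables. *)
Definition query_eqs k : seq (seq term) :=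
  let n := nth 0 (CodeSeq.decode k) 0 in
  poly_terms k :: flatten (map (fun i => loc_eqs i (n + 14 * i)) (iota 0 n)).

Definition query k : nat := code_poly (15 * nth 0 (CodeSeq.decode k) 0) (sum_squares (query_eqs k)).

Definition solves (v : nat -> rat) (ls : seq (seq term)) := forall l, l \in ls -> eval v l = 0%R.

Lemma solves_cons v l ls : solves v (l :: ls) <-> eval v l = 0%R /\ solves v ls.
Proof.
split=> [h|[h1 h2] x]; last by rewrite inE => /predU1P[->|/h2].
by split=> [|x xl]; apply: h; rewrite inE ?eqxx ?xl ?orbT.
Qed.

Lemma solves_cat v l1 l2 : solves v (l1 ++ l2) <-> solves v l1 /\ solves v l2.
Proof.
split=> [h|[h1 h2] x]; last by rewrite mem_cat => /orP[/h1|/h2].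
by split=> x xl; apply: h; rewrite mem_cat xl ?orbT.
Qed.

Lemma solves_nil v : solves v [::] <-> True.
Proof. by split. Qed.

Definition cert_sol (tau : rat) (f : nat -> rat) : Prop :=
  [/\ (f 0 ^+ 2 = f 0)%R, (f 1%N ^+ 2 = f 1%N)%R,
      ((4 * c).-1%:R * (tau - f 0 - 2 * f 1%N) = 2 * f 2%N + f 3%N)%R
    & (1 + N%:R * (f 2%N ^+ 2 + f 2%N * f 3%N + c%:R * f 3%N ^+ 2)
       = f 4%N ^+ 2 + f 4%N * f 5%N + c%:R * f 5%N ^+ 2)%R].

Lemma cert_eqsP v t b : solves v (cert_eqs t b) <-> cert_sol (v t) (fun j => v (b + j)).
Proof.
rewrite /cert_eqs /cert_sol !solves_cons solves_nil /pform !eval_syntax.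
split=> [[h1 [h2 [h3 [h4 _]]]]|[h1 h2 h3 h4]].
  by split; apply/eqP; rewrite -subr_eq0; apply/eqP; [rewrite -h1|rewrite -h2|rewrite -h3|rewrite -h4]; ring.
by do ![split]; [move/eqP: h1|move/eqP: h2|move/eqP: h3|move/eqP: h4]; rewrite -subr_eq0 => /eqP <-; ring.
Qed.

Lemma cert_sol_ext tau f g : (forall j, j < 6 -> f j = g j) -> cert_sol tau f -> cert_sol tau g.
Proof. by move=> fg [h1 h2 h3 h4]; split; rewrite -!fg. Qed.

Lemma int_certE tau : int_cert N c tau <-> exists f, cert_sol tau f.
Proof.
split=> [[e1 [e2 [X [w [Y [Z [h1 h2 h3 h4]]]]]]]|[f [h1 h2 h3 h4]]].
  by exists (nth 0%R [:: e1; e2; X; w; Y; Z]).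
by exists (f 0), (f 1%N), (f 2%N), (f 3%N), (f 4%N), (f 5%N).
Qed.

Lemma loc_eqsP v i b : solves v (loc_eqs i b) <->
  [/\ (v i * (1 + N0%:R * v b) = v b.+1)%R, cert_sol (v b) (fun j => v (b + 2 + j))
    & cert_sol (v b.+1) (fun j => v (b + 8 + j))].
Proof.
rewrite /loc_eqs solves_cons solves_cat !cert_eqsP !eval_syntax.
split=> [[/eqP h1 [h2 h3]]|[h1 h2 h3]]; split=> //.
  by apply/eqP; rewrite -subr_eq0.
by rewrite h1 subrr.
Qed.

Lemma loc_sol (R : realType) q : good_params N0 N c -> Zloc N0 q <->
  exists f, [/\ (q * (1 + N0%:R * f 0) = f 1%N)%R, cert_sol (f 0) (fun j => f (2 + j))
    & cert_sol (f 1%N) (fun j => f (8 + j))].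
Proof.
move=> hg; rewrite (Zloc_certificate R q hg); split=> [[s [y [h1 /int_certE[f hf] /int_certE[g hg']]]]|[f [h1 h2 h3]]].
  exists (fun j => if j is 0 then s else if j is 1 then y else if j < 8 then f (j - 2) else g (j - 8)).
  by split.
by exists (f 0), (f 1%N); split=> //; apply/int_certE; [exists (fun j => f (2 + j))|exists (fun j => f (8 + j))].
Qed.

Lemma bounded_cert_eqs n t b : t < n -> b + 6 <= n -> all (bounded n) (cert_eqs t b).
Proof.
move=> tn bn; have hb j : j < 6 -> b + j < n by move=> j6; apply: leq_trans bn; rewrite -addnS leq_add2l.
by rewrite /= /bounded /= tn !hb.
Qed.

Lemma bounded_query_eqs k : all (bounded (15 * nth 0 (CodeSeq.decode k) 0)) (query_eqs k).
Proof.
rewrite /query_eqs; set n := nth 0 _ 0; rewrite /= andbC; apply/andP; split.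
  apply/allP => l /flattenP[ls /mapP[i]]; rewrite mem_iota => /andP[_ hi] ->; rewrite add0n in hi.
  move: l; apply/allP; rewrite /loc_eqs -cat1s !all_cat !bounded_cert_eqs; try by move: hi; clear; lia.
  by rewrite /= /bounded /= !andbT; move: hi; clear; lia.
have := bounded_poly_terms k; rewrite /poly_nvars -nth0 -/n; apply: sub_all => t; apply: sub_all => j.
by clear; lia.
Qed.

(** The many-one reduction behind the whole construction; [query] is computable in all its
    arguments, hence uniform in the finite set of primes. *)
Lemma HTP_query (R : realType) k : good_params N0 N c ->
  HTP [set: rat] (query k) <-> HTP [set q | Zloc N0 q] k.
Proof.
move=> hg; rewrite !HTP_eval /query nvars_code_poly.
set n := nth 0 _ 0; have -> : poly_nvars k = n by rewrite /poly_nvars -nth0.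
have evq v : eval v (poly_terms (code_poly (15 * n) (sum_squares (query_eqs k)))) = 0%R <->
    eval v (poly_terms k) = 0%R /\ forall i, i < n -> solves v (loc_eqs i (n + 14 * i)).
  rewrite eval_code_poly => [|t tq]; last first.
    by have /allP := bounded_sum_squares (bounded_query_eqs k); apply.
  rewrite eval_sum_squares; apply: (iff_trans (solves_cons _ _ _)); split=> -[h1 h2]; split=> //.
    move=> i hi l hl; apply: h2; apply/flattenP; exists (loc_eqs i (n + 14 * i)) => //.
    by apply: map_f; rewrite mem_iota.
  by move=> l /flattenP[s /mapP[i]]; rewrite mem_iota => /andP[_ hi] -> ; exact: h2.
split=> [[v [_ /evq[e h]]]|[v [hv e]]].
  exists v; split=> // i /h /loc_eqsP[h1 h2 h3]; apply/(loc_sol R _ hg).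
  exists (fun j => v (n + 14 * i + j)); split; rewrite ?addn0 ?addn1 //.
    by apply: cert_sol_ext h2 => j _; rewrite addnA.
  by apply: cert_sol_ext h3 => j _; rewrite addnA.
have /choice[F hF] i : exists f, i < n -> [/\ (v i * (1 + N0%:R * f 0) = f 1%N)%R, cert_sol (f 0) (fun j => f (2 + j))
    & cert_sol (f 1%N) (fun j => f (8 + j))].
  have [hi|] := ltnP i n; last by exists v.
  by have /(loc_sol R _ hg)[f hf] := hv _ hi; exists f.
(* The original values and the chosen witnesses, one block of 14 per variable, are glued into one
   valuation. *)
pose w idx := if idx < n then v idx else F ((idx - n) %/ 14) ((idx - n) %% 14).
have wv i : i < n -> w i = v i by rewrite /w => ->.
have wF i j : j < 14 -> w (n + 14 * i + j) = F i j.
  move=> j14; rewrite /w -addnA ltnNge leq_addr /= addnC addnK mulnC divnMDl // modnMDl.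
  by rewrite divn_small // modn_small // addn0.
exists w; split=> //; apply/evq; split=> [|i hi].
  rewrite -[RHS]e; apply: eq_big_seq => t /(allP (bounded_poly_terms k)).
  rewrite /poly_nvars -nth0 -/n => /allP ht; congr (_ * _)%R.
  by apply: eq_big_seq => j /ht; exact: wv.
have [h1 h2 h3] := hF i hi.
have w0 : w (n + 14 * i) = F i 0 by rewrite -[n + 14 * i]addn0 wF.
have w1 : w (n + 14 * i).+1 = F i 1 by rewrite -addn1 wF.
apply/loc_eqsP; rewrite wv // w0 w1; split=> //.
  by apply: cert_sol_ext h2 => j j6; rewrite -addnA wF //; move: j6; clear; lia.
by apply: cert_sol_ext h3 => j j6; rewrite -addnA wF //; move: j6; clear; lia.
Qed.

End Query.

Section ComputablePolynomials.
Context {B : set nat} {T : Type} {cT : Code T}.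
Implicit Types (f g k n : T -> nat) (p q : T -> seq term).

Lemma computable_code (s : T -> seq nat) : computable B s -> computable B (fun x => CodeSeq.code (s x)).
Proof. by case=> g rg eg; exists g => // x; rewrite eg /enc /code_seq map_id. Qed.

Lemma computable_pvar f : computable B f -> computable B (fun x => pvar (f x)).
Proof. by move=> hf; rewrite /pvar; computability. Qed.

Lemma computable_pnat f : computable B f -> computable B (fun x => pnat (f x)).
Proof. by move=> hf; rewrite /pnat; computability. Qed.

Lemma computable_popp p : computable B p -> computable B (fun x => popp (p x)).
Proof. by move=> hp; rewrite /popp; computability. Qed.

Lemma computable_pmul p q : computable B p -> computable B q -> computable B (fun x => pmul (p x) (q x)).
Proof. by move=> hp hq; rewrite /pmul /mul_term; computability. Qed.

Lemma computable_poly_terms k : computable B k -> computable B (fun x => poly_terms (k x)).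
Proof.
by move=> hk; rewrite /poly_terms /term_of_code /coef_of_code /word; computability.
Qed.
End ComputablePolynomials.

Lemma computable_code_poly (B : set nat) (T : Type) (cT : Code T) (n : T -> nat) (p : T -> seq term) :
  computable B n -> computable B p -> computable B (fun x => code_poly (n x) (p x)).
Proof.
move=> hn hp; rewrite /code_poly; apply: computable_code; computability.
by apply: computable_code; rewrite /code_coef; computability.
Qed.

Lemma computable_sum_squares (B : set nat) (T : Type) (cT : Code T) (ls : T -> seq (seq term)) :
  computable B ls -> computable B (fun x => sum_squares (ls x)).
Proof.
move=> hl; rewrite /sum_squares; computability.
by apply: (computable_pmul (p := snd) (q := snd)); computability.
Qed.

Ltac computable_extra_step ::= lazymatch goal with
  | |- computable _ (fun x => @?f x %| @?g x) => apply: (computable_dvdn (f := f) (g := g))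
  | |- computable _ (fun x => pvar (@?f x)) => apply: (computable_pvar (f := f))
  | |- computable _ (fun x => pnat (@?f x)) => apply: (computable_pnat (f := f))
  | |- computable _ (fun x => popp (@?f x)) => apply: (computable_popp (p := f))
  | |- computable _ (fun x => pmul (@?f x) (@?g x)) => apply: (computable_pmul (p := f) (q := g))
  | |- computable _ (fun x => poly_terms (@?f x)) => apply: (computable_poly_terms (k := f))
  | |- computable _ (fun x => code_poly (@?f x) (@?g x)) => apply: (computable_code_poly (n := f) (p := g))
  | |- computable _ (fun x => sum_squares (@?f x)) => apply: (computable_sum_squares (ls := f))
  end.

Lemma computable_query (B : set nat) (T : Type) (cT : Code T) (N0 N c k : T -> nat) :
  computable B N0 -> computable B N -> computable B c -> computable B k ->
  computable B (fun x => query (N0 x) (N x) (c x) (k x)).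
Proof.
move=> hN0 hN hc hk; rewrite /query /query_eqs /loc_eqs /cert_eqs /pform; cbv zeta.
computability.
Qed.

(** * Candidate solutions *)

Section Candidates.
Implicit Types (k z i : nat) (ps : seq nat).

(* A candidate solution [z] codes a list of codes of lists [:: a; b; d], read as the rational numbers
   [(a - b) / d]. *)
Definition entry z i r := nth 0 (CodeSeq.decode (nth 0 (CodeSeq.decode z) i)) r.

Definition cand z i : rat := (((entry z i 0)%:R - (entry z i 1)%:R) / (entry z i 2)%:R)%R.

(** Rational arithmetic need not be programmed: the equations [d * x_i = a - b] pin each variable to
    its candidate value, and the oracle tells whether the system has a zero. *)
Definition cand_query k z : nat :=
  let n := nth 0 (CodeSeq.decode k) 0 in
  code_poly n (sum_squares (poly_terms k ::
    map (fun i => pmul (pnat (entry z i 2)) (pvar i) ++ popp (pnat (entry z i 0)) ++ pnat (entry z i 1))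
        (iota 0 n))).

Definition cand_ok ps k z : bool :=
  all (fun i => (0 < entry z i 2) && all (fun p => ~~ (p %| entry z i 2)) ps)
      (iota 0 (nth 0 (CodeSeq.decode k) 0)) && `[< HTP [set: rat] (cand_query k z) >].

Lemma HTP_cand_query k z : (forall i, i < poly_nvars k -> 0 < entry z i 2) ->
  HTP [set: rat] (cand_query k z) <-> eval (cand z) (poly_terms k) = 0%R.
Proof.
move=> dpos; rewrite HTP_eval /cand_query nvars_code_poly -/(solves _ _).
set n := nth 0 _ 0; have en : poly_nvars k = n by rewrite /poly_nvars -nth0.
set eqs := map _ _.
have bq : all (bounded n) (poly_terms k :: eqs).
  rewrite /= -en bounded_poly_terms en /=; apply/allP => l /mapP[i]; rewrite mem_iota => /andP[_ hi] ->.
  by rewrite /= !andbT.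
have e v : eval v (poly_terms (code_poly n (sum_squares (poly_terms k :: eqs)))) = 0%R <->
    eval v (poly_terms k) = 0%R /\ forall i, i < n -> v i = cand z i.
  rewrite eval_code_poly => [|t tq]; last by have /allP := bounded_sum_squares bq; apply.
  rewrite eval_sum_squares; apply: (iff_trans (solves_cons _ _ _)).
  have ev i : eval v (pmul (pnat (entry z i 2)) (pvar i) ++ popp (pnat (entry z i 0)) ++ pnat (entry z i 1)) =
      ((entry z i 2)%:R * v i - (entry z i 0)%:R + (entry z i 1)%:R)%R.
    by rewrite !eval_syntax addrA.
  split=> -[h1 h2]; split=> //.
    move=> i hi; have d0 : ((entry z i 2)%:R != 0 :> rat)%R.
      by rewrite pnatr_eq0 -lt0n dpos // en.
    have := h2 _ (map_f _ (_ : i \in iota 0 n)); rewrite mem_iota => /(_ hi); rewrite ev => h.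
    by rewrite /cand; apply: (canRL (mulfK d0)); rewrite mulrC; apply/eqP; rewrite -subr_eq0 -[X in _ == X]h; apply/eqP; ring.
  move=> l /mapP[i]; rewrite mem_iota => /andP[_ hi] ->; rewrite ev h2 // /cand.
  have d0 : ((entry z i 2)%:R != 0 :> rat)%R by rewrite pnatr_eq0 -lt0n dpos // en.
  by field.
split=> [[v [_ /e[<- h]]]|h].
  apply: eq_big_seq => t /(allP (bounded_poly_terms k)); rewrite en => /allP ht; congr (_ * _)%R.
  by apply: eq_big_seq => j /ht /h ->.
by exists (cand z); split=> //; apply/e.
Qed.

Lemma cand_exists ps k : all prime ps -> HTP [set q | Zloc (\prod_(p <- ps) p) q] k ->
  exists z, cand_ok ps k z.
Proof.
move=> pps /HTP_eval[v [hv e]]; set n := nth 0 (CodeSeq.decode k) 0.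
have en : poly_nvars k = n by rewrite /poly_nvars -nth0.
have /choice[F hF] i : exists s : seq nat, i < n -> [/\ 0 < nth 0 s 2, all (fun p => ~~ (p %| nth 0 s 2)) ps
    & v i = (((nth 0 s 0)%:R - (nth 0 s 1)%:R) / (nth 0 s 2)%:R)%R].
  have [hi|] := ltnP i n; last by exists [::].
  have [|a [b [b0 cb ->]]] := hv i; first by rewrite en.
  exists [:: (if a is Posz a' then a' else 0); (if a is Negz a' then a'.+1 else 0); b] => _ /=; split=> //.
    apply/allP => p pin; apply/negP => pb; have pp := allP pps _ pin.
    have : p %| gcdn b (\prod_(p <- ps) p) by rewrite dvdn_gcd pb (big_rem p) //= dvdn_mulr.
    by move/eqP: cb => ->; rewrite dvdn1; case: (p) pp => [|[]].
  congr (_ / _)%R; case: a => a' /=; first by rewrite subr0.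
  by rewrite sub0r NegzE rmorphN.
exists (CodeSeq.code (map (fun i => CodeSeq.code (F i)) (iota 0 n))).
set z := CodeSeq.code _.
have ez i r : i < n -> entry z i r = nth 0 (F i) r.
  by move=> hi; rewrite /entry CodeSeq.codeK (nth_map 0) ?size_iota // CodeSeq.codeK nth_iota.
apply/andP; split.
  by apply/allP => i; rewrite mem_iota => /andP[_ hi]; rewrite ez //; have [-> -> _] := hF i hi.
apply/asboolP/HTP_cand_query => [i|]; first by rewrite en => hi; rewrite ez //; have [] := hF i hi.
rewrite -[RHS]e; apply: eq_big_seq => t /(allP (bounded_poly_terms k)); rewrite en => /allP ht; congr (_ * _)%R.
by apply: eq_big_seq => j /ht hj; rewrite /cand !ez //; have [_ _ ->] := hF j hj.
Qed.

Lemma cand_ok_sound ps k z : cand_ok ps k z ->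
  (forall i, i < poly_nvars k -> 0 < entry z i 2 /\ forall p, p \in ps -> ~~ (p %| entry z i 2)) /\
  eval (cand z) (poly_terms k) = 0%R.
Proof.
move=> /andP[/allP h /asboolP hq].
have h' i : i < poly_nvars k -> 0 < entry z i 2 /\ forall p, p \in ps -> ~~ (p %| entry z i 2).
  move=> hi; have /andP[h1 /allP h2] : (0 < entry z i 2) && all (fun p => ~~ (p %| entry z i 2)) ps.
    by apply: h; rewrite mem_iota nth0.
  by [].
by split=> //; apply/HTP_cand_query => // i /h'[].
Qed.

Lemma computable_cand_ok (T : Type) (cT : Code T) (ps : T -> seq nat) (k z : T -> nat) :
  let B := HTP [set: rat] in
  computable B ps -> computable B k -> computable B z -> computable B (fun x => cand_ok (ps x) (k x) (z x)).
Proof.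
move=> B hps hk hz; rewrite /cand_ok /cand_query /entry; cbv zeta.
computability.
Qed.
End Candidates.

(** * The colouring of the primes *)

Lemma computable_divn (B : set nat) (T : Type) (cT : Code T) (f : T -> nat) (m : nat) : 0 < m ->
  computable B f -> computable B (fun x => f x %/ m).
Proof.
move=> m0 hf; apply: (computable_ext (f := fun x => nat_rect (fun=> nat) 0 (fun j r => nat_of_bool (m %| j.+1) + r) (f x))).
  by move=> x; elim: (f x) => [|j /= ->]; rewrite ?div0n // divnS.
computability.
Qed.

Lemma computable_modn (B : set nat) (T : Type) (cT : Code T) (f : T -> nat) (m : nat) : 0 < m ->
  computable B f -> computable B (fun x => f x %% m).
Proof.
move=> m0 hf; apply: (computable_ext (f := fun x => f x - f x %/ m * m)).
  by move=> x; rewrite {1}(divn_eq (f x) m) addKn.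
have hd := computable_divn m0 hf; computability.
Qed.

Ltac computable_extra_step ::= lazymatch goal with
  | |- computable _ (fun x => @?f x %| @?g x) => apply: (computable_dvdn (f := f) (g := g))
  | |- computable _ (fun x => prime (@?f x)) => apply: (computable_prime (f := f))
  | |- computable _ (fun x => @?f x %/ ?m) => apply: (computable_divn (f := f)); first assumption
  | |- computable _ (fun x => @?f x %% ?m) => apply: (computable_modn (f := f)); first assumption
  end.

Section Construction.
Variables (R : realType) (m : nat).
Hypothesis m0 : 0 < m.
Notation B := (HTP [set: rat]).

(* In a pair [x = (n, s)], [s] is the list of the colours of the numbers [0], ..., [size s - 1], and stage
   [n] takes care of the polynomial [n %/ m] for the colour [n %% m]. *)
Implicit Types x : nat * seq nat.

Definition other_primes x := seq.filter (fun p => prime p && (nth 0 x.2 p != x.1 %% m)) (iota 0 (size x.2)).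
Definition other_odd_primes x := seq.filter odd (other_primes x).

(** Testing one period of residues [t] makes the anisotropy condition decidable, so that [c] can be
    found by minimization. *)
Definition small_ok x c := prime (4 * c).-1 &&
  all (fun p => all (fun t => ~~ (p %| t * t + t + c)) (iota 0 p)) (2 :: other_odd_primes x).

Lemma other_primes_prime x : all prime (other_primes x).
Proof. by apply/allP => p; rewrite mem_filter => /andP[/andP[]]. Qed.

Lemma other_odd_primesP x :
  [/\ uniq (other_odd_primes x), all prime (other_odd_primes x) & all odd (other_odd_primes x)].
Proof.
split; first by rewrite !filter_uniq ?iota_uniq.
  by apply/allP => p; rewrite mem_filter => /andP[_]; exact: (allP (other_primes_prime x)).
exact: filter_all.
Qed.

Lemma small_ex x : exists c, small_ok x c.
Proof.
have [h1 h2 h3] := other_odd_primesP x; have [c [c1 c2]] := good_params_exists R h1 h2 h3.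
exists c; rewrite /small_ok c1; apply/allP => p pin; apply/allP => t _.
by rewrite mulnn; exact: c2.
Qed.

Definition small x := ex_minn (small_ex x).

Lemma good_params_stage x :
  good_params (\prod_(p <- other_primes x) p) (2 * \prod_(p <- other_odd_primes x) p) (small x).
Proof.
have [h1 h2 h3] := other_odd_primesP x.
exists (other_odd_primes x); split=> //; rewrite /small; case: ex_minnP => c /andP[c1 /allP c2] _.
split=> //.
  (* The even part of the set is empty or just 2, which decides between the two allowed shapes of
     [N0]. *)
  have : \prod_(p <- seq.filter (predC odd) (other_primes x)) p = 1 \/
         \prod_(p <- seq.filter (predC odd) (other_primes x)) p = 2.
    have u : uniq (seq.filter (predC odd) (other_primes x)) by rewrite !filter_uniq ?iota_uniq.
    have a : all (pred1 2) (seq.filter (predC odd) (other_primes x)).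
      apply/allP => p; rewrite mem_filter => /andP[/= podd /(allP (other_primes_prime x)) pp].
      by case: (even_prime pp) podd => [->|->].
    move: u a; case: (seq.filter _ _) => [|p [|q s]] /=; first by rewrite big_nil; left.
      by rewrite andbT big_seq1 => _ /eqP ->; right.
    by case/andP=> h _ /and3P[/eqP e1 /eqP e2 _]; rewrite e1 e2 mem_head in h.
  rewrite [X in _ -> X = _ \/ X = _](bigID odd) /other_odd_primes !big_filter /=.
  by case=> ->; [left; rewrite muln1|right; rewrite mulnC].
move=> p t pin; have p0 : 0 < p.
  by move: pin; rewrite inE => /predU1P[->|/(allP h2)/prime_gt0].
have /allP/(_ (t %% p)) := c2 p pin; rewrite mem_iota /= add0n ltn_pmod // => /(_ isT).
have e : t ^ 2 + t + c = t %/ p * (t %/ p * p + 2 * (t %% p) + 1) * p + (t %% p * (t %% p) + t %% p + c).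
  by rewrite {1 2}(divn_eq t p); ring.
by rewrite e [X in _ -> ~~ X]dvdn_addr // dvdn_mull.
Qed.

Definition solvable x : bool := `[< B (query (\prod_(p <- other_primes x) p)
  (2 * \prod_(p <- other_odd_primes x) p) (small x) (x.1 %/ m)) >].

Lemma solvableP x : solvable x <-> HTP [set q | Zloc (\prod_(p <- other_primes x) p) q] (x.1 %/ m).
Proof. by rewrite -(HTP_query R _ (good_params_stage x)); split=> /asboolP. Qed.

(** The disjunction keeps the search total: for an unsolvable polynomial 0 is returned, and its
    entries only affect how far the colouring is extended. *)
Lemma witness_ex x : exists z, ~~ solvable x || cand_ok (other_primes x) (x.1 %/ m) z.
Proof.
case: (boolP (solvable x)) => /= [/solvableP h|_]; last by exists 0.
exact: cand_exists (other_primes_prime x) h.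
Qed.

Definition witness x := ex_minn (witness_ex x).

(** The conditions serve, in order, growth of the colouring, containment of the denominators of the
    zero, and density: the old numbers are few among the primes below [y]. *)
Definition bound_ok x y :=
  [&& size x.2 <= y,
      all (fun i => entry (witness x) i 2 <= y) (iota 0 (nth 0 (CodeSeq.decode (x.1 %/ m)) 0))
    & (x.1 + 2) * size x.2 <= count prime (iota 0 y)].

Lemma count_prime_unbounded n : exists y, n <= count prime (iota 0 y).
Proof.
elim: n => [|n [y hy]]; first by exists 0.
have [p yp pp] := prime_above y; exists p.+1.
have -> : p.+1 = y + (p.+1 - y) by rewrite subnKC // ltnW // ltnW.
rewrite iotaD count_cat -addn1 leq_add // -has_count; apply/hasP; exists p => //.
by rewrite mem_iota; move: yp; clear; lia.
Qed.

Lemma bound_ex x : exists y, bound_ok x y.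
Proof.
have [y1 h1] := count_prime_unbounded ((x.1 + 2) * size x.2).
pose s := map (fun i => entry (witness x) i 2) (iota 0 (nth 0 (CodeSeq.decode (x.1 %/ m)) 0)).
have hs i : i \in s -> i <= sumn s.
  by elim: s => //= a s IH; rewrite inE => /predU1P[->|/IH]; move: (sumn s); clear; lia.
exists (y1 + (size x.2 + sumn s)); apply/and3P; split; first by lia.
  by apply/allP => i hi; apply: leq_trans (hs _ (map_f _ hi)) _; lia.
by rewrite iotaD count_cat; apply: leq_trans h1 (leq_addr _ _).
Qed.

Definition bound x := ex_minn (bound_ex x).

Definition extend x := x.2 ++ nseq ((bound x).+1 - size x.2) (x.1 %% m).

Definition colouring n : seq nat := nat_rect (fun=> seq nat) [::] (fun n s => extend (n, s)) n.

Lemma computable_stage : computable B solvable /\ computable B extend.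
Proof.
have h1 : computable B other_primes by rewrite /other_primes; computability.
have h2 : computable B other_odd_primes by rewrite /other_odd_primes; computability.
have h3 : computable B small by apply: computable_search_pair; rewrite /small_ok; computability.
have h4 : computable B solvable by rewrite /solvable; computability; apply: computable_query; computability.
have h5 : computable B witness.
  by apply: computable_search_pair; computability; apply: computable_cand_ok; computability.
have h6 : computable B bound.
  by apply: computable_search_pair; rewrite /bound_ok /entry; computability.
by split=> //; rewrite /extend; computability.
Qed.

Lemma computable_colouring (T : Type) (cT : Code T) (f : T -> nat) :
  computable B f -> computable B (fun t => colouring (f t)).
Proof.
move=> hf; have [_ he] := computable_stage; rewrite /colouring; computability.
Qed.

Lemma bound_okP x : bound_ok x (bound x).
Proof. by rewrite /bound; case: ex_minnP. Qed.

Lemma size_extend x : size (extend x) = (bound x).+1.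
Proof.
rewrite size_cat size_nseq subnKC //; have /and3P[h _ _] := bound_okP x; exact: leqW.
Qed.

Lemma nth_extend x p : p < size x.2 -> nth 0 (extend x) p = nth 0 x.2 p.
Proof. by move=> hp; rewrite nth_cat hp. Qed.

Lemma nth_extend_new x p : size x.2 <= p <= bound x -> nth 0 (extend x) p = x.1 %% m.
Proof.
case/andP=> h1 h2; rewrite nth_cat ltnNge h1 /= nth_nseq ifT //.
by rewrite ltn_sub2r // ltnS // (leq_trans h1).
Qed.

Lemma leq_size_colouring n n' : n <= n' -> size (colouring n) <= size (colouring n').
Proof.
move=> /subnKC <-; elim: (n' - n) => [|j IH]; first by rewrite addn0.
by apply: leq_trans IH _; rewrite addnS [colouring _.+1]/= size_cat leq_addr.
Qed.

Lemma size_colouring n : n <= size (colouring n).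
Proof.
elim: n => // n IH; rewrite [colouring _]/= size_extend ltnS.
by have /and3P[h _ _] := bound_okP (n, colouring n); apply: leq_trans h.
Qed.

Lemma nth_colouring n n' p : n <= n' -> p < size (colouring n) ->
  nth 0 (colouring n') p = nth 0 (colouring n) p.
Proof.
move=> /subnKC <- hp; elim: (n' - n) => [|j IH]; first by rewrite addn0.
rewrite addnS [colouring _.+1]/= nth_extend //=.
by apply: leq_trans hp (leq_size_colouring _); exact: leq_addr.
Qed.

(** Stage [p.+1] has already coloured [p], by [size_colouring], and later stages never recolour. *)
Definition colour p := nth 0 (colouring p.+1) p.

Lemma colourE n p : p < size (colouring n) -> colour p = nth 0 (colouring n) p.
Proof.
move=> hp; rewrite /colour; case: (leqP n p.+1) => h; first exact: nth_colouring.
by symmetry; apply: nth_colouring; [exact: ltnW|exact: size_colouring].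
Qed.

Lemma colour_new n p : size (colouring n) <= p <= bound (n, colouring n) -> colour p = n %% m.
Proof.
move=> hp; rewrite (@colourE n.+1) [colouring n.+1]/=; last by rewrite size_extend ltnS; case/andP: hp.
exact: nth_extend_new.
Qed.

Lemma colour_lt p : colour p < m.
Proof.
have h n : all (fun c => c < m) (colouring n).
  by elim: n => //= n IH; rewrite all_cat IH all_nseq ltn_pmod // orbT.
by apply: (allP (h _)); apply: mem_nth; exact: size_colouring.
Qed.

Definition colour_class i : set nat := [set p | prime p /\ colour p = i].

Lemma Zinv_prime_factors (S : set nat) (a : int) (d : nat) : 0 < d ->
  (forall p, prime p -> p %| d -> S p) -> Zinv S (a%:~R / d%:R)%R.
Proof.
move=> d0 hd; suff [s [hs ds]] : exists s : seq nat, (forall p, p \in s -> S p) /\ d = \prod_(p <- s) p.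
  by exists a, s; split=> //; rewrite -ds.
elim/ltn_ind: d d0 hd => d IH d0 hd; have [d1|d1] := leqP d 1.
  by exists [::]; split=> //; rewrite big_nil; apply/eqP; rewrite eqn_leq d1.
have pp := pdiv_prime d1; have pd := pdiv_dvd d.
have e := divnK pd.
have [||p pp' pd'|s [hs ds]] := IH (d %/ pdiv d).
- by rewrite ltn_Pdiv // prime_gt1.
- by rewrite divn_gt0 ?prime_gt0 // dvdn_leq.
- by apply: hd => //; apply: dvdn_trans pd' _; rewrite -[X in _ %| X]e dvdn_mulr.
exists (pdiv d :: s); split; last by rewrite big_cons -ds mulnC e.
by move=> p; rewrite inE => /predU1P[->|/hs //]; exact: hd.
Qed.

Lemma Zinv_Zloc (S : set nat) (ps : seq nat) : (forall p, S p -> prime p) -> all prime ps ->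
  (forall p, p \in ps -> ~ S p) -> forall q, Zinv S q -> Zloc (\prod_(p <- ps) p) q.
Proof.
move=> Sp pps hS q [a [s [hs ->]]].
exists a, (\prod_(p <- s) p); split=> //.
  by rewrite big_seq; apply: prodn_cond_gt0 => p /hs/Sp/prime_gt0.
rewrite big_seq; elim/big_rec: _ => [|p n /hs sp]; first by rewrite coprime1n.
have pp := Sp _ sp; rewrite coprimeMl => ->; rewrite andbT prime_coprime //.
rewrite big_seq; elim/big_rec: _ => [|p' n' p'in]; first by rewrite dvdn1 gtn_eqF // prime_gt1.
have p'p : prime p' := allP pps _ p'in.
rewrite Euclid_dvdM // negb_or => ->; rewrite andbT dvdn_prime2 //.
by apply/eqP => pp'; apply: (hS p') => //; rewrite -pp'.
Qed.

(** The decision taken at the single stage [k * m + i] is final: the primes excluded there keep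
    their colours, and the zero found there is made available at once. *)
Lemma HTP_colour_class k i : i < m ->
  HTP (Zinv (colour_class i)) k <-> solvable (k * m + i, colouring (k * m + i)).
Proof.
move=> im; set n := k * m + i; set x := (n, colouring n).
have nk : n %/ m = k by rewrite divnMDl // divn_small // addn0.
have ni : n %% m = i by rewrite modnMDl modn_small.
have ops p : p \in other_primes x -> ~ colour_class i p.
  rewrite mem_filter mem_iota /= ni => /andP[/andP[pp /eqP hp] hs] [_ hc].
  by apply: hp; rewrite -hc; symmetry; apply: colourE.
split=> [/HTP_eval[v [hv e]]|hs].
  apply/solvableP; rewrite /= nk; apply/HTP_eval; exists v; split=> // j /hv.
  by apply: Zinv_Zloc => //; [move=> p []|exact: other_primes_prime].
have := bound_okP x; rewrite /bound_ok /= nk => /and3P[_ /allP hb _].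
have : cand_ok (other_primes x) k (witness x).
  by rewrite /witness; case: ex_minnP => z; rewrite hs /= nk.
move=> /cand_ok_sound[hd e]; apply/HTP_eval; exists (cand (witness x)); split=> // j jk.
have [d0 hp] := hd j jk.
have dy : entry (witness x) j 2 <= bound x by apply: hb; rewrite mem_iota nth0.
have -> : cand (witness x) j =
    (((entry (witness x) j 0)%:Z - (entry (witness x) j 1)%:Z)%:~R / (entry (witness x) j 2)%:R)%R by rewrite rmorphB.
apply: Zinv_prime_factors => // p pp pd; split=> //.
have py : p <= bound x by apply: leq_trans (dvdn_leq d0 pd) dy.
(* A prime of the denominator that is already coloured has colour [i], as the candidate avoids the
   other primes; a new one lies below the bound and receives colour [i]. *)
have [ps|ps] := ltnP p (size (colouring n)); last by rewrite (@colour_new n) ?ps.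
rewrite (colourE ps); apply/eqP; apply: contraT => h.
by have := hp p; rewrite mem_filter mem_iota pp ni /= h ps pd; apply.
Qed.

(** The last inequality says, without division, that the class has proportion at least 1 - 1 / (K +
    1) among the primes up to [y]. *)
Lemma colour_class_dense i K N : i < m -> exists y, [/\ N <= y, 0 < count prime (iota 0 y.+1) &
  (K + 1) * count prime (iota 0 y.+1) <= (K + 1) * count (fun p => prime p && (colour p == i)) (iota 0 y.+1) + count prime (iota 0 y.+1)].
Proof.
(* A stage for the colour [i] so late that both [n + 2 >= K + 1] and [y >= n >= N]. *)
move=> im; pose n := (K + N + 2) * m + i; have ni : n %% m = i by rewrite modnMDl modn_small.
have nn : K + N + 2 <= n by apply: leq_trans (leq_addr _ _); rewrite leq_pmulr.
pose y := bound (n, colouring n); exists y.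
have := bound_okP (n, colouring n); rewrite -/y => /and3P[/= h1 _ h2].
have sn := size_colouring n.
have e : y.+1 = size (colouring n) + (y.+1 - size (colouring n)) by rewrite subnKC // leqW.
have c1 : count (fun p => prime p && (colour p == i)) (iota (size (colouring n)) (y.+1 - size (colouring n))) =
    count prime (iota (size (colouring n)) (y.+1 - size (colouring n))).
  apply: eq_in_count => p; rewrite mem_iota -e ltnS => hp.
  by rewrite (@colour_new n) // ni eqxx andbT.
have c2 : count prime (iota 0 (size (colouring n))) <= size (colouring n).
  by rewrite -[X in _ <= X](size_iota 0) count_size.
have c3 : count prime (iota 0 y) <= count prime (iota 0 y.+1).
  by rewrite -addn1 iotaD count_cat leq_addr.
have c4 : count prime (iota 0 y.+1) = count prime (iota 0 (size (colouring n))) + 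
   count prime (iota (size (colouring n)) (y.+1 - size (colouring n))) by rewrite {1}e iotaD count_cat.
have c5 : count prime (iota (size (colouring n)) (y.+1 - size (colouring n))) <= 
    count (fun p => prime p && (colour p == i)) (iota 0 y.+1) by rewrite {2}e iotaD count_cat add0n c1 leq_addl.
have c6 : (K + 1) * size (colouring n) <= (n + 2) * size (colouring n).
  by rewrite leq_mul2r; move: nn; clear; lia.
have c7 : (n + 2) * size (colouring n) <= count prime (iota 0 y.+1) by apply: leq_trans c3.
have c8 : 0 < size (colouring n) by apply: leq_trans sn; move: nn; clear; lia.
have c9 : (K + 1) * count prime (iota 0 y.+1) <=
    (K + 1) * count (fun p => prime p && (colour p == i)) (iota 0 y.+1) + count prime (iota 0 y.+1).
  rewrite {1}c4 mulnDr addnC leq_add //; first by rewrite leq_mul2l c5 orbT.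
  by apply: leq_trans c7; apply: leq_trans c6; rewrite leq_mul2l c2 orbT.
split=> //; first by apply: leq_trans h1; apply: leq_trans sn; move: nn; clear; lia.
by apply: leq_trans c7; rewrite muln_gt0 c8 addn2.
Qed.

Lemma turing_le_computable (A : set nat) (f : nat -> bool) :
  computable B f -> (forall k, A k <-> f k) -> turing_le A B.
Proof.
move=> [g [c hc] gf] Af; exists c => k; have := hc [tuple k]; rewrite /= /thead (tnth_nth 0) /= [g k]gf.
by move=> h; split=> Ak; move: h; [have -> : f k by apply/Af|have -> : f k = false by apply/negP => /Af].
Qed.

Lemma turing_le_colour_class i : i < m ->
  turing_le (HTP (Zinv (colour_class i))) B /\ turing_le (colour_class i) B.
Proof.
move=> im; have [cs _] := computable_stage; have cc : computable B colouring by exact: computable_colouring (computable_id _ ).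
split.
  apply: turing_le_computable (fun k => HTP_colour_class k im).
  by computability.
apply: (@turing_le_computable _ (fun p => prime p && (colour p == i))).
  rewrite /colour; computability.
move=> p; split=> [[-> ->]|/andP[pp /eqP]]; by rewrite ?eqxx.
Qed.

End Construction.

(** * Upper density *)

Lemma limn_esup_eq1 (R : realType) (u : nat -> \bar R) : (forall x, u x <= 1)%E ->
  (forall K N, exists2 x, N <= x & ((1 - K.+1%:R^-1)%:E <= u x)%E) -> limn_esup u = 1%E.
Proof.
move=> u1 hu; apply/eqP; rewrite eq_le; apply/andP; split.
  apply: (@le_trans _ _ (ereal_sup (range u))).
    by apply: ereal_inf_lbound; exists setT => //; exact: filterT.
  by apply: ub_ereal_sup => _ [x _ <-].
apply: le_ereal_inf_tmp => _ [V [N _ hV] <-]; apply/lee_addgt0Pr => e e0.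
(* The index is chosen so that the defect of [u x] is at most [e]. *)
have [x Nx hx] := hu (Num.bound e^-1)%R N.
have : (u x <= ereal_sup [set u y | y in V])%E by apply: ereal_sup_ubound; exists x => //; exact: hV.
move=> /(le_trans hx) h; apply: le_trans (leeD2r _ h).
rewrite -EFinD lee_fin -addrA lerDl addrC subr_ge0.
have e'0 : (0 < e^-1)%R by rewrite invr_gt0.
rewrite invf_ple ?posrE // ?ltr0n //; apply: le_trans (ltW (archi_boundP (ltW e'0))) _.
by rewrite ler_nat.
Qed.

Lemma primes_uptoE (S : set nat) x :
  primes_upto S x = count (fun p => prime p && `[< S p >]) (iota 0 x.+1).
Proof.
by rewrite /primes_upto cardsE cardE /enum_mem size_filter -enumT -val_enum_ord count_map.
Qed.

Lemma upper_density_eq1 (R : realType) (S : set nat) :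
  (forall K N, exists x, [/\ N <= x, 0 < primes_upto [set: nat] x &
    (K + 1) * primes_upto [set: nat] x <= (K + 1) * primes_upto S x + primes_upto [set: nat] x]) ->
  upper_density R S = 1%E.
Proof.
move=> h; apply: limn_esup_eq1 => [x|K N].
  have le : primes_upto S x <= primes_upto [set: nat] x.
    rewrite !primes_uptoE; apply: sub_count => p /andP[-> _] /=; exact/asboolP.
  rewrite lee_fin; have [->|pos] := posnP (primes_upto [set: nat] x); first by rewrite invr0 mulr0 ler01.
  by rewrite ler_pdivrMr ?ltr0n // mul1r ler_nat.
have [x [Nx pos le]] := h K N; exists x => //.
rewrite lee_fin ler_pdivlMr ?ltr0n // mulrBl mul1r lerBlDr -(ler_pM2l (_ : 0 < K.+1%:R)%R) ?ltr0n //.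
by rewrite mulrDr mulVKf ?pnatr_eq0 // -!natrM -natrD ler_nat -addn1.
Qed.

Theorem theorem3p18 (R : realType) (m : nat) (hm : (0 < m)%N) :
  exists S : 'I_m -> set nat,
    [/\ (\bigcup_(i in [set: 'I_m]) S i = [set p : nat | prime p])%classic,
        trivIset [set: 'I_m]%classic S,
        forall i, upper_density R (S i) = 1%E
      & forall i, turing_le (HTP (Zinv (S i))) (HTP [set: rat]%classic)
                  /\ turing_le (S i) (HTP [set: rat]%classic)].
Proof.
exists (fun i => colour_class R hm i); split=> [|i j _ _ [p [[_ pi] [_ pj]]]|i|i].
- apply/seteqP; split=> [p [i _ []]|p pp] //.
  by exists (Ordinal (colour_lt R hm p)).
- by apply: val_inj; rewrite /= -pi -pj.
- apply: upper_density_eq1 => K N.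
  have [y [h1 h2 h3]] := colour_class_dense R hm K N (ltn_ord i); exists y.
  have eT : primes_upto [set: nat] y = count prime (iota 0 y.+1).
    by rewrite primes_uptoE; apply: eq_count => p /=; rewrite asboolT ?andbT.
  have eS : primes_upto (colour_class R hm i) y = count (fun p => prime p && (colour R hm p == i)) (iota 0 y.+1).
    rewrite primes_uptoE; apply: eq_count => p; case: (boolP (prime p)) => //= pp.
    by apply/asboolP/eqP => [[]|].
  by rewrite eT eS.
exact: turing_le_colour_class.
Qed.
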